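(* Let $u$ be a unit, let $v=1/u$, $C=\int_0^1 v(s)^2\,ds$, $m(s)=C^{-1}v(s)^2$, and let $(\Omega,P)$ be the associated pentagon with its probability measure (defined in the context). Then the sequence of $u$-weighted Farey sets $\mathcal F_u(Q)$, $Q=1,2,3,\ldots$, has a cumulative gap distribution $H_u$, i.e. for every $z\in\mathbb R_{\ge 0}$ the limit \[ H_u(z)=\lim_{Q\to\infty}\frac{\sharp\{0\le i<n(Q): n(Q)(s_{i+1}-s_i)\le z\}}{n(Q)} \] exists (here $\mathcal F_u(Q)=\{0=s_0<s_1<\cdots<s_{n(Q)-1}\}$ and $s_{n(Q)}=1$), and $H_u$ is the cumulative distribution function of the random variable \[ Z:(\Omega,P)\to\mathbb R_{>0},\qquad (x,y)\mapsto \frac{C}{2\,\zeta(2)\,xy}. \] Also, \[ P(Z\le z)=\int_0^1 H_{\mathbf 1}\bigl(m(s)\,z\bigr)\,m(s)\,ds , \] so that $H_u(z)=\int_0^1 H_{\mathbf 1}(m(s)z)\,m(s)\,ds$.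
   Context: A unit is a function $u:[0,1]\to\mathbb R_{>0}$ such that (i) $u$ is continuous; (ii) $[0,1]$ can be partitioned into finitely many subintervals $[s,s']$ (endpoints not necessarily rational), overlapping only at endpoints, such that $u$ is $C^1$ with bounded first derivative on each $(s,s')$. Rational numbers $p/q$ are written in reduced form with $q>0$. The $u$-weighted Farey set $\mathcal F_u(Q)$ is the finite set of all rational $p/q\in[0,1)$ with $u(p/q)\,q\le Q$; $n(Q)=\sharp\mathcal F_u(Q)$, and $Q$ is always taken large enough that $0\in\mathcal F_u(Q)$. $\zeta$ is the Riemann zeta function, $\zeta(2)=\pi^2/6$. Let $l$ and $L$ be the minimum and maximum of $v=1/u$ on $[0,1]$. For $w>0$ let $\Omega_w=\{(x,y)\in\mathbb R_{>0}^2: x,y\le w<x+y\}$ and let $P_w$ be Lebesgue measure on $\Omega_w$ normalized by $P_w(\Omega_w)=1$. Let $\Omega=\bigcup_{w\in[l,L]}\Omega_w=\{(x,y): 0<x,y\le L,\ l<x+y\}$, and let $P$ be the probability measure on $\Omega$ defined by $P=\int_0^1 P_{v(s)}\,m(s)\,ds$, i.e. $\int f\,dP=\int_0^1\bigl[\int f\,dP_{v(s)}\bigr]m(s)\,ds$. $H_{\mathbf 1}$ is the cumulative distribution function of the random variable $Z_1(x,y)=\bigl(2\,\zeta(2)\,xy\bigr)^{-1}$ on $(\Omega_1,P_1)$, that is, $H_{\mathbf 1}(z)=P_1(Z_1\le z)$. *)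

(* Defs.v *)
From HB Require Import structures.
From mathcomp Require Import all_boot all_order all_algebra.
From mathcomp Require Import finmap.
From mathcomp Require Import all_classical all_reals all_analysis.
From mathcomp Require Import measurable_realfun.
From mathcomp Require Import ring lra.

Set Implicit Arguments.
Unset Strict Implicit.
Unset Printing Implicit Defensive.
Import Order.TTheory GRing.Theory Num.Theory.
Import numFieldNormedType.Exports.
Local Open Scope classical_set_scope.
Local Open Scope ring_scope.

Section units.
Context {R : realType}.

Definition piecewise_C1 (f : R -> R) :=
  exists2 t : seq R, itv_partition 0 1 t &
    forall i, (i < size t)%N ->
      let I := (`]nth 0 (0 :: t) i, nth 0 t i[) in
      [/\ {in I, forall x, derivable f x 1},
          {in I, continuous (derive1 f)} &
          exists M : R, {in I, forall x, `|derive1 f x| <= M}].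

(* Only the values on [0, 1] matter; nothing is required outside. *)
Record farey_unit := FareyUnit {
  unit_fun :> R -> R ;
  unit_gt0 : {in `[0, 1], forall x, 0 < unit_fun x} ;
  unit_continuous : {within `[0, 1], continuous unit_fun} ;
  unit_piecewise_C1 : piecewise_C1 unit_fun }.

End units.
Arguments farey_unit : clear implicits.

Section farey_sets.
Context {R : realType}.
Implicit Types (u : farey_unit R) (Q : nat).

Definition farey_set u Q : set rat :=
  [set r | 0 <= r < 1 /\ u (ratr r) * (denq r)%:~R <= Q%:R].

Lemma finite_farey_set u Q : finite_set (farey_set u Q).
Proof.
have [c c01 cP] := @EVT_min R u 0 1 ler01 (@unit_continuous _ u).
have uc0 : 0 < u c by exact: unit_gt0.
have [N QN] : exists N : nat, Q%:R / u c < N%:R.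
  exists (Num.bound (Q%:R / u c)).
  by apply: archi_boundP; rewrite divr_ge0// ltW.
apply: (@sub_finite_set _ _
  ((fun p : nat * nat => p.1%:R / p.2%:R) @` (`I_N `*` `I_N))); last first.
  by apply: finite_image; apply: finite_setX; exact: finite_II.
move=> r [/andP[r0 r1] rQ].
have dE : (`|denq r|%:R : R) = (denq r)%:~R by rewrite natr_absz gtr0_norm.
have dN : (`|denq r| < N)%N.
  rewrite -(ltr_nat R); apply: le_lt_trans QN.
  rewrite ler_pdivlMr// (le_trans _ rQ)// mulrC dE ler_wpM2r//.
    by rewrite ler0z ltW// denq_gt0.
  by apply: cP; rewrite in_itv/= ler0q r0/= -[leRHS](ratr_nat R 1) ler_rat ltW.
have n0 : 0 <= numq r by rewrite numq_ge0.
exists (`|numq r|, `|denq r|)%N => /=.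
  split => //=; apply: ltn_trans dN.
  rewrite -ltz_nat gez0_abs// absz_denq -(ltr_int rat).
  by rewrite -[X in _ < X]mul1r -ltr_pdivrMr ?ltr0z ?denq_gt0// divq_num_den.
by rewrite -[RHS]divq_num_den !natr_absz (ger0_norm n0) gtr0_norm.
Qed.

Definition farey_card u Q : nat := #|` fset_set (farey_set u Q)|.

(* s_0 < ... < s_(n(Q) - 1), followed by s_(n(Q)) = 1. The default of [fset_set]
   on infinite sets plays no role, by [finite_farey_set]. *)
Definition farey_seq u Q : seq R :=
  rcons [seq ratr r | r <- sort <=%R (fset_set (farey_set u Q))] 1.

Definition farey_gap u Q (i : nat) : R :=
  nth 0 (farey_seq u Q) i.+1 - nth 0 (farey_seq u Q) i.

Definition farey_gap_ratio u (z : R) Q : R :=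
  let n := farey_card u Q in
  #|[pred i : 'I_n | n%:R * farey_gap u Q i <= z]|%:R / n%:R.

Definition cumulative_gap u (z : R) : R := limn (farey_gap_ratio u z).

End farey_sets.

Section probability_P_.
Context {R : realType}.
Notation T := (measurableTypeR R * measurableTypeR R)%type.
Notation leb := (@lebesgue_measure R).

Definition Omega_ (w : R) : set T :=
  [set p | [/\ 0 < p.1, 0 < p.2, p.1 <= w, p.2 <= w & w < p.1 + p.2]].

Let graph : set (measurableTypeR R * T) := [set q | Omega_ q.1 q.2].

Let measurable_graph : measurable graph.
Proof.
have m1 : measurable_fun [set: measurableTypeR R * T] (fun q => q.1).
  exact: measurable_fst.
have m2 : measurable_fun [set: measurableTypeR R * T] (fun q => q.2.1).
  exact: measurableT_comp.
have m3 : measurable_fun [set: measurableTypeR R * T] (fun q => q.2.2).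
  exact: measurableT_comp.
pose b (q : measurableTypeR R * T) :=
  (0 < q.2.1) && ((0 < q.2.2) && ((q.2.1 <= q.1) &&
    ((q.2.2 <= q.1) && (q.1 < q.2.1 + q.2.2)))).
have mb : measurable_fun setT b.
  apply: measurable_and; first exact: measurable_fun_ltr.
  apply: measurable_and; first exact: measurable_fun_ltr.
  apply: measurable_and; first exact: measurable_fun_ler.
  apply: measurable_and; first exact: measurable_fun_ler.
  by apply: measurable_fun_ltr => //; exact: measurable_funD.
have -> : graph = setT `&` b @^-1` [set true].
  rewrite setTI; apply/seteqP; split => q /=; rewrite /b /graph /Omega_ /=.
    by case=> -> -> -> -> ->.
  by move=> /and5P[].
exact: mb.
Qed.

Let Omega_E w : Omega_ w = xsection graph w.
Proof. by apply/seteqP; split => p; rewrite /xsection /= inE. Qed.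

Lemma measurable_Omega_ w : measurable (Omega_ w).
Proof. by rewrite Omega_E; exact: measurable_xsection. Qed.

Definition leb_Omega_ (w : R) : {measure set T -> \bar R} :=
  mrestr (leb \x leb)%E (measurable_Omega_ w).

(* The Dirac measure is only the value of [mnormalize] on null or infinite
   measures, hence irrelevant for w > 0, see [P_Omega_]. *)
Definition P_ (w : R) : probability T R :=
  mnormalize (leb_Omega_ w) (dirac ((0, 0) : T)).

Let leb2_sigma_finite : sigma_finite [set: T] (leb \x leb)%E.
Proof.
have /sigma_finiteP[F [TF ndF Foo]] := sigma_finiteT leb.
exists (fun n => F n `*` F n).
  rewrite -setXTT TF predeqE => -[x y]; split.
    move=> [/= [n _ Fnx] [k _ Fky]]; exists (maxn n k) => //; split.
    - by move: x Fnx; exact/subsetPset/ndF/leq_maxl.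
    - by move: y Fky; exact/subsetPset/ndF/leq_maxr.
  by move=> [n _ []/= ? ?]; split; exists n.
move=> k; have [? ?] := Foo k.
split; first exact: measurableX.
by rewrite product_measure1E// lte_mul_pinfty// ge0_fin_numE.
Qed.

Lemma measurable_P_ (A : set T) : measurable A ->
  measurable_fun [set: measurableTypeR R] (fun w => P_ w A).
Proof.
move=> mA.
have mk (U : set T) : measurable U ->
    measurable_fun [set: measurableTypeR R] (leb_Omega_ ^~ U).
  move=> mU.
  pose B : set (measurableTypeR R * T) := graph `&` (snd @^-1` U).
  have mB : measurable B.
    apply: measurableI => //; rewrite -[X in measurable X]setTI.
    exact: measurable_snd.
  rewrite (_ : leb_Omega_ ^~ U = (leb \x leb)%E \o xsection B).
    pose sf := Measure_isSigmaFinite.Build _ _ _ (leb \x leb)%E leb2_sigma_finite.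
    pose leb2 : {sigma_finite_measure set T -> \bar R} :=
      HB.pack (leb \x leb)%E sf.
    exact: (measurable_fun_xsection leb2 mB).
  apply/funext => w /=; rewrite /leb_Omega_ /= /mrestr; congr (product_measure1 _ _ _).
  apply/seteqP; split => p; rewrite /xsection /= inE.
    by move=> [].
  by move=> [].
pose ik := isKernel.Build _ _ _ _ _ (leb_Omega_ : measurableTypeR R -> _) mk.
pose k : R.-ker (measurableTypeR R) ~> T := HB.pack (leb_Omega_ : measurableTypeR R -> _) ik.
exact: (measurable_kernel (knormalize k (dirac ((0, 0) : T))) A mA).
Qed.

Lemma P_Omega_ w : 0 < w -> P_ w (Omega_ w) = 1%E.
Proof.
move=> w0.
have mO := measurable_Omega_ w.
have mw a b : measurable (`]a, b]%classic `*` `]a, b]%classic : set T).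
  exact: measurableX.
have ltoo : ((leb \x leb)%E (Omega_ w) < +oo)%E.
  apply: (@le_lt_trans _ _ ((leb \x leb)%E (`]0, w] `*` `]0, w]))).
    apply: le_measure; rewrite ?inE//.
    by move=> [x y] [/= x0 y0 xw yw _]; split; rewrite /= in_itv/=; apply/andP.
  rewrite product_measure1E//= lebesgue_measure_itv/= lte_fin w0.
  by rewrite -EFinB -EFinM ltry.
have gt0 : (0 < (leb \x leb)%E (Omega_ w))%E.
  apply: (@lt_le_trans _ _ ((leb \x leb)%E (`](w / 2), w] `*` `](w / 2), w]))).
    rewrite product_measure1E//= lebesgue_measure_itv/= lte_fin.
    rewrite ifT; last by lra.
    by rewrite -EFinB -EFinM lte_fin mulr_gt0//; lra.
  apply: le_measure; rewrite ?inE//.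
  move=> [x y] [/=]; rewrite !in_itv/= => /andP[wx xw] /andP[wy yw].
  by split => /=; lra.
have -> : P_ w (Omega_ w) = mnormalize (leb_Omega_ w) (dirac ((0, 0) : T))
    (Omega_ w) by [].
rewrite /mnormalize /leb_Omega_ /= /mrestr setTI.
rewrite gt_eqF//= lt_eqF//= setIid.
rewrite -[X in (X * _)%E]fineK ?ge0_fin_numE ?ltW//.
by rewrite -EFinM divff// gt_eqF// fine_gt0// gt0.
Qed.

End probability_P_.

Section pentagon.
Context {R : realType}.
Variable u : farey_unit R.
Notation T := (measurableTypeR R * measurableTypeR R)%type.
Notation leb := (@lebesgue_measure R).

(* v, C and m *)
Definition unit_inv (s : R) : R := (u s)^-1.

Definition unit_mass : R := \int[leb]_(s in `[0, 1]) (unit_inv s ^+ 2).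

Definition unit_density (s : R) : R := unit_mass^-1 * unit_inv s ^+ 2.

Definition pentagon : set T :=
  let V := unit_inv @` `[0, 1] in \bigcup_(w in `[inf V, sup V]) Omega_ w.

(* A measure on the plane, carried by the pentagon, see
   [pentagon_prob_pentagon]. *)
Definition pentagon_prob (A : set T) : \bar R :=
  (\int[leb]_(s in `[0%R, 1%R]) (P_ (unit_inv s) A * (unit_density s)%:E))%E.

Lemma unit_inv_gt0 : {in `[0, 1], forall s, 0 < unit_inv s}.
Proof. by move=> s s01; rewrite invr_gt0 unit_gt0. Qed.

Lemma unit_inv_continuous : {within `[0, 1], continuous unit_inv}.
Proof.
rewrite continuous_subspace_in => s s01.
apply: cvgV; last exact: (@unit_continuous _ u s).
by rewrite gt_eqF// unit_gt0//; rewrite inE in s01.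
Qed.

Lemma unit_inv_has_inf : has_inf (unit_inv @` `[0, 1]).
Proof.
have [c _ cP] := @EVT_min R unit_inv 0 1 ler01 unit_inv_continuous.
split; first by exists (unit_inv 0), 0 => //=; rewrite in_itv/= lexx ler01.
by exists (unit_inv c) => _ [s s01 <-]; exact: cP.
Qed.

Lemma unit_inv_has_sup : has_sup (unit_inv @` `[0, 1]).
Proof.
have [c _ cP] := @EVT_max R unit_inv 0 1 ler01 unit_inv_continuous.
split; first by exists (unit_inv 0), 0 => //=; rewrite in_itv/= lexx ler01.
by exists (unit_inv c) => _ [s s01 <-]; exact: cP.
Qed.

Let mI : measurable (`[0, 1]%classic : set (measurableTypeR R)).
Proof. exact: measurable_itv. Qed.

Let measurable_unit_inv : measurable_fun (`[0, 1] : set (measurableTypeR R)) unit_inv.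
Proof.
apply: subspace_continuous_measurable_fun; first exact: mI.
exact: unit_inv_continuous.
Qed.

Let sqr_continuous : {within `[0, 1], continuous (fun s => unit_inv s ^+ 2)}.
Proof.
move=> s; have uc := @unit_inv_continuous s.
exact: (cvg_comp unit_inv (fun x : R => x ^+ 2) uc (@exprn_continuous R 2 _)).
Qed.

Let sqr_integrable :
  leb.-integrable `[0, 1] (EFin \o (fun s => unit_inv s ^+ 2)).
Proof.
by apply: continuous_compact_integrable; [exact: segment_compact|exact: sqr_continuous].
Qed.

Lemma unit_mass_gt0 : 0 < unit_mass.
Proof.
have [c c01 cP] := @EVT_min R unit_inv 0 1 ler01 unit_inv_continuous.
have c0 := unit_inv_gt0 c01.
apply: (@lt_le_trans _ _ (unit_inv c ^+ 2)); first by rewrite exprn_gt0.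
rewrite -lee_fin /unit_mass /Rintegral fineK; last first.
  exact: integrable_fin_num.
apply: (@le_trans _ _ (\int[leb]_(s in `[0%R, 1%R]) (unit_inv c ^+ 2)%:E)%E).
  by rewrite integral_cst//= lebesgue_measure_itv/= lte_fin ltr01 oppr0 adde0 mule1.
apply: ge0_le_integral => //.
- by move=> s _; rewrite lee_fin exprn_ge0// ltW.
- by move/integrableP : sqr_integrable => [].
- move=> s s01; rewrite lee_fin lerXn2r ?nnegrE ?(ltW c0)//; last exact: cP.
  exact/ltW/unit_inv_gt0.
Qed.

Lemma unit_density_ge0 s : 0 <= unit_density s.
Proof. by rewrite mulr_ge0 ?invr_ge0 ?sqr_ge0// ltW ?unit_mass_gt0. Qed.

Let measurable_density :
  measurable_fun (`[0, 1] : set (measurableTypeR R)) (EFin \o unit_density).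
Proof.
apply/measurable_EFinP; apply: measurable_funM => //.
by apply/measurable_EFinP; move/integrableP : sqr_integrable => [].
Qed.

Lemma integral_density :
  (\int[leb]_(s in `[0%R, 1%R]) (unit_density s)%:E = 1)%E.
Proof.
under eq_integral do rewrite EFinM.
rewrite integralZl//.
have -> : (\int[leb]_(s in `[0%R, 1%R]) (unit_inv s ^+ 2)%:E = unit_mass%:E)%E.
  by rewrite /unit_mass /Rintegral fineK//; exact: integrable_fin_num.
by rewrite -EFinM mulVf// gt_eqF// unit_mass_gt0.
Qed.

Let measurable_integrand A : measurable A ->
  measurable_fun (`[0, 1] : set (measurableTypeR R))
    (fun s => P_ (unit_inv s) A * (unit_density s)%:E)%E.
Proof.
move=> mA; apply: emeasurable_funM; last exact: measurable_density.
exact: (measurableT_comp (measurable_P_ mA) measurable_unit_inv).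
Qed.

Let prob0 : pentagon_prob set0 = 0%E.
Proof.
rewrite /pentagon_prob; under eq_integral do rewrite measure0 mul0e.
exact: integral0.
Qed.

Let integrand_ge0 A s : (0 <= P_ (unit_inv s) A * (unit_density s)%:E)%E.
Proof. by rewrite mule_ge0// lee_fin unit_density_ge0. Qed.

Let prob_ge0 A : (0 <= pentagon_prob A)%E.
Proof. by apply: integral_ge0 => s _; exact: integrand_ge0. Qed.

Let prob_sigma_additive : semi_sigma_additive pentagon_prob.
Proof.
move=> F mF tF mUF; rewrite [X in _ --> X](_ : _ =
  (\int[leb]_(s in `[0%R, 1%R])
     (\sum_(n <oo) (P_ (unit_inv s) (F n) * (unit_density s)%:E)))%E); last first.
  apply: eq_integral => s _.
  under eq_eseriesr do rewrite muleC.
  rewrite nneseriesZl ?lee_fin ?unit_density_ge0// muleC; congr (_ * _)%E.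
  by apply/esym/cvg_lim => //; exact: measure_semi_sigma_additive.
apply/cvg_closeP; split.
  by apply: is_cvg_nneseries => n _ _; exact: prob_ge0.
rewrite closeE// integral_nneseries// => n.
exact: measurable_integrand.
Qed.

HB.instance Definition _ := isMeasure.Build _ _ _ pentagon_prob
  prob0 prob_ge0 prob_sigma_additive.

Let prob_setT : pentagon_prob setT = 1%E.
Proof.
rewrite /pentagon_prob; under eq_integral do rewrite probability_setT mul1e.
exact: integral_density.
Qed.

HB.instance Definition _ :=
  Measure_isProbability.Build _ _ _ pentagon_prob prob_setT.

Lemma pentagonE :
  let V := unit_inv @` `[0, 1] in
  pentagon = [set p | [/\ 0 < p.1 <= sup V, 0 < p.2 <= sup V &
                          inf V < p.1 + p.2]].
Proof.
have lL : inf (unit_inv @` `[0, 1]) <= sup (unit_inv @` `[0, 1]).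
  have V0 : (unit_inv @` `[0, 1]) (unit_inv 0).
    by exists 0 => //=; rewrite in_itv/= lexx ler01.
  apply: (@le_trans _ _ (unit_inv 0)).
    by apply: ge_inf => //; case: unit_inv_has_inf.
  by apply: ub_le_sup => //; case: unit_inv_has_sup.
rewrite /pentagon /=; set l := inf _ in lL *; set L := sup _ in lL *.
apply/seteqP; split => [[x y] [w /=]|[x y] /=].
  rewrite in_itv/= => /andP[lw wL] [/= x0 y0 xw yw wxy].
  by rewrite x0 y0/=; split; lra.
move=> [/andP[x0 xL] /andP[y0 yL] lxy].
exists (Num.max l (Num.max x y)).
  by rewrite /= in_itv/= le_max lexx/= !ge_max lL xL yL.
by split => //=; rewrite ?le_max ?lexx ?orbT// !gt_max lxy/=; lra.
Qed.

Lemma measurable_pentagon : measurable pentagon.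
Proof.
rewrite pentagonE /=; set l := inf _; set L := sup _.
have mf : measurable_fun [set: T] (fun p => p.1) by exact: measurable_fst.
have ms : measurable_fun [set: T] (fun p => p.2) by exact: measurable_snd.
pose b (p : T) := (0 < p.1 <= L) && ((0 < p.2 <= L) && (l < p.1 + p.2)).
have mb : measurable_fun setT b.
  apply: measurable_and.
    by apply: measurable_and; [exact: measurable_fun_ltr|exact: measurable_fun_ler].
  apply: measurable_and.
    by apply: measurable_and; [exact: measurable_fun_ltr|exact: measurable_fun_ler].
  by apply: measurable_fun_ltr => //; exact: measurable_funD.
rewrite (_ : mkset _ = setT `&` b @^-1` [set true]); first exact: mb.
by rewrite setTI; apply/seteqP; split => p; rewrite /b /= => /and3P.
Qed.

Lemma pentagon_prob_pentagon : pentagon_prob pentagon = 1%E.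
Proof.
rewrite -integral_density; apply: eq_integral => s; rewrite inE => s01.
rewrite (_ : P_ _ _ = 1%E) ?mul1e//.
apply/eqP; rewrite eq_le probability_le1/=; last exact: measurable_pentagon.
rewrite -(P_Omega_ (unit_inv_gt0 s01)); apply: le_measure; rewrite ?inE.
- exact: measurable_Omega_.
- exact: measurable_pentagon.
- move=> p ps; exists (unit_inv s) => //=; rewrite in_itv/=; apply/andP; split.
    by apply: ge_inf; [case: unit_inv_has_inf|exists s].
  by apply: ub_le_sup; [case: unit_inv_has_sup|exists s].
Qed.

End pentagon.

Section gap_variable.
Context {R : realType}.
Notation T := (measurableTypeR R * measurableTypeR R)%type.

Definition zeta (s : R) : R :=
  limn (series (fun n : nat => n.+1%:R `^ (- s))).

(* The value outside x, y > 0 is irrelevant: the measures used are carried by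
   this quadrant. *)
Definition gap_fun (c : R) (p : T) : R := c / (2 * zeta 2 * p.1 * p.2).

Let measurable_gap_fun c : measurable_fun setT (gap_fun c).
Proof.
have mV : measurable_fun [set: R] (@GRing.inv R).
  rewrite (_ : @GRing.inv R = fun x => if x == 0 then 0 else x^-1); last first.
    by apply/funext => x; case: eqP => // ->; rewrite invr0.
  apply: measurable_fun_if => //.
    exact: measurable_fun_eqr.
  rewrite setTI; apply: open_continuous_measurable_fun.
    rewrite (_ : _ @^-1` _ = [set x | x != 0]); first exact: open_neq.
    by apply/seteqP; split => x /=; case: (x == 0).
  by move=> x; rewrite inE/= => /negbT x0; exact: inv_continuous.
apply: measurable_funM => //; apply: measurableT_comp => //.
by apply: measurable_funM => //; apply: measurable_funM.
Qed.

HB.instance Definition _ c :=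
  isMeasurableFun.Build _ _ _ _ (gap_fun c) (measurable_gap_fun c).

Definition gap_var (u : farey_unit R) : {RV (pentagon_prob u) >-> R} :=
  gap_fun (unit_mass u).

Definition gap_var1 : {RV (P_ (1 : R)) >-> R} := gap_fun 1.

End gap_variable.

(* Main.v *)
Require Import Defs.
From HB Require Import structures.
From mathcomp Require Import all_boot all_order all_algebra.
From mathcomp Require Import finmap cyclic.
From mathcomp Require Import all_classical all_reals all_analysis.
From mathcomp Require Import measurable_realfun.
From mathcomp Require Import ring lra zify.
Set Implicit Arguments.
Unset Strict Implicit.
Unset Printing Implicit Defensive.
Import Order.TTheory GRing.Theory Num.Theory.
Import numFieldNormedType.Exports.
Local Open Scope classical_set_scope.
Local Open Scope ring_scope.

(** The proof counts gaps through the points that begin them. A point of a set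
    is called followed within t if the set contains a larger point at distance
    at most t; with n = n(Q) and t = z / n, the numerator of the gap ratio is
    the number of points of F_u(Q), completed by 1, that are followed within t.
    This count is stable: on an interval, replacing a set by a larger one
    changes it by at most twice the number of added points, plus one
    ([followed_count_lower], [followed_count_upper]). Cut [0, 1] into pieces on
    which l <= v <= L with l and L close. On such a piece F_u(Q) lies between
    the classical Farey sets of real orders Q l and Q L, so it suffices to
    count followed points of classical Farey sets on short intervals, to let
    Q grow, and then to refine the pieces ([card_estimate],
    [followed_total_estimate]). The limits are Riemann sums of v^2 and of
    v^2 area(k / v^2), where area(k) is the area of the part xy >= k of
    Omega_1, and the scaling (x, y) -> (w x, w y) identifies the resulting
    integral with the distribution function of Z ([P_gap_scaling],
    [gap_density_integral_cdf]).

    In the classical Farey set of order X, the point p/q and its right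
    neighbour, of denominator q', are characterised by X - q < q' <= X and
    q | p q' + 1, and their distance is 1 / (q q') ([farey_followedP]). Counting
    followed points p/q in [a, b) is therefore counting, for each q <= X, the
    solutions of p q' = -1 modulo q with p and q' in two given intervals of
    length at most q. If inverses modulo q are equidistributed, this number is
    about phi(q) / q^2 times the product of the two lengths, and a weighted sum
    of totients remains ([consecutive_count_asymptotic]).

    Equidistribution of inverses is proved without exponential sums. For a
    function f on the plane over a finite field of n elements, the number of
    points of the hyperbola x y = c, weighted by a translate of f, has small
    variance over all translates. Averaging over c as well, this is a count of
    solutions of linear equations ([variance_units_le]). For a fixed c, the
    second moment is again a sum of correlations of f along hyperbolas, whose
    parameters take each value at most twice, so that the averaged bound
    applies ([hyp_variance_le]). For the indicator of a box, few points are
    gained or lost under small translations, hence the count for the box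
    itself is close to its mean ([hyperbola_box_count]). Modulo q = p r with p
    a large prime and r prime to p, splitting into residue classes modulo r
    reduces to this case ([inverse_count_prime_factor]); the moduli without
    such a p are divisible by a large square, up to finitely many, and are
    rare ([inverse_count_average]).

    Finally, Gauss's identity, that the totients of the divisors of q sum to q,
    expresses the Riemann sum of a monotone g through the totient sums of g at
    the scales X / k. Solving for the scale X turns an error rate d of the
    asymptotics X area(g) / zeta(2) into (zeta(2) - 1) d + o(1), and
    zeta(2) - 1 <= 3/4 < 1; iterating gives rate o(1), uniformly in g
    ([totient_sum_asymptotic]). *)

(** * Hyperbolas over a finite field, on average over translates *)

Section hyperbola_mean.
Context (R : realFieldType) (F : finFieldType).
Implicit Types f : F -> F -> R.

(** The sum of f over the points of the translate by (s, t) of the hyperbola x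
    y = c. *)
Definition hyp_sum f (c s t : F) : R := \sum_(x | x != 0) f (s + x) (t + c / x).
Definition mass f : R := \sum_s \sum_t f s t.

Local Notation n := (#|F|%:R : R).

Lemma card_field_gt1 : (1 < #|F|)%N.
Proof.
rewrite (cardD1 (0 : F)) (cardD1 (1 : F)) !inE/= oner_neq0 //.
Qed.

Lemma sum_all_const (a : R) : \sum_(x : F) a = n * a.
Proof. by rewrite sumr_const mulr_natl. Qed.

Lemma sum_nonzero_const (a : R) : \sum_(x : F | x != 0) a = (n - 1) * a.
Proof.
have e : \sum_(x : F) a = n * a by rewrite sumr_const mulr_natl.
by rewrite mulrBl mul1r -e [in RHS](bigD1 0) //= addrC addrK.
Qed.

Lemma sum2_shift f (a b : F) : \sum_s \sum_t f (s + a) (t + b) = mass f.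
Proof.
rewrite /mass [RHS](reindex_inj (addIr a)); apply: eq_bigr => s _.
by rewrite [RHS](reindex_inj (addIr b)).
Qed.

Lemma sum_hyp f c : \sum_s \sum_t hyp_sum f c s t = (n - 1) * mass f.
Proof.
under eq_bigr do rewrite exchange_big /=.
rewrite exchange_big /= -sum_nonzero_const; apply: eq_bigr => x x0.
exact: sum2_shift.
Qed.

(** Expanding the square gives pairs of points of the hyperbola. A translation
    by the first point turns an off-diagonal pair into the correlation of f
    with a single translate of itself. *)
Lemma sum_sq_hyp f c :
  \sum_s \sum_t hyp_sum f c s t ^+ 2 =
  (n - 1) * mass (fun s t => f s t ^+ 2) +
  \sum_(x | x != 0) \sum_(x' | (x' != 0) && (x' != x))
    \sum_s \sum_t f s t * f (s + (x' - x)) (t + c * (x'^-1 - x^-1)).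
Proof.
have -> : \sum_s \sum_t hyp_sum f c s t ^+ 2 = \sum_(x | x != 0) \sum_(x' | x' != 0)
    \sum_s \sum_t f (s + x) (t + c / x) * f (s + x') (t + c / x').
  transitivity (\sum_s \sum_t \sum_(x | x != 0) \sum_(x' | x' != 0)
      f (s + x) (t + c / x) * f (s + x') (t + c / x')).
    do 2!apply: eq_bigr => ? _; rewrite expr2 /hyp_sum big_distrl /=.
    by apply: eq_bigr => x _; rewrite big_distrr.
  under eq_bigr do rewrite exchange_big /=.
  rewrite exchange_big /=; apply: eq_bigr => x _.
  under eq_bigr do rewrite exchange_big /=.
  by rewrite exchange_big.
rewrite -sum_nonzero_const -big_split /=; apply: eq_bigr => x x0.
rewrite (bigD1 x) //=; congr (_ + _).
  rewrite -(sum2_shift _ x (c / x)).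
  by do 2!apply: eq_bigr => ? _; rewrite expr2.
apply: eq_bigr => y _.
rewrite -[RHS](sum2_shift (fun s t => f s t * f (s + (y - x)) (t + c * (y^-1 - x^-1))) x (c / x)).
do 2!apply: eq_bigr => ? _; congr (_ * f _ _).
  by rewrite -addrA (addrC x) subrK.
by rewrite -addrA mulrBr (addrC (c / x)) subrK.
Qed.

Lemma var_expand f c :
  \sum_s \sum_t (hyp_sum f c s t - mass f / n) ^+ 2 =
  \sum_s \sum_t hyp_sum f c s t ^+ 2 - 2 * (mass f / n) * ((n - 1) * mass f)
   + mass f ^+ 2.
Proof.
have n0 : n != 0 by rewrite pnatr_eq0 -lt0n (leq_trans _ card_field_gt1).
rewrite -(sum_hyp f c) mulr_sumr -sumrB.
have -> : mass f ^+ 2 = \sum_(s : F) n * (mass f / n) ^+ 2.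
  by rewrite sum_all_const; field.
rewrite -big_split /=; apply: eq_bigr => s _.
have -> : n * (mass f / n) ^+ 2 = \sum_(t : F) (mass f / n) ^+ 2.
  by rewrite sum_all_const.
rewrite mulr_sumr -sumrB -big_split /=; apply: eq_bigr => t _; ring.
Qed.

Variable f : F -> F -> R.
Hypothesis f01 : forall s t, 0 <= f s t <= 1.
Local Notation sigma := (mass f).
Local Notation M := (hyp_sum f).

Let f0 s t : 0 <= f s t. Proof. by case/andP: (f01 s t). Qed.
Let f1 s t : f s t <= 1. Proof. by case/andP: (f01 s t). Qed.

Lemma mass_ge0 : 0 <= sigma.
Proof. by do 2!apply: sumr_ge0 => ? _. Qed.

Lemma mass_sq_le : mass (fun s t => f s t ^+ 2) <= sigma.
Proof.
do 2!apply: ler_sum => ? _; rewrite expr2 -[leRHS]mulr1.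
by rewrite ler_wpM2l.
Qed.

Lemma mass_le : sigma <= n ^+ 2.
Proof.
apply: (@le_trans _ _ (\sum_(s : F) \sum_(t : F) 1)).
  by do 2!apply: ler_sum => ? _.
by rewrite !sum_all_const mulr1 expr2.
Qed.

(** For x and x' fixed and distinct, the displacement c (1/x' - 1/x) takes
    each nonzero value once as c varies. Allowing the value 0 as well makes
    both displacements range over the whole field, and the correlations then
    sum to the square of the mass. *)
Lemma sum_sq_hyp_units_le :
  \sum_(c | c != 0) \sum_s \sum_t M c s t ^+ 2 <= n ^+ 2 * sigma + n * sigma ^+ 2.
Proof.
have n1 : 1 <= n by rewrite ler1n ltnW ?card_field_gt1.
under eq_bigr do rewrite sum_sq_hyp.
rewrite big_split /= sum_nonzero_const lerD //.
  rewrite mulrA; apply: ler_pM; rewrite ?mass_sq_le //.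
  - by rewrite mulr_ge0// subr_ge0.
  - by do 2!apply: sumr_ge0 => ? _; rewrite exprn_ge0.
  - by rewrite expr2 ler_pM ?subr_ge0// gerBl.
rewrite exchange_big /=.
under eq_bigr do rewrite exchange_big /=.
have step x x' : x != 0 -> x' != 0 -> x' != x ->
   \sum_(c | c != 0) \sum_s \sum_t f s t * f (s + (x' - x)) (t + c * (x'^-1 - x^-1))
   <= \sum_s \sum_t f s t * \sum_e f (s + (x' - x)) (t + e).
  move=> x0 x'0 xx'.
  have e0 : x'^-1 - x^-1 != 0.
    by rewrite subr_eq0; apply: contra xx' => /eqP/invr_inj->.
  rewrite exchange_big /=; apply: ler_sum => s _.
  rewrite exchange_big /=; apply: ler_sum => t _.
  rewrite -mulr_sumr ler_wpM2l//.
  rewrite [leRHS](reindex_inj (mulIf e0)) /= big_mkcond /=.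
  by apply: ler_sum => c _; case: ifP.
apply: (@le_trans _ _ (\sum_(x : F) \sum_(x' : F) \sum_s \sum_t
    f s t * \sum_e f (s + (x' - x)) (t + e))).
  have pos x x' : 0 <= \sum_s \sum_t f s t * \sum_e f (s + (x' - x)) (t + e).
    by do 2!apply: sumr_ge0 => ? _; rewrite mulr_ge0// sumr_ge0.
  rewrite big_mkcond /=; apply: ler_sum => x _; case: ifP => x0; last first.
    by apply: sumr_ge0 => x' _.
  rewrite big_mkcond /=; apply: ler_sum => x' _; case: ifP => // /andP[? ?].
  exact: step.
rewrite (_ : n * _ = \sum_(x : F) sigma ^+ 2); last by rewrite sum_all_const.
apply: ler_sum => x _.
rewrite exchange_big /= expr2 mulr_suml; apply: ler_sum => s _.
rewrite exchange_big /= mulr_suml; apply: ler_sum => t _.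
rewrite -mulr_sumr ler_wpM2l//.
rewrite le_eqVlt; apply/orP; left; apply/eqP.
rewrite /mass [RHS](reindex_inj (addrI (s - x))); apply: eq_bigr => x' _.
rewrite [RHS](reindex_inj (addrI t)); apply: eq_bigr => e _.
by congr f; ring.
Qed.

(** The terms of order n sigma^2 in the second moment and in the square of the
    mean cancel, which leaves one factor n less than the trivial bound n^5. *)
Lemma variance_units_le :
  \sum_(c | c != 0) \sum_s \sum_t (M c s t - sigma / n) ^+ 2 <= 4 * n ^+ 4.
Proof.
have n1 : 1 <= n by rewrite ler1n ltnW ?card_field_gt1.
have n0 : n != 0 by rewrite gt_eqF// (lt_le_trans ltr01).
under eq_bigr do rewrite var_expand.
rewrite big_split /= sumrB !sum_nonzero_const.
have := sum_sq_hyp_units_le; set A := (X in X <= _) => HA.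
have s0 := mass_ge0; have s1 := mass_le.
have -> : (n - 1) * (2 * (sigma / n) * ((n - 1) * sigma)) =
   2 * (n - 2 + n^-1) * sigma ^+ 2 by field.
have i0 : 0 <= n^-1 by rewrite invr_ge0 (le_trans _ n1).
have h1 : sigma ^+ 2 <= n ^+ 4.
  have e4 : n ^+ 4 = (n ^+ 2) ^+ 2 by rewrite -exprM.
  by rewrite e4 lerXn2r ?nnegrE ?exprn_ge0.
have h2 : n ^+ 2 * sigma <= n ^+ 4.
  by rewrite (exprD n 2 2) ler_wpM2l ?exprn_ge0 ?ler0n.
have h3 : 0 <= n^-1 * sigma ^+ 2 by rewrite mulr_ge0// exprn_ge0.
set S := sigma ^+ 2 in HA h1 h3 *.
set T := n^-1 * S in h3 *.
have -> : 2 * (n - 2 + n^-1) * S = 2 * n * S - 4 * S + 2 * T by rewrite /T; ring.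
have -> : (n - 1) * S = n * S - S by ring.
rewrite -/A; lra.
Qed.

Definition self_corr c : R := \sum_s \sum_t f s t * M c s t.

(** The deviation is the sum of f against the deviations of the hyperbola sums
    from their mean; with 0 <= f <= 1 it is bounded in absolute value through
    the variance, by the inequality between the arithmetic and geometric means
    with weight eta n. *)
Lemma self_corr_dev (eta : R) : 0 < eta ->
  \sum_(c | c != 0) `|self_corr c - sigma ^+ 2 / n| <= eta * n ^+ 4 + 4 * n ^+ 3 / eta.
Proof.
move=> eta0.
have n1 : 1 <= n by rewrite ler1n ltnW ?card_field_gt1.
have n0 : 0 < n by rewrite (lt_le_trans ltr01).
have en : 0 < eta * n by rewrite mulr_gt0.
(* this is |a| e <= e^2 + a^2, for e = eta n *)
have young (a : R) : `|a| <= eta * n + a ^+ 2 / (eta * n).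
  have h : `|a| ^+ 2 = a ^+ 2 by rewrite real_normK// num_real.
  rewrite -h -(ler_pM2r en) mulrDl mulfVK ?gt_eqF//.
  have := normr_ge0 a; nra.
have bnd c : `|self_corr c - sigma ^+ 2 / n| <=
    eta * n ^+ 3 + (\sum_s \sum_t (M c s t - sigma / n) ^+ 2) / (eta * n).
  have -> : self_corr c - sigma ^+ 2 / n = \sum_s \sum_t f s t * (M c s t - sigma / n).
    rewrite expr2 -mulrA {1}/mass mulr_suml -sumrB; apply: eq_bigr => s _.
    rewrite mulr_suml -sumrB; apply: eq_bigr => t _; ring.
  have -> : eta * n ^+ 3 = \sum_(s : F) \sum_(t : F) eta * n.
    by rewrite !sum_all_const; ring.
  rewrite [X in _ <= _ + X]mulr_suml -big_split /=.
  apply: le_trans (ler_norm_sum _ _ _) _; apply: ler_sum => s _.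
  rewrite [X in _ <= _ + X]mulr_suml -big_split /=.
  apply: le_trans (ler_norm_sum _ _ _) _; apply: ler_sum => t _.
  apply: le_trans (young _); rewrite normrM ger0_norm// -[leRHS]mul1r.
  by rewrite ler_wpM2r.
apply: le_trans (ler_sum _ (fun c _ => bnd c)) _.
rewrite big_split /= sum_nonzero_const -mulr_suml lerD//.
  rewrite (_ : eta * n ^+ 4 = n * (eta * n ^+ 3)); last by ring.
  by rewrite ler_wpM2r ?gerBl// mulr_ge0 ?exprn_ge0 ?ltW.
rewrite ler_pdivrMr//.
have -> : 4 * n ^+ 3 / eta * (eta * n) = 4 * n ^+ 4 by field; rewrite gt_eqF.
exact: variance_units_le.
Qed.

(** Write an off-diagonal pair as x = d u, x' = d (u + 1). For u fixed, the
    displacements (d, - (c / (u (u + 1))) / d) run over the hyperbola of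
    parameter - c / (u (u + 1)) as d varies: the second moment for the single
    parameter c is a sum of correlations for many parameters. *)
Lemma sum_sq_hyp_corr c :
  \sum_s \sum_t M c s t ^+ 2 <=
  n * sigma + \sum_(u | (u != 0) && (u != -1)) self_corr (- c / (u * (u + 1))).
Proof.
have n1 : 1 <= n by rewrite ler1n ltnW ?card_field_gt1.
rewrite sum_sq_hyp lerD//.
  rewrite ler_pM ?subr_ge0 ?gerBl ?mass_sq_le//.
  by do 2!apply: sumr_ge0 => ? _; rewrite exprn_ge0.
rewrite le_eqVlt; apply/orP; left; apply/eqP.
pose G x d := \sum_s \sum_t f s t * f (s + d) (t + c * ((x + d)^-1 - x^-1)).
transitivity (\sum_(x | x != 0) \sum_(d | (d != 0) && (x + d != 0)) G x d).
  apply: eq_bigr => x x0; rewrite (reindex_inj (addrI x)) /=.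
  apply: eq_big => d; first by rewrite andbC -subr_eq0 (addrC x) addrK.
  move=> _; rewrite /G; do 2!apply: eq_bigr => ? _.
  by rewrite (addrC x d) addrK.
transitivity (\sum_(d | d != 0) \sum_(x | (x != 0) && (x + d != 0)) G x d).
  rewrite (exchange_big_dep (fun d => d != 0)) /=; last by move=> x d _ /andP[].
  by apply: eq_bigr => d d0; apply: eq_bigl => x; rewrite d0.
transitivity (\sum_(d | d != 0) \sum_(u | (u != 0) && (u != -1)) G (d * u) d).
  apply: eq_bigr => d d0; rewrite (reindex_inj (mulfI d0)) /=.
  apply: eq_bigl => u; rewrite mulf_eq0 (negbTE d0) /=.
  by rewrite -[X in _ + X]mulr1 -mulrDr mulf_eq0 (negbTE d0)/= addr_eq0.
rewrite exchange_big /=; apply: eq_bigr => u /andP[u0 u1].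
rewrite /self_corr /hyp_sum.
rewrite /G exchange_big /=; apply: eq_bigr => s _.
rewrite exchange_big /=; apply: eq_bigr => t _.
rewrite mulr_sumr; apply: eq_bigr => d d0; congr (_ * f _ (_ + _)).
have u2 : u + 1 != 0 by rewrite addr_eq0.
by rewrite -[X in _ * u + X]mulr1 -mulrDr; field; rewrite u0 u2 d0.
Qed.

(** The parameter - c / (u (u + 1)) takes each value at most twice, so the sum
    over u of the deviations of the correlations is at most twice the sum over
    all parameters, which is small by [self_corr_dev]. The main terms cancel
    exactly: there are n - 2 admissible u. *)
Lemma hyp_variance_le c (eta : R) : c != 0 -> 0 < eta ->
  \sum_s \sum_t (M c s t - sigma / n) ^+ 2 <=
    n ^+ 3 + 2 * (eta * n ^+ 4 + 4 * n ^+ 3 / eta).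
Proof.
move=> c0 eta0.
have n1 : 1 <= n by rewrite ler1n ltnW ?card_field_gt1.
have n0 : n != 0 by rewrite gt_eqF// (lt_le_trans ltr01).
have dev := self_corr_dev eta0; set D := (X in X <= _) in dev.
have h : \sum_(u | (u != 0) && (u != -1)) self_corr (- c / (u * (u + 1))) <=
   (n - 2) * (sigma ^+ 2 / n) + 2 * D.
  have -> : (n - 2) * (sigma ^+ 2 / n) =
      \sum_(u : F | (u != 0) && (u != -1)) sigma ^+ 2 / n.
    have m10 : (-1 : F) != 0 by rewrite oppr_eq0 oner_neq0.
    have := sum_nonzero_const (sigma ^+ 2 / n); rewrite (bigD1 (-1)) //= => h1.
    rewrite (_ : n - 2 = n - 1 - 1); last by ring.
    by rewrite mulrBl -h1; ring.
  rewrite -lerBlDl -sumrB.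
  apply: (@le_trans _ _ (\sum_(u | (u != 0) && (u != -1))
      `|self_corr (- c / (u * (u + 1))) - sigma ^+ 2 / n|)).
    by apply: ler_sum => u _; exact: ler_norm.
  rewrite (partition_big (fun u => - c / (u * (u + 1))) (fun k => k != 0)) /=; last first.
    move=> u /andP[u0 u1]; rewrite mulf_neq0 ?oppr_eq0 ?invr_eq0 ?mulf_neq0//.
    by rewrite addr_eq0.
  rewrite mulr_sumr; apply: ler_sum => k k0.
  rewrite (eq_bigr (fun=> `|self_corr k - sigma ^+ 2 / n|)); last by move=> u /andP[_ /eqP->].
  rewrite sumr_const -[leLHS]mulr_natl; apply: ler_wpM2r => //; rewrite ler_nat.
  (* the u of parameter k are roots of k X^2 + k X + c *)
  pose P : {poly F} := k *: 'X^2 + k *: 'X + c%:P.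
  have sP : size P = 3%N.
    rewrite /P -addrA size_polyDl size_scale// size_polyXn//.
    apply: leq_ltn_trans (size_polyD _ _) _; rewrite gtn_max size_scale// size_polyX /=.
    by rewrite (leq_ltn_trans (size_polyC_leq1 _)).
  have P0 : P != 0 by rewrite -size_poly_eq0 sP.
  have := max_poly_roots P0 (rs := enum [pred u | ((u != 0) && (u != -1)) &&
     (- c / (u * (u + 1)) == k)]).
  rewrite sP ltnS -cardE; apply; last exact: enum_uniq.
  apply/allP => u; rewrite mem_enum inE => /andP[/andP[u0 u1] /eqP kE].
  rewrite /root /P !hornerE /= -kE; apply/eqP.
  have u2 : u + 1 != 0 by rewrite addr_eq0.
  by field; rewrite u0 u2.
rewrite var_expand.
have hs := sum_sq_hyp_corr c.
have s0 := mass_ge0; have s1 := mass_le.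
set A := \sum_s _ in hs *; set B := \sum_(u | _) _ in hs h.
have -> : 2 * (sigma / n) * ((n - 1) * sigma) = 2 * sigma ^+ 2 - 2 * (sigma ^+ 2 / n) by field.
have e : (n - 2) * (sigma ^+ 2 / n) = sigma ^+ 2 - 2 * (sigma ^+ 2 / n) by field.
rewrite e in h.
have h2 : n * sigma <= n ^+ 3 by rewrite [leRHS]exprS ler_wpM2l ?ler0n.
by lra.
Qed.

End hyperbola_mean.

(** * Points of a hyperbola in a box, modulo a prime *)

Lemma big_ord_nat_ltn (R : nmodType) (G : nat -> R) (l p : nat) : (l <= p)%N ->
  \sum_(i < l) G i = \sum_(i < p | (i < l)%N) G i.
Proof. by move=> lp; rewrite (big_ord_widen p G lp). Qed.

Section hyperbola_box.
Context (R : realType) (p : nat) (p_pr : prime p).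
Local Notation F := 'F_p.
Implicit Types a b c s t x : F.

Definition arc a (l : nat) s : R := ((s - a)%R < l)%N%:R.

Lemma sum_arc a (l : nat) (G : F -> R) : (l <= p)%N ->
  \sum_(i < l) G (a + i%:R) = \sum_s arc a l s * G s.
Proof.
move=> lp; rewrite [RHS](reindex_inj (addrI a)) /=.
have -> : \sum_s arc a l (a + s) * G (a + s) =
    \sum_(s : F | (s < l)%N) G (a + (s : nat)%:R).
  rewrite [RHS]big_mkcond /=; apply: eq_bigr => s _.
  rewrite /arc (addrC a) addrK natr_Zp.
  by case: ifP => _; rewrite ?mul1r ?mul0r// addrC.
by rewrite (big_ord_nat_ltn (fun i => G (a + i%:R)) (p := (Zp_trunc (pdiv p)).+2)) // Fp_cast.
Qed.

Lemma arc01 a l s : 0 <= arc a l s <= 1.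
Proof. by rewrite /arc; case: ltnP; rewrite lexx ler01. Qed.

(** A unit translation changes membership in an arc only at its two ends. *)
Lemma arc_shift1 a l : \sum_s `|arc a l (s + 1) - arc a l s| <= 2.
Proof.
apply: (@le_trans _ _ (\sum_s ((s == a - 1)%:R + (s == a + l.-1%:R)%:R))).
  apply: ler_sum => s _; rewrite /arc.
  have [->|sa] := eqVneq s (a - 1).
    rewrite subrK subrr /=.
    by do 2![case: (_ < l)%N]; case: (_ == _); rewrite /= ?subrr ?subr0 ?sub0r ?normrN ?normr0 ?normr1; lra.
  rewrite add0r.
  (* away from a - 1, adding 1 does not wrap around p *)
  have v1 : nat_of_ord (s + 1 - a) = (nat_of_ord (s - a)).+1.
    have -> : s + 1 - a = (s - a) + 1 by ring.
    have : s - a + 1 != 0.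
      apply: contra sa => /eqP e; apply/eqP.
      by rewrite -[s in LHS](subrK a) -[s - a](addrK 1) e; ring.
    move: (s - a) => d; rewrite -val_eqE /=.
    have := ltn_ord d; rewrite (@modn_small 1) //.
    case: (ltngtP d.+1 (Zp_trunc (pdiv p)).+2) => // dp _.
      by rewrite addn1 modn_small.
    by rewrite addn1 dp modnn.
  rewrite v1.
  case: (ltnP (s - a)%R l) => h; last first.
    by rewrite (leq_gtF (leqW h)) subrr normr0 ler0n.
  have [h'|h'] := ltnP; first by rewrite subrr normr0 ler0n.
  rewrite (_ : s == _) ?sub0r ?normrN ?normr1// .
  have e : l.-1 = nat_of_ord (s - a) by lia.
  by rewrite e natr_Zp addrC subrK.
rewrite big_split /= -!natr_sum.
have one b : (\sum_(s : F) (s == b) = 1)%N.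
  by rewrite (bigD1 b) //= eqxx big1 // => s /negbTE->.
by rewrite !one -natrD.
Qed.

Lemma arc_shift a l (k : nat) : \sum_s `|arc a l (s + k%:R) - arc a l s| <= 2 * k%:R.
Proof.
elim: k => [|k IH]; first by rewrite big1 ?mulr0// => s _; rewrite addr0 subrr normr0.
have h := arc_shift1 a l; rewrite (reindex_inj (addIr (k%:R : F))) /= in h.
apply: le_trans (_ : _ <= \sum_s (`|arc a l (s + k%:R + 1) - arc a l (s + k%:R)| +
   `|arc a l (s + k%:R) - arc a l s|)) _.
  apply: ler_sum => s _; rewrite -natr1 addrA.
  apply: le_trans (ler_normD _ _); by rewrite addrA subrK.
by rewrite big_split /= -[k.+1%:R in leRHS]natr1 mulrDr mulr1 addrC lerD.
Qed.

Variables (a b c : F) (l m : nat).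
Hypotheses (c0 : c != 0) (lp : (l <= p)%N) (mp : (m <= p)%N).

Definition box s t := arc a l s * arc b m t.

Lemma box01 s t : 0 <= box s t <= 1.
Proof.
by have /andP[? ?] := arc01 a l s; have /andP[? ?] := arc01 b m t; rewrite /box mulr_ge0 //= mulr_ile1.
Qed.

Lemma mass_box : mass box = l%:R * m%:R.
Proof.
rewrite /mass /box.
have e (a' : F) (l' : nat) : (l' <= p)%N -> \sum_s arc a' l' s = l'%:R.
  move=> h; have := sum_arc a' (fun=> 1) h; under [RHS]eq_bigr do rewrite mulr1.
  by move=> <-; rewrite sumr_const card_ord.
by under eq_bigr do rewrite -mulr_sumr; rewrite -mulr_suml !e.
Qed.

Lemma hyp_box : hyp_sum box c 0 0 =
  \sum_(i < l) \sum_(j < m) ((a + i%:R) * (b + j%:R) == c)%:R.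
Proof.
rewrite (sum_arc a (fun s => \sum_(j < m) (s * (b + j%:R) == c)%:R) lp).
under [RHS]eq_bigr => s _ do rewrite (sum_arc b (fun t => (s * t == c)%:R) mp).
rewrite [RHS](bigD1 0) //= [X in _ = _ * X + _]big1 ?mulr0 ?add0r; last first.
  by move=> t _; rewrite mul0r eq_sym (negbTE c0) mulr0.
apply: eq_bigr => x x0; rewrite !add0r /box; congr (_ * _).
rewrite (bigD1 (c / x)) //= mulrCA mulfV// mulr1 eqxx mulr1 big1 ?addr0// => t tx.
rewrite (_ : (x * t == c) = false) ?mulr0//; apply: contraNF tx => /eqP <-.
by rewrite mulrAC mulfV// mul1r.
Qed.

(** Since x -> c / x is a bijection of the units, each coordinate contributes
    at most the number of residues at which an arc differs from its translate. *)
Lemma hyp_box_shift (k k' : nat) :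
  `|hyp_sum box c k%:R k'%:R - hyp_sum box c 0 0| <= 2 * k%:R + 2 * k'%:R.
Proof.
rewrite /hyp_sum -sumrB.
apply: le_trans (ler_norm_sum _ _ _) _.
apply: (@le_trans _ _ (\sum_(x | x != 0) (`|arc a l (x + k%:R) - arc a l x| +
    `|arc b m (c / x + k'%:R) - arc b m (c / x)|))).
  apply: ler_sum => x _; rewrite !add0r (addrC k%:R) (addrC k'%:R) /box.
  set u := arc a l _; set v := arc b m _; set u' := arc a l _; set v' := arc b m _.
  have -> : u * v - u' * v' = (u - u') * v + u' * (v - v') by ring.
  have /andP[u0 u1] : 0 <= u' <= 1 by exact: arc01.
  have /andP[v0 v1] : 0 <= v <= 1 by exact: arc01.
  apply: le_trans (ler_normD _ _) _; rewrite !normrM (ger0_norm u0) (ger0_norm v0).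
  by apply: lerD; [rewrite ler_piMr|rewrite ler_piMl].
rewrite big_split /= lerD//.
  apply: le_trans (arc_shift a l k); rewrite big_mkcond /=; apply: ler_sum => x _.
  by case: ifP.
apply: le_trans (arc_shift b m k').
rewrite [leLHS](reindex_onto (fun y => c / y) (fun x => c / x)) /=; last first.
  by move=> x x0; field; rewrite c0 x0.
rewrite big_mkcond /=; apply: ler_sum => y _.
case: ifP => // /andP[h /eqP ->] //.
Qed.

(** The count for the box is compared with the counts for its translates by
    (k, k') with k, k' < h, and these with the mean, through the variance over
    all translates. The parameter eta weights the variance as in
    [self_corr_dev], and eta' is the one of [hyp_variance_le]. *)
Lemma box_count_h (h : nat) (eta eta' : R) : (0 < h)%N -> (h <= p)%N -> 0 < eta -> 0 < eta' ->
  `|hyp_sum box c 0 0 - l%:R * m%:R / p%:R| <=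
   4 * h%:R + eta * p%:R +
   (p%:R ^+ 3 + 2 * (eta' * p%:R ^+ 4 + 4 * p%:R ^+ 3 / eta')) / (eta * p%:R * h%:R ^+ 2).
Proof.
move=> h0 hp e0 e'0.
have := @hyp_variance_le R F box box01 c _ c0 e'0.
rewrite card_Fp// mass_box; set V := (X in _ <= X -> _); set sg := _ / _ => HV.
set N := hyp_sum box c 0 0.
have p0 : (0 : R) < p%:R by rewrite ltr0n prime_gt0.
have h0' : (0 : R) < h%:R by rewrite ltr0n.
have ep : 0 < eta * p%:R by rewrite mulr_gt0.
have young (z : R) : `|z| <= eta * p%:R + z ^+ 2 / (eta * p%:R).
  have hz : `|z| ^+ 2 = z ^+ 2 by rewrite real_normK// num_real.
  rewrite -hz -(ler_pM2r ep) mulrDl mulfVK ?gt_eqF//.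
  have := normr_ge0 z; nra.
pose D s t := (hyp_sum box c s t - sg) ^+ 2.
have pt (k k' : 'I_h) : `|N - sg| <= 4 * h%:R + eta * p%:R + D k%:R k'%:R / (eta * p%:R).
  have -> : N - sg = - (hyp_sum box c k%:R k'%:R - N) + (hyp_sum box c k%:R k'%:R - sg) by ring.
  apply: le_trans (ler_normD _ _) _; rewrite normrN -addrA lerD ?young//.
  apply: le_trans (hyp_box_shift _ _) _.
  have k1 : (k%:R : R) <= h%:R by rewrite ler_nat ltnW.
  have k2 : (k'%:R : R) <= h%:R by rewrite ler_nat ltnW.
  by lra.
have tot : \sum_(k < h) \sum_(k' < h) D k%:R k'%:R <= V.
  apply: le_trans HV.
  (* as h <= p, the shifts k < h are distinct residues *)
  have drop (G : F -> R) : (forall s, 0 <= G s) -> \sum_(k < h) G k%:R <= \sum_s G s.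
    move=> G0; have := sum_arc 0 G hp; under eq_bigr do rewrite add0r.
    move=> ->; apply: ler_sum => s _; have /andP[? ?] := arc01 0 h s.
    by rewrite ler_piMl.
  apply: (@le_trans _ _ (\sum_(k < h) \sum_t D k%:R t)).
    by apply: ler_sum => k _; apply: (drop (D k%:R)) => t; exact: sqr_ge0.
  by apply: (drop (fun s => \sum_t D s t)) => s; apply: sumr_ge0 => t _; exact: sqr_ge0.
have : \sum_(k < h) \sum_(k' < h) `|N - sg| <= \sum_(k < h) \sum_(k' < h)
    (4 * h%:R + eta * p%:R + D k%:R k'%:R / (eta * p%:R)).
  by do 2!apply: ler_sum => ? _.
have cst (x : R) : \sum_(k < h) \sum_(k' < h) x = x * h%:R ^+ 2.
  by rewrite !sumr_const card_ord -mulrnA -[LHS]mulr_natr natrM expr2.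
have -> : \sum_(k < h) \sum_(k' < h) (4 * h%:R + eta * p%:R + D k%:R k'%:R / (eta * p%:R)) =
   (4 * h%:R + eta * p%:R) * h%:R ^+ 2 + (\sum_(k < h) \sum_(k' < h) D k%:R k'%:R) / (eta * p%:R).
  rewrite -cst mulr_suml -big_split /=; apply: eq_bigr => k _.
  by rewrite mulr_suml -big_split.
rewrite cst => H.
have hh : 0 < h%:R ^+ 2 :> R by rewrite exprn_gt0.
have H2 : `|N - sg| * h%:R ^+ 2 <= (4 * h%:R + eta * p%:R) * h%:R ^+ 2 + V / (eta * p%:R).
  by apply: le_trans H _; rewrite lerD2l ler_wpM2r// invr_ge0 ltW.
rewrite -(ler_pM2r hh); apply: le_trans H2 _.
rewrite -/V le_eqVlt; apply/orP; left; apply/eqP; field.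
by rewrite !gt_eqF.
Qed.

End hyperbola_box.

(** In [box_count_h], shifts up to h = d p with d a small multiple of eps
    change the count by a small multiple of p, while their number h^2 is of
    order p^2: the variance, which is a small multiple of p^4, is divided by p
    h^2. *)
Lemma hyperbola_box_count (R : realType) (eps : R) : 0 < eps -> exists P0 : nat,
  forall p, prime p -> (P0 < p)%N -> forall (a b c : 'F_p) (l m : nat), c != 0 ->
  (l <= p)%N -> (m <= p)%N ->
  `|\sum_(i < l) \sum_(j < m) ((a + i%:R) * (b + j%:R) == c)%:R - l%:R * m%:R / p%:R|
    <= eps * p%:R.
Proof.
move=> eps0'.
wlog eps1 : eps eps0' / eps <= 1.
  move=> W; have [e1|e1] := leP eps 1; first exact: W.
  have [P0 H] := W 1 ltr01 (lexx _); exists P0 => p pp Pp a b c l m c0 lp mp.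
  apply: le_trans (H p pp Pp a b c l m c0 lp mp) _.
  by rewrite ler_wpM2r ?ler0n// ltW.
have eps0 := eps0'.
(* the terms 4 h, eta p and the part of the variance linear in eta' are eps p
   / 4 each, up to the constant K *)
pose d := eps / 16; pose eta := eps / 4; pose eta' := eta * d ^+ 2 * eps / 8.
have d0 : 0 < d by rewrite divr_gt0.
have et0 : 0 < eta by rewrite divr_gt0.
have et'0 : 0 < eta' by rewrite divr_gt0// mulr_gt0// mulr_gt0// exprn_gt0.
pose K := 4 + (1 + 8 / eta') / (eta * d ^+ 2).
have [P0 HP0] : exists P0 : nat, 4 * K / eps < P0%:R.
  exists (Num.bound (4 * K / eps)); apply: archi_boundP.
  have K0 : 0 < K.
    apply: addr_gt0 => //; apply: divr_gt0; last by rewrite mulr_gt0// exprn_gt0.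
    by apply: addr_gt0 => //; apply: divr_gt0.
  by rewrite ltW// divr_gt0// mulr_gt0.
exists P0 => p pp Pp a b c l m c0 lp mp.
rewrite -hyp_box//.
have p0 : (0 : R) < p%:R by rewrite ltr0n prime_gt0.
have HK : K <= eps / 4 * p%:R.
  have : 4 * K / eps < p%:R by apply: lt_trans HP0 _; rewrite ltr_nat.
  rewrite ltr_pdivrMr//; lra.
pose h := (Num.truncn (d * p%:R)).+1.
have dp0 : 0 <= d * p%:R by rewrite mulr_ge0 ?ltW.
have h1 : d * p%:R < h%:R by exact: truncnS_gt.
have h2 : h%:R <= d * p%:R + 1 by rewrite -natr1 lerD2r truncn_le.
have hp : (h <= p)%N.
  rewrite -(ler_nat R); apply: le_trans h2 _.
  have p2 : (2 : R) <= p%:R by rewrite ler_nat prime_gt1.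
  rewrite /d; nra.
have h0 : (0 : R) < h%:R by rewrite ltr0n.
apply: le_trans (box_count_h pp a b c0 lp mp (ltn0Sn _ : (0 < h)%N) hp et0 et'0) _.
set X := p%:R : R in p0 HK h1 h2 *; set H := h%:R : R in h0 h1 h2 *.
have T1 : (X ^+ 3 + 2 * (eta' * X ^+ 4 + 4 * X ^+ 3 / eta')) / (eta * X * H ^+ 2) <=
   (1 + 8 / eta') / (eta * d ^+ 2) + eps / 4 * X.
  have q1 : eta * X * (d * X) ^+ 2 <= eta * X * H ^+ 2.
    apply: ler_wpM2l; first by rewrite ltW// mulr_gt0.
    by rewrite lerXn2r ?nnegrE// ltW.
  apply: (@le_trans _ _ ((X ^+ 3 + 2 * (eta' * X ^+ 4 + 4 * X ^+ 3 / eta')) / (eta * X * (d * X) ^+ 2))).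
    apply: ler_wpM2l; last first.
      have pos k : 0 < k -> 0 < eta * X * k ^+ 2.
        by move=> k0; apply: mulr_gt0; [exact: mulr_gt0|exact: exprn_gt0].
      by rewrite lef_pV2 ?posrE ?pos// mulr_gt0.
    have X0 k : 0 <= X ^+ k by rewrite exprn_ge0// ltW.
    apply: addr_ge0 => //; apply: mulr_ge0 => //; apply: addr_ge0.
      by apply: mulr_ge0 => //; exact: ltW.
    by apply: mulr_ge0; [rewrite mulr_ge0|rewrite invr_ge0 ltW].
  rewrite le_eqVlt; apply/orP; left; apply/eqP.
  have -> : (1 + 8 / eta') / (eta * d ^+ 2) + eps / 4 * X =
      (1 + 8 / eta') / (eta * d ^+ 2) + 2 * eta' * X / (eta * d ^+ 2).
    by congr (_ + _); rewrite /eta'; field; rewrite !gt_eqF.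
  by field; rewrite !gt_eqF.
have -> : eps * X = eps / 4 * X + eps / 4 * X + eps / 4 * X + eps / 4 * X by field.
have T2 : 4 * H + eta * X <= 4 * (d * X) + 4 + eta * X by rewrite lerD2r; lra.
have dE : 4 * (d * X) = eps / 4 * X by rewrite /d; field.
have eE : eta * X = eps / 4 * X by rewrite /eta.
rewrite /K in HK; lra.
Qed.

(** * Inverses in intervals, modulo a composite number *)

(** The number of i with e + r i < n, for e < r. *)
Definition class_count (r n e : nat) : nat := ((n + (r.-1 - e)) %/ r)%N.

Lemma class_countS r n e : (e < r)%N ->
  class_count r n.+1 e = (class_count r n e + (e == n %% r))%N.
Proof.
move=> er; have r0 : (0 < r)%N by exact: leq_ltn_trans er.
rewrite /class_count.
rewrite {1 2}(divn_eq n r) addSn -!addnA -addnS !divnMDl// -addnA; congr addn.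
have := ltn_pmod n r0; move: (n %% r)%N => t tr.
case: (ltngtP e t) => et.
- have -> : ((t + (r.-1 - e)).+1 = 1 * r + (t - e))%N by lia.
  have -> : ((t + (r.-1 - e)) = 1 * r + (t - e).-1)%N by lia.
  by rewrite !divnMDl// !divn_small//; lia.
- by rewrite !divn_small//; lia.
- have -> : ((t + (r.-1 - e)).+1 = 1 * r + 0)%N by lia.
  by rewrite divnMDl// !divn_small//; lia.
Qed.

Lemma sum_residue_classes (V : nmodType) (r n : nat) (G : nat -> V) : (0 < r)%N ->
  \sum_(k < n) G k = \sum_(e < r) \sum_(i < class_count r n e) G (e + r * i)%N.
Proof.
move=> r0; elim: n => [|n IH].
  rewrite big_ord0 big1 // => e _; rewrite /class_count divn_small ?big_ord0//.
  by have := ltn_ord e; lia.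
rewrite big_ord_recr /= IH.
have mr := ltn_pmod n r0.
rewrite (bigD1 (Ordinal mr)) //= [RHS](bigD1 (Ordinal mr)) //=.
rewrite class_countS// eqxx addn1 big_ord_recr /= -!addrA; congr (_ + _).
(* the index n joins the class of n modulo r, as its element of rank n / r *)
have -> : class_count r n (n %% r) = (n %/ r)%N.
  rewrite /class_count {1}(divn_eq n r) -addnA divnMDl// [X in (_ + X %/ _)%N](_ : _ = r.-1).
    by rewrite (@divn_small r.-1) ?addn0 ?ltn_predL.
  by lia.
rewrite addrC mulnC addnC -divn_eq; congr (_ + _).
apply: eq_bigr => e en; rewrite class_countS//.
by have /negbTE : (e != n %% r :> nat)%N by []; move=> ->; rewrite addn0.
Qed.

Lemma class_count_le r n e p : (e < r)%N -> (n <= p * r)%N -> (class_count r n e <= p)%N.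
Proof.
move=> er np; rewrite /class_count -ltnS ltn_divLR; last by exact: leq_ltn_trans er.
by rewrite mulSn; lia.
Qed.

Lemma class_count_bound (R : realFieldType) r n e : (e < r)%N ->
  `|(class_count r n e)%:R - n%:R / r%:R| <= 1 :> R.
Proof.
move=> er; have r0 : (0 < r)%N by exact: leq_ltn_trans er.
have r0' : (0 : R) < r%:R by rewrite ltr0n.
have -> : (class_count r n e)%:R - n%:R / r%:R =
    ((class_count r n e * r)%N%:R - n%:R) / r%:R :> R.
  by rewrite natrM; field; rewrite gt_eqF.
rewrite normrM normfV (gtr0_norm r0') ler_pdivrMr// mul1r /class_count.
have := leq_divM (n + (r.-1 - e)) r; have := ltn_ceil (n + (r.-1 - e)) r0.
set D := (_ %/ r * r)%N; rewrite mulSn -/D => h1 h2.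
have h3 : (n <= D + r)%N by lia. have h4 : (D <= n + r)%N by lia.
move: h3 h4; rewrite -!(ler_nat R) !natrD => h3 h4; rewrite ler_norml; apply/andP; split; lra.
Qed.

Lemma sum_shift_mod (V : zmodType) (r a : nat) (G : nat -> V) :
  \sum_(e < r) G ((a + e) %% r)%N = \sum_(e < r) G e.
Proof.
case: r => [|r]; first by rewrite !big_ord0.
elim: a => [|a IH].
  by apply: eq_bigr => e _; rewrite add0n modn_small.
rewrite -{}IH big_ord_recr [RHS]big_ord_recl /= addn0 addrC; congr (_ + _).
  by rewrite addSnnS modnDr.
by apply: eq_bigr => i _; rewrite addSnnS.
Qed.

Lemma dvdn_mod_mulS r a y : (r %| a * (y %% r) + 1)%N = (r %| a * y + 1)%N.
Proof. by rewrite /dvdn -modnDml modnMmr modnDml. Qed.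

(** If a is prime to r, then y -> a y + 1 permutes the residues modulo r and
    vanishes once. Otherwise there is no solution, since the gcd of r and a
    would divide 1. *)
Lemma count_neg_inverse (r a b : nat) : (0 < r)%N ->
  (\sum_(y < r) (r %| a * (b + y) + 1) = coprime r a)%N.
Proof.
move=> r0.
have := sum_shift_mod r b (fun y => ((r %| a * y + 1)%N : nat)%:R : int).
under eq_bigr do rewrite dvdn_mod_mulS.
rewrite -!natr_sum => /eqP; rewrite eqr_nat => /eqP ->.
have [cop|ncop] := boolP (coprime r a); last first.
  rewrite big1 // => y _; apply/eqP; rewrite eqb0; apply: contra ncop => h.
  rewrite /coprime -dvdn1 -(@dvdn_addr (a * y)%N); last first.
    by rewrite dvdn_mulr// dvdn_gcdr.
  exact: dvdn_trans (dvdn_gcdl _ _) h.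
pose f (y : 'I_r) : 'I_r := Ordinal (ltn_pmod (a * y + 1) r0).
have finj : injective f.
  move=> y z [] /eqP; rewrite eqn_modDr.
  wlog yz : y z / (y <= z)%N.
    by move=> W; case: (leqP y z) => [/W//|/ltnW/W h /eqP e]; apply/esym/h; rewrite e.
  rewrite eq_sym eqn_mod_dvd ?leq_mul2l ?yz ?orbT// -mulnBr Gauss_dvdr// => d.
  apply/val_inj => /=.
  have := ltn_ord z; case: (posnP (z - y)%N) => [h|h]; first by lia.
  by have := dvdn_leq h d; lia.
have [g fg gf] := injF_bij finj.
have fE (y : 'I_r) : (r %| a * y + 1)%N = (f y == Ordinal r0) by rewrite -val_eqE.
rewrite (bigD1 (g (Ordinal r0))) //= fE gf eqxx big1 // => y yg.
rewrite fE; case: eqP => // e; case/eqP: yg; by rewrite -e fg.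
Qed.

Lemma count_neg_inverse_pairs (r a b : nat) : (0 < r)%N ->
  (\sum_(x < r) \sum_(y < r) (r %| (a + x) * (b + y) + 1) = totient r)%N.
Proof.
move=> r0; under eq_bigr do rewrite count_neg_inverse//.
rewrite totient_count_coprime big_mkord.
apply/eqP; rewrite -(eqr_nat int) !natr_sum.
rewrite -(sum_shift_mod r a (fun y => (coprime r y : nat)%:R : int)).
by apply/eqP/eq_bigr => e _; rewrite coprime_modr.
Qed.

Lemma totient_le q : (totient q <= q)%N.
Proof.
rewrite totient_count_coprime big_mkord (leq_trans (leq_sum _ (fun i _ => leq_b1 _)))//.
by rewrite sum1_card card_ord.
Qed.

Section composite.
Context (R : realType).

(** The congruence x y = -1 modulo q relates the numerator of a fraction of
    denominator q to the denominator of its right neighbour in a Farey set. *)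
Definition inverse_count (q a n b m : nat) : R :=
  \sum_(x < n) \sum_(y < m) (q %| (a + x) * (b + y) + 1)%N%:R.

(** For each x there is at most one y modulo q. *)
Lemma inverse_count_le q a n b m : (0 < q)%N -> (m <= q)%N ->
  0 <= inverse_count q a n b m <= n%:R.
Proof.
move=> q0 mq; apply/andP; split; first by do 2!apply: sumr_ge0 => ? _.
rewrite /inverse_count -[X in _ <= X%:R](card_ord n) -sumr_const; apply: ler_sum => x _.
rewrite -natr_sum (_ : 1 = 1%:R)// ler_nat.
rewrite (big_ord_widen q (fun y => ((q %| (a + x) * (b + y) + 1)%N : nat)) mq).
apply: (@leq_trans (coprime q (a + x))); last by case: coprime.
rewrite -(count_neg_inverse _ b q0) big_mkcond /=; apply: leq_sum => y _.
by case: ifP.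
Qed.

Lemma totient_main_term_le q n m : (n <= q)%N -> (m <= q)%N ->
  0 <= ((totient q)%:R * n%:R * m%:R / q%:R ^+ 2 : R) <= q%:R.
Proof.
case: q => [|q].
  by rewrite !leqn0 => /eqP-> /eqP->; rewrite mulr0 mul0r lexx.
move=> nq mq; have q0 : (0 : R) < q.+1%:R by rewrite ltr0n.
apply/andP; split.
  by rewrite !mulr_ge0// invr_ge0 exprn_ge0.
rewrite ler_pdivrMr ?exprn_gt0// expr2 mulrA.
by rewrite -!natrM ler_nat leq_mul// leq_mul// totient_le.
Qed.

(** Both intervals are split into residue classes modulo r. Of the pairs of
    classes, phi(r) are compatible with the congruence modulo r, and on each
    of them the congruence modulo p puts a point of a box, of sides about n /
    r and m / r, on a hyperbola. *)
Lemma inverse_count_prime_factor (eps : R) : 0 < eps -> exists P0 : nat,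
  forall p r, prime p -> (P0 < p)%N -> (0 < r)%N -> ~~ (p %| r)%N ->
  forall a n b m, (n <= p * r)%N -> (m <= p * r)%N ->
  `|inverse_count (p * r) a n b m -
    (totient (p * r))%:R * n%:R * m%:R / (p * r)%:R ^+ 2| <= eps * (p * r)%:R.
Proof.
move=> eps0; have e2 : 0 < eps / 2 by rewrite divr_gt0.
have [P0 HP0] := hyperbola_box_count e2.
pose P1 := Num.bound (6 / eps).
exists (maxn P0 P1) => p r pp; rewrite gtn_max => /andP[pP0 pP1] r0 pr a n b m nq mq.
have p0 : (0 : R) < p%:R by rewrite ltr0n prime_gt0.
have r0' : (0 : R) < r%:R by rewrite ltr0n.
have cop : coprime p r by rewrite prime_coprime.
have rF : (r%:R : 'F_p) != 0.
  by rewrite -(dvdn_pcharf (pchar_Fp pp)).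
pose good (x y : nat) := (r %| (a + x) * (b + y) + 1)%N.
have e3 : 3 <= eps / 2 * p%:R.
  have : 6 / eps < P1%:R by apply: archi_boundP; rewrite divr_ge0// ltW.
  rewrite ltr_pdivrMr// => h; have : (P1%:R : R) <= p%:R by rewrite ler_nat ltnW.
  move: (P1%:R : R) h => z h1 h2; nra.
have -> : inverse_count (p * r) a n b m =
    \sum_(x < r) \sum_(y < r | good x y) \sum_(i < class_count r n x)
      \sum_(j < class_count r m y)
        (((a + x)%:R / r%:R + i%:R) * ((b + y)%:R / r%:R + j%:R) == (- (r%:R ^- 2) : 'F_p))%:R.
  rewrite /inverse_count (sum_residue_classes _ (fun k => \sum_(y < m) ((p * r %| (a + k) * (b + y) + 1)%N%:R : R)) r0).
  apply: eq_bigr => x _.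
  under eq_bigr => i _ do rewrite (sum_residue_classes _ (fun k => ((p * r %| (a + (x + r * i)) * (b + k) + 1)%N%:R : R)) r0).
  rewrite exchange_big /= [RHS]big_mkcond /=; apply: eq_bigr => y _.
  (* whether the congruence modulo r holds depends only on the residue classes *)
  have gE i j : (r %| (a + (x + r * i)) * (b + (y + r * j)) + 1)%N = good x y.
    rewrite /good /dvdn.
    have -> : ((a + (x + r * i)) * (b + (y + r * j)) + 1 =
       (i * (b + (y + r * j)) + (a + x) * j) * r + ((a + x) * (b + y) + 1))%N by ring.
    by rewrite modnMDl.
  case: ifP => gxy; last first.
    by rewrite big1// => i _; rewrite big1// => j _; rewrite Gauss_dvd// gE gxy andbF.
  apply: eq_bigr => i _; apply: eq_bigr => j _.
  rewrite Gauss_dvd// gE gxy andbT; congr (_ %:R).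
  rewrite (dvdn_pcharf (pchar_Fp pp)) !natrD natrM !natrD !natrM.
  rewrite -[in RHS]addr_eq0.
  set A : 'F_p := a%:R; set B : 'F_p := b%:R.
  have -> : ((A + x%:R) / r%:R + i%:R) * ((B + y%:R) / r%:R + j%:R) + r%:R ^- 2 =
     ((A + (x%:R + r%:R * i%:R)) * (B + (y%:R + r%:R * j%:R)) + 1) / r%:R ^+ 2.
    by field.
  by rewrite mulf_eq0 invr_eq0 expf_eq0 (negbTE rF) orbF.
have cnt : \sum_(x < r) \sum_(y < r | good x y) (1 : R) = (totient r)%:R.
  rewrite -(count_neg_inverse_pairs a b r0) natr_sum; apply: eq_bigr => x _.
  by rewrite natr_sum big_mkcond /=; apply: eq_bigr => y _; rewrite /good; case: ifP.
have tot_le : (totient r)%:R <= r%:R :> R by rewrite ler_nat totient_le.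
pose T := n%:R * m%:R / (r%:R ^+ 2 * p%:R) : R.
(* phi(p r) = (p - 1) phi(r): the part with -1 is an error of size at most r *)
have mainE : (totient (p * r))%:R * n%:R * m%:R / (p * r)%:R ^+ 2 =
   (totient r)%:R * T - (totient r)%:R * (n%:R * m%:R / (p * r)%:R ^+ 2) :> R.
  rewrite totient_coprime// totient_prime// !natrM /T.
  have -> : p.-1%:R = p%:R - 1 :> R by rewrite -subn1 natrB ?prime_gt0.
  by field; rewrite !gt_eqF.
have small : 0 <= ((totient r)%:R * (n%:R * m%:R / (p * r)%:R ^+ 2) : R) <= (totient r)%:R.
  have h0 : 0 <= n%:R * m%:R / (p * r)%:R ^+ 2 :> R.
    by rewrite !mulr_ge0// invr_ge0 exprn_ge0.
  rewrite mulr_ge0//= ler_piMr// ler_pdivrMr ?mul1r ?exprn_gt0 ?ltr0n ?muln_gt0 ?r0 ?(prime_gt0 pp)//.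
  by rewrite expr2 -!natrM ler_nat leq_mul.
have main : `|(\sum_(x < r) \sum_(y < r | good x y) \sum_(i < class_count r n x)
      \sum_(j < class_count r m y)
        (((a + x)%:R / r%:R + i%:R) * ((b + y)%:R / r%:R + j%:R) == (- (r%:R ^- 2) : 'F_p))%:R)
    - (totient r)%:R * T| <= (totient r)%:R * (eps / 2 * p%:R + 2).
  rewrite -cnt !mulr_suml -sumrB.
  apply: le_trans (ler_norm_sum _ _ _) _; apply: ler_sum => x _.
  rewrite !mulr_suml -sumrB.
  apply: le_trans (ler_norm_sum _ _ _) _; apply: ler_sum => y _.
  rewrite !mul1r.
  have lx := class_count_le (ltn_ord x) nq; have ly := class_count_le (ltn_ord y) mq.
  have c0 : (- (r%:R ^- 2) : 'F_p) != 0 by rewrite oppr_eq0 invr_eq0 expf_neq0.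
  have H := HP0 p pp pP0 ((a + x)%:R / r%:R) ((b + y)%:R / r%:R) _ _ _ c0 lx ly.
  set N := \sum_(i < _) _ in H *.
  have bx := class_count_bound R n (ltn_ord x); have by_ := class_count_bound R m (ltn_ord y).
  move: lx ly; rewrite -!(ler_nat R).
  set l := (class_count r n x)%:R : R in H bx *; set l' := (class_count r m y)%:R : R in H by_ *.
  move=> lx ly.
  have -> : N - T = (N - l * l' / p%:R) + (l * (l' - m%:R / r%:R) + m%:R / r%:R * (l - n%:R / r%:R)) / p%:R.
    by rewrite /T; field; rewrite !gt_eqF.
  apply: le_trans (ler_normD _ _) _; rewrite lerD//.
  rewrite normrM normfV (gtr0_norm p0) ler_pdivrMr//.
  apply: le_trans (ler_normD _ _) _; rewrite (normrM l) (normrM (m%:R / r%:R)).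
  have mr : 0 <= (m%:R / r%:R : R) <= p%:R.
    by rewrite divr_ge0//= ler_pdivrMr// -natrM ler_nat.
  case/andP: mr => mr0 mr1.
  have l0 : 0 <= l by rewrite ler0n.
  rewrite (ger0_norm l0) (ger0_norm mr0).
  have h1 : l * `|l' - m%:R / r%:R| <= p%:R * 1 by rewrite ler_pM.
  have h2 : m%:R / r%:R * `|l - n%:R / r%:R| <= p%:R * 1 by rewrite ler_pM.
  by lra.
rewrite mainE opprB addrC -addrA [X in `|_ + X|]addrC.
apply: le_trans (ler_normD _ _) _; case/andP: small => s0 s1.
rewrite (ger0_norm s0); apply: le_trans (lerD s1 main) _.
apply: (@le_trans _ _ (r%:R * (eps / 2 * p%:R + 3))).
  rewrite -[X in X + _]mulr1 -mulrDr ler_pM//; lra.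
rewrite natrM mulrA [eps * _]mulrC; nra.
Qed.

End composite.

(** * Inverses in intervals, for most moduli *)

Lemma leq_sqr b : (b <= b ^ 2)%N.
Proof. by case: b => // b; rewrite -{1}[b.+1]expn1 leq_pexp2l. Qed.

(** Write q = b^2 k with b maximal, so that k is squarefree. If all primes of
    k are at most M = max(P, B), then k divides M!, so for b < B and q > B^2
    M! some prime p > M divides k; it divides k once, and does not divide b <
    p. *)
Lemma exact_prime_or_square (P B q : nat) : (0 < q)%N ->
  (B ^ 2 * (maxn P B)`! < q)%N ->
  (exists p r, [/\ prime p, (P < p)%N, (0 < r)%N, ~~ (p %| r)%N & q = (p * r)%N]) \/
  (exists2 b, (B <= b)%N & (b ^ 2 %| q)%N).
Proof.
move=> q0 qbig.
have ex : exists b, (b ^ 2 %| q)%N by exists 1%N; rewrite dvd1n.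
have ub b : (b ^ 2 %| q)%N -> (b <= q)%N.
  by move=> /dvdn_leq -/(_ q0); apply: leq_trans; exact: leq_sqr.
case: (ex_maxnP ex ub) => b bq bmax.
have [Bb|bB] := leqP B b; first by right; exists b.
left.
have b0 : (0 < b)%N by apply: (bmax 1%N); rewrite dvd1n.
have /dvdnP[k qE] := bq.
have k0 : (0 < k)%N by move: q0; rewrite qE muln_gt0 => /andP[].
have sqfree p : prime p -> (p %| k)%N -> ~~ (p ^ 2 %| k)%N.
  move=> pp pk; apply/negP => p2k.
  have : (p * b <= b)%N.
    by apply: bmax; rewrite expnMn qE dvdn_mul.
  by have := prime_gt1 pp; nia.
have [/hasP[p pk Mp]|/hasPn small] := boolP (has (fun p => maxn P B < p)%N (primes k)).
  move: pk; rewrite mem_primes => /and3P[pp _ pk].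
  move: Mp; rewrite gtn_max => /andP[Pp Bp].
  have pb : ~~ (p %| b)%N by apply/negP => /dvdn_leq -/(_ b0); lia.
  have /dvdnP[k' kE] := pk.
  exists p, (k' * b ^ 2)%N; split => //.
  - by move: q0; rewrite qE kE !muln_gt0 => /andP[/andP[-> _] ->].
  - rewrite Euclid_dvdM// Euclid_dvdX// andbT negb_or pb andbT.
    apply: contra (sqfree p pp pk) => /dvdnP[j jE].
    by rewrite kE jE -mulnA dvdn_mull.
  - by rewrite qE kE; ring.
exfalso.
have kM : (k %| (maxn P B)`!)%N.
  apply/dvdn_partP => // p pk; have pk' : p \in primes k by [].
  move: (pk'); rewrite mem_primes => /and3P[pp _ pdk].
  have l1 : logn p k = 1%N.
    apply/eqP; rewrite eqn_leq logn_gt0 pk' andbT.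
    by rewrite leqNgt -pfactor_dvdn// sqfree.
  rewrite p_part l1 expn1 dvdn_fact// prime_gt0//= leqNgt.
  exact: small.
move: qbig; rewrite qE mulnC ltnNge => /negP; apply.
by apply: leq_mul; [apply: dvdn_leq => //; exact: fact_gt0|rewrite leq_exp2r// ltnW].
Qed.

Section average.
Context (R : realType).

Lemma count_multiples_le (d N : nat) : (0 < d)%N ->
  \sum_(1 <= q < N.+1) (d %| q)%N%:R <= N%:R / d%:R :> R.
Proof.
move=> d0; have d0' : (0 : R) < d%:R by rewrite ltr0n.
elim: N => [|N IH]; first by rewrite big_geq// mul0r.
suff h : \sum_(1 <= q < N.+1) (d %| q)%N%:R = (N %/ d)%N%:R :> R.
  rewrite big_nat_recr//= h -natrD ler_pdivlMr// -natrM ler_nat.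
  case: (boolP (d %| N.+1)%N) => [/dvdnP[k kE]|_]; last first.
    by rewrite addn0 (leq_trans (leq_divM _ _)).
  have : (N %/ d < k)%N by rewrite ltn_divLR// -kE.
  by rewrite addn1 kE leq_mul2r => ->; rewrite orbT.
elim: N {IH} => [|N IH]; first by rewrite big_geq// div0n.
rewrite big_nat_recr//= IH -natrD; congr _%:R.
by rewrite divnS// addnC.
Qed.

Lemma sum_inv_sq_le (B N : nat) : (1 < B)%N ->
  \sum_(B <= b < N) (b%:R ^+ 2)^-1 <= (B.-1%:R)^-1 :> R.
Proof.
move=> B1; have [NB|BN] := leqP N B.
  by rewrite big_geq// invr_ge0.
apply: (@le_trans _ _ (\sum_(B <= b < N) (((b.-1)%:R)^-1 - (b.+1.-1%:R)^-1))).
  apply: ler_sum_nat => b /andP[Bb bN].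
  have b1 : (1 : R) <= b.-1%:R by rewrite ler1n; lia.
  have -> : b%:R = b.-1%:R + 1 :> R by rewrite natr1 prednK//; lia.
  move: b1; set t := _%:R : R => b1.
  have t0 : 0 < t by lra. have t1 : 0 < t + 1 by lra.
  have -> : t^-1 - (t + 1)^-1 = (t * (t + 1))^-1 by field; rewrite !gt_eqF.
  rewrite lef_pV2 ?posrE ?mulr_gt0 ?exprn_gt0//; nra.
rewrite (@telescope_sumr_eq _ _ _ (fun b => - (b.-1%:R : R)^-1)); first last.
- by move=> k _; rewrite opprK addrC.
- exact: ltnW.
by rewrite opprK gerDr oppr_le0 invr_ge0.
Qed.

(** The estimate of [inverse_count_prime_factor] holds for q unless q is
    bounded or divisible by b^2 for some b >= B. For these exceptional q the
    trivial bound q is used: the first are finitely many, and the second have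
    density at most the sum of the 1 / b^2, that is O(1 / B). *)
Lemma inverse_count_average (eps : R) : 0 < eps -> exists2 K : R, 0 <= K &
  forall N (a n b m : nat -> nat),
    (forall q, n q <= q)%N -> (forall q, m q <= q)%N ->
  \sum_(1 <= q < N.+1) `|inverse_count R q (a q) (n q) (b q) (m q) -
    (totient q)%:R * (n q)%:R * (m q)%:R / q%:R ^+ 2| <= eps * N%:R ^+ 2 + K * N%:R.
Proof.
move=> eps0; have e2 : 0 < eps / 2 by rewrite divr_gt0.
have [P0 HP0] := inverse_count_prime_factor e2.
pose B := (Num.bound (2 / eps)).+2.
have HB : (B.-1%:R)^-1 <= eps / 2 :> R.
  rewrite -[leRHS]invrK lef_pV2 ?posrE ?invr_gt0//.
  rewrite invf_div; apply: (@le_trans _ _ (Num.bound (2 / eps))%:R); last by rewrite ler_nat.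
  by rewrite ltW// archi_boundP// divr_ge0// ltW.
pose T := (B ^ 2 * (maxn P0 B)`!)%N.
exists T%:R => // N a n b m nq mq.
have triv q : (0 < q)%N -> (q <= N)%N -> `|inverse_count R q (a q) (n q) (b q) (m q) -
    (totient q)%:R * (n q)%:R * (m q)%:R / q%:R ^+ 2| <= N%:R.
  move=> q0 qN.
  have /andP[h0 h1] := inverse_count_le R (a q) (n q) (b q) q0 (mq q).
  have /andP[h2 h3] := totient_main_term_le R (nq q) (mq q).
  have h4 : (q%:R : R) <= N%:R by rewrite ler_nat.
  have h5 : ((n q)%:R : R) <= q%:R by rewrite ler_nat.
  rewrite ler_norml; apply/andP; split; lra.
apply: (@le_trans _ _ (\sum_(1 <= q < N.+1) (eps / 2 * N%:R + N%:R * ((q <= T)%N%:R +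
    \sum_(B <= c < N.+1) (c ^ 2 %| q)%N%:R)))).
  apply: ler_sum_nat => q /andP[q0]; rewrite ltnS => qN.
  have s0 : 0 <= \sum_(B <= c < N.+1) (c ^ 2 %| q)%N%:R :> R by rewrite sumr_ge0.
  have N0 : (0 : R) <= N%:R by [].
  have eN : 0 <= eps / 2 * N%:R by rewrite mulr_ge0// ltW.
  have [qT|Tq] := leqP q T.
    apply: le_trans (triv q q0 qN) _; rewrite mulrDr mulr1.
    have := mulr_ge0 N0 s0; lra.
  have [[p [r [pp Pp r0 pr qE]]]|[c Bc cq]] := exact_prime_or_square q0 Tq.
    have := HP0 p r pp Pp r0 pr (a q) (n q) (b q) (m q).
    rewrite -qE => /(_ (nq q) (mq q)) h; apply: le_trans h _.
    have : eps / 2 * q%:R <= eps / 2 * N%:R by rewrite ler_wpM2l ?ler_nat// ltW.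
    by have := mulr_ge0 N0 s0; rewrite add0r; lra.
  apply: le_trans (triv q q0 qN) _.
  have cN : (c < N.+1)%N.
    rewrite ltnS (leq_trans _ qN)// (leq_trans _ (dvdn_leq q0 cq))//.
    exact: leq_sqr.
  have : 1 <= \sum_(B <= c < N.+1) (c ^ 2 %| q)%N%:R :> R.
    rewrite (bigD1_seq c) ?mem_index_iota ?Bc ?iota_uniq//= cq lerDl.
    by rewrite sumr_ge0.
  by move=> /(ler_wpM2l N0); rewrite mulr1 add0r; lra.
rewrite big_split /= sumr_const_nat subn1 /= -mulr_sumr big_split /=.
rewrite exchange_big /=.
have h1 : \sum_(1 <= q < N.+1) (q <= T)%N%:R <= T%:R :> R.
  rewrite -natr_sum ler_nat; elim: (N) => [|k IH]; first by rewrite big_geq.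
  rewrite big_nat_recr//=; have [kT|kT] := ltnP k T; last by rewrite addn0.
  rewrite addn1 (leq_ltn_trans _ kT)//.
  rewrite -[leqRHS](_ : \sum_(1 <= q < k.+1) 1 = k)%N; last by rewrite sum_nat_const_nat muln1 subn1.
  by apply: leq_sum => q _; exact: leq_b1.
have h2 : \sum_(B <= c < N.+1) \sum_(1 <= q < N.+1) (c ^ 2 %| q)%N%:R <= N%:R * (eps / 2) :> R.
  apply: (@le_trans _ _ (\sum_(B <= c < N.+1) N%:R * (c%:R ^+ 2)^-1)).
    apply: ler_sum_nat => c /andP[Bc _]; rewrite -natrX; apply: count_multiples_le.
    by rewrite expn_gt0; lia.
  rewrite -mulr_sumr ler_wpM2l//; apply: le_trans HB; exact: sum_inv_sq_le.
rewrite -mulr_natl; set S1 := \sum_(_ <= q < _) _ in h1 *; set S2 := \sum_(_ <= c < _) _ in h2 *.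
have : N%:R * (S1 + S2) <= N%:R * (T%:R + N%:R * (eps / 2)) by rewrite ler_wpM2l// lerD.
rewrite expr2; lra.
Qed.

End average.

(** * The value zeta(2), and increments of an integral *)

Section zeta2.
Context {R : realType}.

Definition zsum (N : nat) : R := \sum_(1 <= k < N.+1) (k%:R ^+ 2)^-1.

Let zterm (n : nat) : (n.+1%:R `^ (- 2) : R) = (n.+1%:R ^+ 2)^-1.
Proof. by rewrite -powR_mulrn// powRN. Qed.

Let zseries N : series (fun n : nat => n.+1%:R `^ (- 2) : R) N = zsum N.
Proof.
rewrite /series /zsum /= big_add1 /=; apply: eq_bigr => i _; exact: zterm.
Qed.

Lemma zsum_tail (N M : nat) : (0 < N)%N -> (N <= M)%N ->
  0 <= zsum M - zsum N <= N%:R^-1.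
Proof.
move=> N0 NM; rewrite /zsum [X in X - _](@big_cat_nat _ _ _ N.+1) //= [X in X - _]addrC addrK.
apply/andP; split; first by apply: sumr_ge0 => k _; rewrite invr_ge0 exprn_ge0.
exact: (@sum_inv_sq_le R N.+1 M.+1).
Qed.

Lemma zeta2_approx (N : nat) : (0 < N)%N -> 0 <= zeta (2 : R) - zsum N <= N%:R^-1.
Proof.
move=> N0.
have nd : nondecreasing_seq zsum.
  apply/nondecreasing_seqP => n; rewrite /zsum [leRHS]big_nat_recr//= lerDl.
  by rewrite invr_ge0 exprn_ge0.
have ub n : zsum n <= zsum 1 + 1.
  apply: (@le_trans _ _ (zsum (maxn n 1))); first by apply: nd; exact: leq_maxl.
  have := @zsum_tail 1 (maxn n 1) isT (leq_maxr _ _); rewrite invr1; lra.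
have cz : cvgn zsum.
  apply: nondecreasing_is_cvgn => //; exists (zsum 1 + 1) => _ [n _ <-]; exact: ub.
have zE : zeta (2 : R) = limn zsum.
  by rewrite /zeta (_ : series _ = zsum)//; apply/funext => n; exact: zseries.
rewrite zE; apply/andP; split.
  by rewrite subr_ge0; exact: nondecreasing_cvgn_le.
rewrite lerBlDr; apply: (@limr_le nat \oo _ R _ zsum); first exact: cz.
by exists N => //= M /= /(zsum_tail N0); lra.
Qed.

(** The upper bound makes zeta(2) - 1 <= 3/4, the contraction ratio of
    [totient_rate_contract]. *)
Lemma zeta2_bounds : 1 <= zeta (2 : R) <= 7 / 4.
Proof.
have := @zeta2_approx 2 isT.
rewrite /zsum big_nat_recr//= big_nat1 expr1n invr1; lra.
Qed.

End zeta2.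

Section primitive.
Context {R : realType}.
Notation mu := (@lebesgue_measure R).

Lemma Rintegral_increment (f : R -> R) (a b lo hi : R) :
  mu.-integrable `[0, 1] (EFin \o f) -> 0 <= a -> a <= b -> b <= 1 ->
  (forall x, a < x <= b -> lo <= f x <= hi) ->
  lo * (b - a) <= \int[mu]_(x in `[0, b]) f x - \int[mu]_(x in `[0, a]) f x
    <= hi * (b - a).
Proof.
move=> fi a0 ab b1 H.
have fb : mu.-integrable `[0, b] (EFin \o f).
  by apply: integrableS fi => //; apply: subset_itvl; rewrite bnd_simp.
rewrite Rintegral_itvB ?bnd_simp//.
have fab : mu.-integrable `]a, b] (EFin \o f).
  by apply: integrableS fb => //; apply: subset_itvr; rewrite bnd_simp.
have cI (r : R) : mu.-integrable `]a, b] (EFin \o cst r).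
  apply: (@integrableS _ _ _ mu `[0, 1]) => //.
    by move=> x /=; rewrite !in_itv/= => /andP[? ?]; apply/andP; split; lra.
  apply: continuous_compact_integrable; first exact: segment_compact.
  by apply: continuous_subspaceT => x; exact: cst_continuous.
have cE (r : R) : \int[mu]_(x in `]a, b]) r = r * (b - a).
  rewrite Rintegral_cst//; congr (_ * _).
  rewrite [X in fine X](_ : _ = (b - a)%:E)//.
  apply: etrans (@lebesgue_measure_itv R `]a, b]) _; rewrite /= lte_fin.
  by move: ab; rewrite le_eqVlt => /predU1P[->|->]; rewrite ?ltxx ?subrr.
apply/andP; split; rewrite -cE.
- apply: le_Rintegral; [by []|exact: cI|exact: fab|].
  by move=> x; rewrite /= in_itv/= => /H /andP[].
- apply: le_Rintegral; [by []|exact: fab|exact: cI|].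
  by move=> x; rewrite /= in_itv/= => /H /andP[].
Qed.

End primitive.

(** * Weighted sums of the totient function *)

Section totient_sums.
Context {R : realType}.
Notation mu := (@lebesgue_measure R).
Implicit Types (g : R -> R) (X Y : R).

(** The class of functions for which the asymptotics of totient sums is
    uniform: monotonicity bounds the error of Riemann sums independently of
    the function. *)
Definition profile g := [/\ measurable_fun setT g, forall x, 0 <= g x <= 1,
  forall x y, 0 < x -> x <= y -> y <= 1 -> g x <= g y & forall x, 1 < x -> g x = 0].

Definition area g : R := \int[mu]_(x in `[0, 1]) g x.

Lemma profile_integrable g : profile g -> mu.-integrable `[0, 1] (EFin \o g).
Proof.
move=> [mg g01 _ _]; apply: measurable_bounded_integrable => //.
- by rewrite [X in (X < _)%E](_ : _ = 1%:E) ?ltry//;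
     apply: etrans (@lebesgue_measure_itv R `[0, 1]) _; rewrite /= lte_fin ltr01 oppr0 adde0.
- exact: measurable_funTS.
- exists 1; split; first exact: num_real.
  by move=> M M1 x _; rewrite /= ger0_norm; have /andP[] := g01 x => // _ /le_trans; apply; exact: ltW.
Qed.

Lemma area01 g : profile g -> 0 <= area g <= 1.
Proof.
move=> pg; have gi := profile_integrable pg; case: pg => mg g01 _ _.
have := Rintegral_increment (lo := 0) (hi := 1) gi (lexx 0) ler01 (lexx 1) (fun x _ => g01 x).
by rewrite set_itv1 Rintegral_set1 !subr0 !mulr1.
Qed.

(** For a nondecreasing function, the sum and the integral are compared cell
    by cell, and the total error is at most the variation, which is at most 1. *)
Lemma riemann_sum g X : profile g -> 1 <= X ->
  `|\sum_(1 <= q < (Num.truncn X).+1) g (q%:R / X) - X * area g| <= 1.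
Proof.
move=> pg X1; have gi := profile_integrable pg; have [mg g01 gm _] := pg.
have X0 : 0 < X by exact: lt_le_trans X1.
set N := Num.truncn X.
have NX : N%:R <= X by rewrite truncn_le// ltW.
have XN : X < N%:R + 1 by rewrite natr1 truncnS_gt.
have N1 : (0 < N)%N by rewrite -(ltr_nat R); lra.
pose J x := \int[mu]_(t in `[0, x]) g t.
have J0 : J 0 = 0 by rewrite /J set_itv1 Rintegral_set1.
have node (q : nat) : (q <= N)%N -> 0 <= (q%:R / X : R) <= 1.
  move=> qN; rewrite divr_ge0 ?(ltW X0)//= ler_pdivrMr// mul1r (le_trans _ NX)//.
  by rewrite ler_nat.
have stepw (q : nat) : (q.+1%:R / X - q%:R / X : R) = X^-1.
  by rewrite -mulrBl -natr1 addrAC subrr add0r mul1r.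
have mono (q : nat) : (q%:R / X : R) <= q.+1%:R / X.
  by rewrite ler_pM2r ?invr_gt0// ler_nat.
have upper q : (q < N)%N -> J (q.+1%:R / X) - J (q%:R / X) <= g (q.+1%:R / X) * X^-1.
  move=> qN; rewrite -[X in _ <= _ * X](stepw q).
  have /andP[q0 _] := node q (ltnW qN); have /andP[_ q1] := node _ qN.
  have := Rintegral_increment (lo := 0) (hi := g (q.+1%:R / X)) gi q0 (mono q) q1.
  case/(_ _)/andP => // x /andP[qx xq].
  by have /andP[-> _] := g01 x; apply: gm => //; exact: le_lt_trans qx.
have lower q : (0 < q)%N -> (q < N)%N -> g (q%:R / X) * X^-1 <= J (q.+1%:R / X) - J (q%:R / X).
  move=> q00 qN; rewrite -[X in _ * X <= _](stepw q).
  have /andP[q0 _] := node q (ltnW qN); have /andP[_ q1] := node _ qN.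
  have := Rintegral_increment (lo := g (q%:R / X)) (hi := 1) gi q0 (mono q) q1.
  case/(_ _)/andP => // x /andP[qx xq].
  have /andP[_ ->] := g01 x; rewrite andbT; apply: gm; rewrite ?(ltW qx)//.
    by rewrite divr_gt0// ltr0n.
  exact: le_trans q1.
have tele n : J (n%:R / X) = \sum_(0 <= q < n) (J (q.+1%:R / X) - J (q%:R / X)).
  by rewrite (telescope_sumr (fun q => J (q%:R / X)))// mul0r J0 subr0.
(* the last cell, between N / X and 1, is incomplete *)
have JN : 0 <= area g - J (N%:R / X) <= X^-1.
  have /andP[q0 q1] := node N (leqnn N).
  have := Rintegral_increment (lo := 0) (hi := 1) gi q0 q1 (lexx 1) (fun x _ => g01 x).
  rewrite -/(J _) -/(area g) mul0r mul1r => /andP[-> h]; rewrite (le_trans h)//.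
  by rewrite -(ler_pM2r X0) mulrBl mulVf ?mulfVK ?gt_eqF// mul1r; lra.
have up : J (N%:R / X) <= (\sum_(1 <= q < N.+1) g (q%:R / X)) * X^-1.
  rewrite tele// mulr_suml [leRHS]big_add1 /=.
  by apply: ler_sum_nat => q /andP[_ qN]; exact: upper.
have lo : (\sum_(1 <= q < N.+1) g (q%:R / X) - 1) * X^-1 <= J (N%:R / X).
  rewrite big_nat_recr//= tele// (big_ltn N1) /=.
  have : 0 <= J (1 / X) - J (0 / X).
    have /andP[q0 _] := node 0%N isT; have /andP[_ q1] := node _ N1.
    have := Rintegral_increment (lo := 0) (hi := 1) gi q0 (mono 0%N) q1 (fun x _ => g01 x).
    by rewrite mul0r => /andP[].
  have : (\sum_(1 <= q < N) g (q%:R / X)) * X^-1 <= \sum_(1 <= q < N) (J (q.+1%:R / X) - J (q%:R / X)).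
    by rewrite mulr_suml; apply: ler_sum_nat => q /andP[q1 qN]; exact: lower.
  have : (g (N%:R / X) - 1) * X^-1 <= 0.
    by rewrite mulr_le0_ge0 ?invr_ge0 ?(ltW X0)// subr_le0; case/andP: (g01 (N%:R / X)).
  rewrite -addrA mulrDl; lra.
have sX : X * X^-1 = 1 by rewrite mulfV// gt_eqF.
set S := \sum_(_ <= q < _) _ in up lo *.
have := ler_wpM2l (ltW X0) up; have := ler_wpM2l (ltW X0) lo.
rewrite ![X * (_ * X^-1)]mulrCA sX !mulr1.
case/andP: JN => /(ler_wpM2l (ltW X0)); rewrite mulr0 mulrBr => a1 /(ler_wpM2l (ltW X0)).
rewrite sX mulrBr => a2 a3 a4.
by rewrite ler_norml; apply/andP; split; lra.
Qed.

Definition totient_sum g X : R :=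
  \sum_(1 <= q < (Num.truncn X).+1) (totient q)%:R / q%:R * g (q%:R / X).

Lemma totient_sum_ext g X N : profile g -> 0 < X -> (Num.truncn X <= N)%N ->
  \sum_(1 <= q < N.+1) (totient q)%:R / q%:R * g (q%:R / X) = totient_sum g X.
Proof.
move=> [_ _ _ g0] X0 XN; rewrite /totient_sum (@big_cat_nat _ _ _ (Num.truncn X).+1)//=.
rewrite [X in _ + X]big_nat_cond [X in _ + X]big1 ?addr0// => q /andP[/andP[Xq _] _].
rewrite g0 ?mulr0// ltr_pdivlMr// mul1r; apply: lt_le_trans (truncnS_gt _) _.
by rewrite ler_nat.
Qed.

Lemma totient_sum_bound g X : profile g -> 0 <= X -> 0 <= totient_sum g X <= X.
Proof.
move=> [_ g01 _ _] X0; rewrite /totient_sum.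
have term q : 0 <= (totient q)%:R / q%:R * g (q%:R / X) <= 1.
  have /andP[g0 g1] := g01 (q%:R / X).
  have p0 : 0 <= (totient q)%:R / q%:R :> R by rewrite divr_ge0.
  rewrite mulr_ge0//= mulr_ile1//.
  case: q p0 {g0 g1} => [|q] _; first by rewrite invr0 mulr0.
  by rewrite ler_pdivrMr ?ltr0n// mul1r ler_nat totient_le.
apply/andP; split; first by apply: sumr_ge0 => q _; case/andP: (term q).
apply: (@le_trans _ _ (\sum_(1 <= q < (Num.truncn X).+1) 1)).
  by apply: ler_sum => q _; case/andP: (term q).
by rewrite sumr_const_nat subn1 truncn_le.
Qed.

Lemma sum_multiples (V : zmodType) (d N : nat) (H : nat -> V) : (0 < d)%N ->
  \sum_(1 <= q < N.+1 | (d %| q)%N) H q = \sum_(1 <= k < N.+1 | (d * k <= N)%N) H (d * k)%N.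
Proof.
move=> d0.
transitivity (\sum_(1 <= q < N.+1) \sum_(1 <= k < N.+1 | (d * k == q)%N) H (d * k)%N).
  rewrite big_mkcond /=; apply: eq_big_nat => q /andP[q0 qN].
  case: ifP => [/dvdnP[k kE]|nd]; last first.
    by rewrite big1// => k /eqP kE; move: nd; rewrite -kE dvdn_mulr.
  rewrite (eq_bigl (fun j => j == k)); last first.
    by move=> j /=; rewrite kE mulnC eqn_pmul2r.
  rewrite big_nat1_eq ifT ?kE 1?mulnC//.
  by move: q0 qN; rewrite kE; nia.
rewrite (exchange_big_dep predT)//= [RHS]big_mkcond /=; apply: eq_big_nat => k /andP[k0 kN].
rewrite (eq_bigl (fun q => q == (d * k)%N)); last by move=> q; rewrite eq_sym.
rewrite big_nat1_eq muln_gt0 d0 k0 ltnS /=; by case: ifP.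
Qed.

(** Gauss: q is the sum of phi(d) over the divisors d of q. With q = d k, the
    terms with a given k form a totient sum at the scale X / k. *)
Lemma sum_profile_totient g X : profile g -> 0 < X ->
  \sum_(1 <= q < (Num.truncn X).+1) g (q%:R / X) =
  \sum_(1 <= k < (Num.truncn X).+1) k%:R^-1 * totient_sum g (X / k%:R).
Proof.
move=> pg X0; set N := Num.truncn X; have [_ _ _ g0] := pg.
transitivity (\sum_(1 <= q < N.+1) \sum_(1 <= d < N.+1 | (d %| q)%N)
    (totient d)%:R * (g (q%:R / X) / q%:R)).
  apply: eq_big_nat => q /andP[q0 qN].
  rewrite -mulr_suml.
  have e : \sum_(1 <= d < N.+1 | (d %| q)%N) (totient d)%:R = q%:R :> R.
    rewrite -[in RHS](sum_totient_dvd q) natr_sum.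
    rewrite -(big_mkord (fun d => d %| q)%N (fun d => (totient d)%:R : R)).
    rewrite [RHS]big_ltn_cond// dvd0n gtn_eqF//=.
    rewrite (@big_cat_nat _ _ _ q.+1)//= [X in _ + X]big_nat_cond [X in _ + X]big1 ?addr0//.
    move=> d /andP[/andP[qd _] dq]; have := dvdn_leq q0 dq; lia.
  by rewrite e mulrCA mulfV ?mulr1// pnatr_eq0 -lt0n.
rewrite (exchange_big_dep predT)//=.
transitivity (\sum_(1 <= d < N.+1) \sum_(1 <= k < N.+1)
    (totient d)%:R * (g ((d * k)%:R / X) / (d * k)%:R)).
  apply: eq_big_nat => d /andP[d0 dN].
  rewrite (@sum_multiples _ d N (fun q => (totient d)%:R * (g (q%:R / X) / q%:R)))// big_mkcond.
  apply: eq_bigr => k _; case: leqP => // dk.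
  rewrite g0 ?mul0r ?mulr0// ltr_pdivlMr// mul1r; apply: lt_le_trans (truncnS_gt _) _.
  by rewrite ler_nat.
rewrite exchange_big /=; apply: eq_big_nat => k /andP[k0 kN].
have k0' : (0 : R) < k%:R by rewrite ltr0n.
rewrite -(@totient_sum_ext g (X / k%:R) N)//; first last.
- apply: le_truncn; rewrite ler_pdivrMr// -{1}[X]mulr1 ler_wpM2l ?(ltW X0)//.
  by rewrite ler1n.
- by rewrite divr_gt0.
rewrite mulr_sumr; apply: eq_big_nat => d /andP[d0 _].
have d0' : (0 : R) < d%:R by rewrite ltr0n.
rewrite natrM (_ : d%:R / (X / k%:R) = d%:R * k%:R / X); last first.
  by field; rewrite !gt_eqF.
by field; rewrite !gt_eqF.
Qed.

Local Notation z2 := (zeta (2 : R)).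

Let z2_gt0 : 0 < z2. Proof. by have /andP[] := @zeta2_bounds R; lra. Qed.

(** The initial rate of the iteration: both terms lie in [0, X]. *)
Lemma totient_error_bound g X : profile g -> 0 <= X ->
  `|totient_sum g X - X * area g / z2| <= X.
Proof.
move=> pg X0; have /andP[s0 s1] := totient_sum_bound pg X0.
have /andP[a0 a1] := area01 pg.
have t0 : 0 <= X * area g / z2 by rewrite divr_ge0 ?mulr_ge0 ?(ltW z2_gt0).
have t1 : X * area g / z2 <= X.
  rewrite ler_pdivrMr// ler_wpM2l//; have /andP[] := @zeta2_bounds R; lra.
by rewrite ler_norml; apply/andP; split; lra.
Qed.

Definition totient_rate (d : R) := exists2 X0 : R, 1 <= X0 &
  forall X g, X0 <= X -> profile g -> `|totient_sum g X - X * area g / z2| <= d * X.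

(** The term k = 1 of [sum_profile_totient] is the totient sum at X itself.
    Replace the terms k >= 2 by their asymptotics: the main terms add up to X
    area(g) (zeta(2) - 1) / zeta(2), which leaves X area(g) / zeta(2) for k =
    1, and the errors add up to at most (zeta(2) - 1) d X, apart from the
    terms with X / k < X0, whose sum is bounded. *)
Lemma totient_rate_contract (d eta : R) : 0 <= d -> 0 < eta ->
  totient_rate d -> totient_rate (3 / 4 * d + eta).
Proof.
move=> d0 eta0 [X0 X01 H].
pose X1 := 2 * X0 + (3 + 2 * X0) / eta.
have q0 : 0 <= (3 + 2 * X0) / eta by rewrite divr_ge0 ?(ltW eta0)//; lra.
exists X1; first by rewrite /X1; lra.
move=> X g XX1 pg.
have XX0 : 2 * X0 <= X by rewrite /X1 in XX1; lra.
have Xe : 3 + 2 * X0 <= eta * X.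
  have : (3 + 2 * X0) / eta <= X by rewrite /X1 in XX1; lra.
  by rewrite ler_pdivrMr// (mulrC eta).
have Xp : 0 < X by lra.
have X1' : 1 <= X by lra.
have rs := riemann_sum pg X1'; move: rs; rewrite sum_profile_totient//.
set N := Num.truncn X.
have NX : N%:R <= X by rewrite truncn_le// ltW.
have XN : X < N%:R + 1 by rewrite natr1 truncnS_gt.
have N1 : (0 < N)%N by rewrite -(ltr_nat R); lra.
rewrite big_ltn// invr1 mul1r mulr1.
pose E k := totient_sum g (X / k%:R) - (X / k%:R) * area g / z2.
pose I := area g; have /andP[I0 I1] := area01 pg.
have splitE : \sum_(2 <= k < N.+1) k%:R^-1 * totient_sum g (X / k%:R) =
   \sum_(2 <= k < N.+1) k%:R^-1 * E k + X * I / z2 * (zsum N - 1).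
  rewrite /zsum [X in _ * (X - 1)]big_ltn// expr1n invr1 [_ - 1]addrAC subrr add0r.
  rewrite mulr_sumr -big_split /=.
  apply: eq_big_nat => k /andP[k0 _].
  have k0' : (0 : R) < k%:R by rewrite ltr0n ltnW.
  by rewrite /E /I; field; rewrite !gt_eqF.
rewrite splitE => rs.
have sumE : `|\sum_(2 <= k < N.+1) k%:R^-1 * E k| <= 3 / 4 * d * X + 2 * X0.
  (* the rate d is available for k <= B, the trivial one is used beyond *)
  pose B := Num.truncn (X / X0).
  have X0p : 0 < X0 by lra.
  have B1 : (2 : R) <= X / X0 by rewrite ler_pdivlMr.
  have BX : B%:R <= X / X0 by rewrite truncn_le// ; lra.
  have XB : X / X0 < B%:R + 1 by rewrite natr1 truncnS_gt.
  have B2 : (0 < B)%N by rewrite -(ltr_nat R); lra.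
  have bnd k : (2 <= k)%N -> `|k%:R^-1 * E k| <= d * X * (k%:R ^+ 2)^-1 +
      X * (if (B.+1 <= k)%N then (k%:R ^+ 2)^-1 else 0).
    move=> k2; have k0' : (0 : R) < k%:R by rewrite ltr0n ltnW.
    rewrite normrM normfV (gtr0_norm k0').
    have sq : k%:R^-1 * (X / k%:R) = X * (k%:R ^+ 2)^-1 by field; rewrite gt_eqF.
    have Xk0 : 0 <= X / k%:R by rewrite divr_ge0 ?(ltW Xp)// ltW.
    case: ifP => Bk.
      apply: (@le_trans _ _ (k%:R^-1 * (X / k%:R))).
        by rewrite ler_wpM2l ?invr_ge0 ?(ltW k0')//; exact: totient_error_bound.
      rewrite sq lerDr mulr_ge0 ?invr_ge0 ?exprn_ge0 ?mulr_ge0// ?ltW//.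
    rewrite mulr0 addr0 -mulrA -sq mulrCA ler_wpM2l ?invr_ge0 ?(ltW k0')//.
    apply: H => //; rewrite ler_pdivlMr// -ler_pdivlMl// mulrC.
    by apply: le_trans BX; rewrite ler_nat leqNgt Bk.
  apply: le_trans (ler_norm_sum _ _ _) _.
  apply: le_trans (ler_sum_nat (fun k (hk : (2 <= k < N.+1)%N) => bnd k (proj1 (andP hk)))) _.
  rewrite big_split /= -!mulr_sumr.
  have s1 : \sum_(2 <= k < N.+1) (k%:R ^+ 2)^-1 <= 3 / 4 :> R.
    have /andP[_ zb] := @zeta2_bounds R; have /andP[za _] := @zeta2_approx R _ N1.
    move: za; rewrite /zsum big_ltn// expr1n invr1; lra.
  have s2 : \sum_(2 <= k < N.+1) (if (B.+1 <= k)%N then (k%:R ^+ 2)^-1 else 0) <= B%:R^-1 :> R.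
    apply: le_trans (@sum_inv_sq_le R B.+1 N.+1 _) => //.
    have [BN|NB] := leqP B.+1 N.+1; last first.
      rewrite [leRHS]big_geq 1?ltnW// big_nat_cond big1// => k /andP[/andP[_ kN] _].
      by rewrite leq_gtF// -ltnS; exact: ltn_trans kN NB.
    rewrite (@big_cat_nat _ _ _ B.+1)//= [X in X + _]big_nat_cond big1 ?add0r; last first.
      by move=> k /andP[/andP[_ kN] _]; rewrite leq_gtF.
    by rewrite le_eqVlt; apply/orP; left; apply/eqP/eq_big_nat => k /andP[-> _].
  have s3 : X * B%:R^-1 <= 2 * X0.
    rewrite ler_pdivrMr ?ltr0n//.
    have hB : (1 : R) <= B%:R by rewrite ler1n.
    have : X / X0 <= 2 * B%:R by lra.
    by rewrite ler_pdivrMr//; lra.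
  have := ler_wpM2l (mulr_ge0 d0 (ltW Xp)) s1; have := ler_wpM2l (ltW Xp) s2.
  lra.
have /andP[z1 z3] := @zeta2_approx R _ N1.
have last_ : 0 <= X * I / z2 * (z2 - zsum N) <= 2.
  have t0 : 0 <= X * I / z2 by rewrite divr_ge0 ?mulr_ge0 ?(ltW z2_gt0) ?(ltW Xp).
  have t1 : X * I / z2 <= X.
    rewrite ler_pdivrMr//.
    have : X * I <= X * 1 by rewrite ler_wpM2l// ltW.
    have : X * 1 <= X * z2 by rewrite ler_wpM2l ?(ltW Xp)//; have /andP[] := @zeta2_bounds R.
    lra.
  rewrite mulr_ge0//=.
  apply: (@le_trans _ _ (X * N%:R^-1)); first by apply: ler_pM.
  rewrite ler_pdivrMr ?ltr0n//; have : (1 : R) <= N%:R by rewrite ler1n.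
  lra.
have id : X * I / z2 * (zsum N - 1) = X * I - X * I / z2 * (z2 - zsum N) - X * I / z2.
  by field; rewrite gt_eqF.
rewrite id -/I in rs.
move: rs sumE last_; rewrite -/I; set A := \sum_(_ <= k < _) _; set t := X * I / z2; set r := t * _.
rewrite !ler_norml => /andP[r1 r2] /andP[r3 r4] /andP[r5 r6].
by apply/andP; split; lra.
Qed.

(** Iteration of [totient_rate_contract] from the trivial rate 1. *)
Theorem totient_sum_asymptotic (eps : R) : 0 < eps -> exists2 X0 : R, 1 <= X0 &
  forall X g, X0 <= X -> profile g -> `|totient_sum g X - X * area g / z2| <= eps * X.
Proof.
move=> eps0; rewrite -/(totient_rate eps).
have it n : totient_rate ((3 / 4) ^+ n + eps / 2).
  elim: n => [|n IH].
    exists 1 => // X g X1 pg; apply: le_trans (totient_error_bound pg _) _; first by lra.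
    rewrite expr0; nra.
  (* eps / 2 is the fixed point of d -> 3/4 d + eps / 8 *)
  have /= := @totient_rate_contract _ (eps / 8) _ _ IH.
  rewrite (_ : 3 / 4 * _ + _ = (3 / 4) ^+ n.+1 + eps / 2); last by rewrite exprS; field.
  by apply; [rewrite addr_ge0 ?exprn_ge0|]; lra.
have q1 : `|3 / 4 : R| < 1 by rewrite ger0_norm; lra.
have /cvgrPdist_lt/(_ (eps / 2)) := cvg_expr q1.
case; first by rewrite divr_gt0.
move=> n _ /(_ n (leqnn n)) /=; rewrite sub0r normrN ger0_norm ?exprn_ge0 => // hn.
have [X0 X01 H] := it n; exists X0 => // X g XX pg.
apply: le_trans (H X g XX pg) _; rewrite ler_wpM2r//; last by lra.
by lra.
Qed.

End totient_sums.

(** * Counting pairs of consecutive denominators *)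

Section gap_profile.
Context {R : realType}.
Implicit Types (k x : R).

(** The length of the section at abscissa x of the part x y >= k of the
    triangle Omega_1, whose ordinates lie in (1 - x, 1]. *)
Definition gap_profile k x : R :=
  if (0 < x) && (x <= 1) then Num.max 0 (Num.min x (1 - k / x)) else 0.

Lemma gap_profileE k x : 0 < x -> x <= 1 ->
  gap_profile k x = Num.max 0 (Num.min x (1 - k / x)).
Proof. by move=> x0 x1; rewrite /gap_profile x0 x1. Qed.

Lemma gap_profile_le k x : 0 <= x -> 0 <= gap_profile k x <= x.
Proof.
by move=> x0; rewrite /gap_profile; case: ifP => _; rewrite ?lexx ?x0// le_max lexx /= ge_max x0 ge_min lexx.
Qed.

Lemma measurable_inv : measurable_fun [set: R] (@GRing.inv R).
Proof.
rewrite (_ : @GRing.inv R = fun x => if x == 0 then 0 else x^-1); last first.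
  by apply/funext => x; case: eqP => // ->; rewrite invr0.
apply: measurable_fun_if => //; first exact: measurable_fun_eqr.
rewrite setTI; apply: open_continuous_measurable_fun.
  rewrite (_ : _ @^-1` _ = [set x | x != 0]); first exact: open_neq.
  by apply/seteqP; split => x /=; case: (x == 0).
by move=> x; rewrite inE/= => /negbT x0; exact: inv_continuous.
Qed.

Lemma gap_profileP k : 0 <= k -> profile (gap_profile k).
Proof.
move=> k0; split.
- apply: measurable_fun_ifT => //.
    by apply: measurable_and; [exact: measurable_fun_ltr|exact: measurable_fun_ler].
  apply: measurable_maxr => //; apply: measurable_minr => //.
  apply: measurable_funB => //; apply: measurable_funM => //.
  exact: measurable_inv.
- move=> x; rewrite /gap_profile; case: ifP => [/andP[x0 x1]|_]; last by rewrite lexx ler01.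
  have := gap_profile_le k (ltW x0); rewrite gap_profileE// => /andP[-> h] /=.
  exact: le_trans h x1.
- move=> x y x0 xy y1; have y0 := lt_le_trans x0 xy.
  rewrite !gap_profileE//; last exact: le_trans y1.
  rewrite le_max2// le_min2// lerD2l lerN2 ler_wpM2l// lef_pV2 ?posrE//.
- by move=> x x1; rewrite /gap_profile [x <= 1]leNgt x1 andbF.
Qed.

End gap_profile.

Section natural_intervals.
Context {R : realType}.
Implicit Types (x X : R).

Definition nceil x : nat := `|Num.ceil x|%N.

Lemma nceil_le x (n : nat) : 0 <= x -> (nceil x <= n)%N = (x <= n%:R).
Proof.
move=> x0; have c0 : 0 <= Num.ceil x by rewrite ceil_ge0; lra.
by rewrite /nceil -lez_nat gez0_abs// ceil_le_int.
Qed.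

Lemma nceil_bounds x : 0 <= x -> x <= (nceil x)%:R < x + 1.
Proof.
move=> x0; rewrite -nceil_le// leqnn /= ltNge; apply/negP => h.
case: (posnP (nceil x)) => [e|n0]; first by rewrite e in h; lra.
have : ((nceil x).-1 < nceil x)%N by rewrite ltn_predL.
by rewrite ltnNge nceil_le// -subn1 natrB//; lra.
Qed.

Definition num_count (x y : R) : nat := (nceil y - nceil x)%N.

Lemma num_count_bound (x y : R) : 0 <= x -> x <= y ->
  `|(num_count x y)%:R - (y - x)| <= 1.
Proof.
move=> x0 xy; have y0 := le_trans x0 xy.
have /andP[a1 a2] := nceil_bounds x0; have /andP[b1 b2] := nceil_bounds y0.
have ab : (nceil x <= nceil y)%N by rewrite nceil_le// (le_trans xy).
by rewrite /num_count natrB// ler_norml; apply/andP; split; lra.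
Qed.

(** With [succ_count], the interval of the integers q' such that X - q < q' <=
    X and k X^2 <= q q': the possible denominators of a right neighbour, at
    distance 1 / (q q') at most 1 / (k X^2), of a fraction of denominator q.
    It contains at most one integer of each class modulo q. *)
Definition succ_first X k (q : nat) : nat :=
  maxn (Num.truncn (X - q%:R)).+1 (nceil (k * X ^+ 2 / q%:R)).
Definition succ_count X k (q : nat) : nat :=
  minn q ((Num.truncn X).+1 - succ_first X k q)%N.

Lemma truncn_subn X (q : nat) : q%:R <= X -> Num.truncn (X - q%:R) = (Num.truncn X - q)%N.
Proof.
move=> qX; have X0 : 0 <= X by apply: le_trans qX.
have qT : (q <= Num.truncn X)%N by rewrite truncn_ge_nat.
apply: truncn_def; have /andP[h1 h2] := truncn_itv X0.
rewrite -subSn// !natrB ?(leqW qT)//.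
by apply/andP; split; lra.
Qed.

Lemma succ_intervalP X k (q q' : nat) : 0 <= k -> (0 < q)%N -> q%:R <= X ->
  (succ_first X k q <= q' < succ_first X k q + succ_count X k q)%N =
  [&& X - q%:R < q'%:R, q'%:R <= X & k * X ^+ 2 <= q%:R * q'%:R].
Proof.
move=> k0 q0 qX; have X0 : 0 <= X by apply: le_trans qX.
have q0' : (0 : R) < q%:R by rewrite ltr0n.
have qT : (q <= Num.truncn X)%N by rewrite truncn_ge_nat.
rewrite -(truncn_lt_nat q') ?subr_ge0// -(truncn_ge_nat q')//.
have -> : (k * X ^+ 2 <= q%:R * q'%:R) = (nceil (k * X ^+ 2 / q%:R) <= q')%N.
  by rewrite nceil_le ?ler_pdivrMr ?(mulrC q%:R)// divr_ge0// mulr_ge0// exprn_ge0.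
rewrite /succ_count /succ_first truncn_subn//.
set c := nceil _; set T := Num.truncn X in qT *.
by apply/idP/idP; lia.
Qed.

(** With x = q / X, the interval of the q' is X times the section of the
    triangle described by [gap_profile], up to rounding of its ends. *)
Lemma succ_count_bound X k (q : nat) : 0 <= k -> (0 < q)%N -> q%:R <= X ->
  `|(succ_count X k q)%:R - X * gap_profile k (q%:R / X)| <= 1.
Proof.
move=> k0 q0 qX.
have q0' : (0 : R) < q%:R by rewrite ltr0n.
have X0 : 0 < X by apply: lt_le_trans qX.
have qT : (q <= Num.truncn X)%N by rewrite truncn_ge_nat// ltW.
have /andP[h1 h2] := truncn_itv (ltW X0).
have y0 : 0 <= k * X ^+ 2 / q%:R by rewrite divr_ge0// mulr_ge0// exprn_ge0// ltW.
have /andP[c1 c2] := nceil_bounds y0.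
have -> : X * gap_profile k (q%:R / X) = Num.max 0 (Num.min q%:R (X - k * X ^+ 2 / q%:R)).
  rewrite gap_profileE ?divr_gt0 ?ler_pdivrMr ?mul1r//.
  rewrite maxr_pMr ?(ltW X0)// mulr0 minr_pMr ?(ltW X0)//; congr (Num.max _ (Num.min _ _)).
    by field; rewrite gt_eqF.
  by field; rewrite !gt_eqF.
rewrite /succ_count /succ_first truncn_subn//.
move: c1 c2 y0; set y := k * X ^+ 2 / q%:R; set c := nceil y; move=> c1 c2 y0.
move: h2; rewrite -natr1; set T := Num.truncn X in qT h1 *; move=> h2.
have qTR : (q%:R : R) <= T%:R by rewrite ler_nat.
(* the lower end is T - q + 1 or c, and the interval is empty for c > T *)
have [cl|cl] := leqP c (T - q).+1.
  have -> : (minn q (T.+1 - (T - q).+1) = q)%N by lia.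
  have cl' : c%:R <= (T%:R - q%:R) + 1 :> R by rewrite -natrB// natr1 ler_nat.
  have : X - q%:R - y >= -1 by lra.
  have q1 : (1 : R) <= q%:R by rewrite ler1n.
  case: (leP q%:R (X - y)) => h h3.
    by rewrite max_r ?(ltW q0')// subrr normr0.
  by rewrite max_r ?ler_norml; [apply/andP; split; lra|lra].
have [cT|cT] := leqP c T.+1.
  have -> : (minn q (T.+1 - c) = T.+1 - c)%N by lia.
  have cl' : (T%:R - q%:R) + 1 + 1 <= c%:R :> R by rewrite -natrB// !natr1 ler_nat.
  have cT' : c%:R <= T%:R + 1 :> R by rewrite natr1 ler_nat.
  rewrite natrB// -natr1.
  have h3 : X - y <= q%:R by lra.
  by rewrite min_r//; case: (leP 0 (X - y)) => h; rewrite ler_norml; apply/andP; split; lra.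
have -> : (minn q (T.+1 - c) = 0)%N by lia.
have cT' : T%:R + 1 + 1 <= c%:R :> R by rewrite !natr1 ler_nat.
have h3 : X - y <= 0 by lra.
by rewrite max_l ?subrr ?normr0// ge_min h3 orbT.
Qed.

End natural_intervals.

Section consecutive_count.
Context {R : realType}.

(** Pairs (p, q'), summed over q: the numerators p with p / q in [a, b), and
    the denominators q' of the right neighbours of p / q. *)
Definition consecutive_count (X k a b : R) : R :=
  \sum_(1 <= q < (Num.truncn X).+1)
    inverse_count R q (nceil (a * q%:R)) (num_count (a * q%:R) (b * q%:R))
      (succ_first X k q) (succ_count X k q).

Lemma num_count_le (a b : R) (q : nat) : 0 <= a -> a <= b -> b <= 1 ->
  (num_count (a * q%:R) (b * q%:R) <= q)%N.
Proof.
move=> a0 ab b1; rewrite /num_count leq_subLR; apply: leq_trans (leq_addl _ _).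
by rewrite nceil_le ?mulr_ge0 ?(le_trans a0 ab)// ler_piMl.
Qed.

(** Three errors are added: D from the equidistribution of inverses, E from
    rounding the lengths of the two intervals, and the error of the totient
    sum of the profile. The bounds depend neither on k nor on the interval [a,
    b). *)
Theorem consecutive_count_asymptotic (eps : R) : 0 < eps -> exists2 X0 : R, 1 <= X0 &
  forall X k a b, X0 <= X -> 0 <= k -> 0 <= a -> a <= b -> b <= 1 ->
  `|consecutive_count X k a b - (b - a) * area (gap_profile k) / zeta 2 * X ^+ 2| <=
    eps * X ^+ 2.
Proof.
move=> eps0; have e3 : 0 < eps / 3 by rewrite divr_gt0.
have [K K0 HK] := inverse_count_average e3.
have [X0 X01 H] := totient_sum_asymptotic e3.
exists (X0 + 3 * (K + 2) / eps); first by rewrite ler_wpDr// divr_ge0 ?(ltW eps0)//; lra.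
move=> X k a b XX k0 a0 ab b1.
have q0 : 0 <= 3 * (K + 2) / eps by rewrite divr_ge0 ?(ltW eps0)//; lra.
have X0X : X0 <= X by lra.
have Xp : 0 < X by lra.
have XK : K + 2 <= eps / 3 * X.
  have : 3 * (K + 2) / eps <= X by lra.
  by rewrite ler_pdivrMr//; lra.
have pg := gap_profileP k0.
have := H X _ X0X pg; set A := area _; rewrite /totient_sum; set N := Num.truncn X => HA.
have NX : N%:R <= X by rewrite truncn_le// ltW.
pose n q := num_count (a * q%:R) (b * q%:R).
pose m q := succ_count X k q.
have nq q : (n q <= q)%N by exact: num_count_le.
have mq q : (m q <= q)%N by exact: geq_minl.
have HE := HK N (fun q => nceil (a * q%:R)) n (succ_first X k) m nq mq.
pose D q := inverse_count R q (nceil (a * q%:R)) (n q) (succ_first X k q) (m q) -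
    (totient q)%:R * (n q)%:R * (m q)%:R / q%:R ^+ 2.
pose E q := (totient q)%:R * (n q)%:R * (m q)%:R / q%:R ^+ 2 -
   (b - a) * X * ((totient q)%:R / q%:R * gap_profile k (q%:R / X)).
have -> : consecutive_count X k a b - (b - a) * A / zeta 2 * X ^+ 2 =
   \sum_(1 <= q < N.+1) D q + \sum_(1 <= q < N.+1) E q +
   (b - a) * X * (\sum_(1 <= q < N.+1) (totient q)%:R / q%:R * gap_profile k (q%:R / X)
      - X * A / zeta 2).
  rewrite mulrBr mulr_sumr /consecutive_count addrA; congr (_ - _); last by ring.
  rewrite -!big_split /=; apply: eq_bigr => q _; rewrite /D /E; ring.
have boundE : `|\sum_(1 <= q < N.+1) E q| <= 2 * X.
  apply: le_trans (ler_norm_sum _ _ _) _.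
  apply: (@le_trans _ _ (\sum_(1 <= q < N.+1) 2)); last first.
    by rewrite sumr_const_nat subn1 -[leLHS]mulr_natr ler_wpM2l.
  apply: ler_sum_nat => q /andP[q1]; rewrite ltnS => qN.
  have qX : q%:R <= X by apply: le_trans NX; rewrite ler_nat.
  have qp : (0 : R) < q%:R by rewrite ltr0n.
  have h1 := succ_count_bound k0 q1 qX.
  have h2 : `|(n q)%:R - (b - a) * q%:R| <= 1.
    by rewrite mulrBl num_count_bound ?mulr_ge0// ler_wpM2r.
  have /andP[g0 g1] : 0 <= X * gap_profile k (q%:R / X) <= q%:R.
    have := gap_profile_le k (divr_ge0 (ltW qp) (ltW Xp)) => /andP[u0 u1].
    rewrite mulr_ge0 ?(ltW Xp)//= (le_trans (ler_wpM2l (ltW Xp) u1))//.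
    by rewrite mulrCA mulfV ?mulr1// gt_eqF.
  have -> : E q = (totient q)%:R / q%:R ^+ 2 *
     ((n q)%:R * ((m q)%:R - X * gap_profile k (q%:R / X)) +
      X * gap_profile k (q%:R / X) * ((n q)%:R - (b - a) * q%:R)).
    by rewrite /E; field; rewrite gt_eqF.
  have t0 : 0 <= (totient q)%:R / q%:R ^+ 2 :> R by rewrite divr_ge0// exprn_ge0.
  rewrite normrM (ger0_norm t0).
  apply: (@le_trans _ _ ((totient q)%:R / q%:R ^+ 2 * (q%:R + q%:R))).
    rewrite ler_wpM2l//; apply: le_trans (ler_normD _ _) _; rewrite (normrM (n q)%:R) (normrM (X * _)).
    rewrite (ger0_norm g0) (ger0_norm (ler0n _ _)).
    rewrite lerD// -[leRHS]mulr1 ler_pM// ler_nat//.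
  rewrite mulrAC ler_pdivrMr ?exprn_gt0//.
  have : ((totient q)%:R : R) * (q%:R + q%:R) <= q%:R * (q%:R + q%:R).
    by rewrite ler_wpM2r ?addr_ge0// ler_nat totient_le.
  by rewrite expr2; lra.
have boundD : `|\sum_(1 <= q < N.+1) D q| <= eps / 3 * X ^+ 2 + K * X.
  apply: le_trans (ler_norm_sum _ _ _) _; apply: le_trans HE _.
  rewrite lerD// ler_wpM2l ?(ltW e3)//.
  by rewrite lerXn2r ?nnegrE ?(ltW Xp).
have boundA : `|(b - a) * X * (\sum_(1 <= q < N.+1) (totient q)%:R / q%:R * gap_profile k (q%:R / X)
      - X * A / zeta 2)| <= eps / 3 * X ^+ 2.
  have u0 : 0 <= (b - a) * X by rewrite mulr_ge0 ?subr_ge0// ltW.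
  rewrite normrM (ger0_norm u0).
  apply: (@le_trans _ _ (X * (eps / 3 * X))).
    apply: ler_pM => //; rewrite ler_piMl ?(ltW Xp)//; lra.
  by rewrite expr2 mulrCA.
apply: le_trans (ler_normD _ _) _; apply: le_trans (lerD (ler_normD _ _) (lexx _)) _.
have : (K + 2) * X <= eps / 3 * X ^+ 2.
  by rewrite expr2 mulrA; apply: ler_wpM2r => //; exact: ltW.
move: boundA boundD boundE; rewrite mulrDl; lra.
Qed.

End consecutive_count.

(** * Right neighbours in the classical Farey sets *)

Section farey_list.

Definition qden (r : rat) : nat := `|denq r|%N.

Lemma qden_gt0 r : (0 < qden r)%N.
Proof. by rewrite absz_gt0 denq_neq0. Qed.

Lemma qdenE (V : numDomainType) r : (denq r)%:~R = (qden r)%:R :> V.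
Proof. by rewrite /qden natr_absz gtr0_norm. Qed.

Lemma qden_frac (p q : nat) : (0 < q)%N -> coprime p q -> qden (p%:R / q%:R) = q.
Proof.
move=> q0 pq; rewrite /qden.
have := @coprimeq_den p q; rewrite !absz_nat => -> //.
by rewrite eqz_nat gtn_eqF.
Qed.

Lemma qnum_frac (p q : nat) : (0 < q)%N -> coprime p q -> `|numq (p%:R / q%:R)|%N = p.
Proof.
move=> q0 pq.
have := @coprimeq_num p q; rewrite !absz_nat => -> //.
by rewrite gtr0_sg ?mul1r.
Qed.

Lemma rat_frac (r : rat) : 0 <= r ->
  r = (`|numq r|%N)%:R / (qden r)%:R /\ coprime `|numq r|%N (qden r).
Proof.
move=> r0; split; last exact: coprime_num_den.
rewrite -[LHS]divq_num_den -!qdenE; congr (_ / _).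
by rewrite natr_absz ger0_norm ?numq_ge0.
Qed.

(** Ordered by denominators, so that counting in this list is a double sum
    over denominators and numerators. *)
Definition farey_list (M : nat) : seq rat :=
  [seq (p.2%:R / p.1%:R : rat) |
     p <- [seq p <- [seq (q, a) | q <- index_iota 1 M.+1, a <- index_iota 0 q] | coprime p.2 p.1]].

Lemma farey_pairsP M (c : nat * nat) :
  (c \in [seq p <- [seq (q, a) | q <- index_iota 1 M.+1, a <- index_iota 0 q] | coprime p.2 p.1])
  = [&& (0 < c.1)%N, (c.1 <= M)%N, (c.2 < c.1)%N & coprime c.2 c.1].
Proof.
case: c => q a /=; rewrite mem_filter /=; case: coprime; rewrite ?andbF//= andbT.
apply/allpairsPdep/and3P => [[q1 [a1 [hq ha [-> ->]]]]|[q0 qM aq]].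
  by move: hq ha; rewrite !mem_index_iota ltnS => /andP[? ?] /andP[].
by exists q, a; rewrite !mem_index_iota ltnS q0 qM aq.
Qed.

Lemma farey_list_uniq M : uniq (farey_list M).
Proof.
rewrite map_inj_in_uniq ?filter_uniq//; last first.
  move=> [q a] [q' a']; rewrite !farey_pairsP /= => /and4P[q0 _ _ c] /and4P[q'0 _ _ c'] e.
  have := qden_frac q0 c; rewrite e qden_frac// => ->.
  by have := qnum_frac q0 c; rewrite e qnum_frac// => ->.
apply: allpairs_uniq_dep; rewrite ?iota_uniq//.
- by move=> q _; exact: iota_uniq.
- by move=> [q a] [q' a'] _ _ /= [-> ->].
Qed.

Lemma mem_farey_list M r : (r \in farey_list M) = [&& 0 <= r, r < 1 & (qden r <= M)%N].
Proof.
apply/mapP/and3P => [[[q a]]|[r0 r1 rM]].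
  rewrite farey_pairsP /= => /and4P[q0 qM aq c] ->; rewrite qden_frac//; split=> //.
  by rewrite ltr_pdivrMr ?ltr0n// mul1r ltr_nat.
have [rE c] := rat_frac r0; exists (qden r, `|numq r|%N) => //.
rewrite farey_pairsP /= qden_gt0 rM c andbT /=.
have := r1; rewrite {1}rE ltr_pdivrMr ?ltr0n ?qden_gt0// mul1r ltr_nat//.
Qed.

Lemma sum_farey_list (V : nmodType) M (G : rat -> V) :
  \sum_(r <- farey_list M) G r =
  \sum_(1 <= q < M.+1) \sum_(a < q | coprime a q) G (a%:R / q%:R).
Proof.
rewrite big_map big_filter big_mkcond big_allpairs_dep /=; apply: eq_big_nat => q _.
by rewrite -big_mkcond /= big_mkord.
Qed.

End farey_list.

Section followed_points.
Context {R : realType}.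
Implicit Types (X t k : R) (S : rat -> bool).

(** Any larger point of S is accepted here, not only the next one, so that the
    property is monotone in S. *)
Definition followed S t (r : rat) : Prop := exists s, [/\ S s, r < s & ratr s <= ratr r + t].

Definition farey_le X (r : rat) : bool := (qden r)%:R <= X.

Definition next_den X k (p q q' : nat) : bool :=
  [&& X - q%:R < q'%:R, q'%:R <= X, k * X ^+ 2 <= q%:R * q'%:R & (q %| p * q' + 1)%N].

Lemma ratr_frac (a b : nat) : ratr (a%:R / b%:R) = a%:R / b%:R :> R.
Proof. by rewrite fmorph_div /= !rmorph_nat. Qed.

(** The integers q' with X - q < q' <= X are q consecutive ones, and p is
    invertible modulo q. *)
Lemma exists_next_den X (p q : nat) : (0 < q)%N -> coprime p q -> q%:R <= X ->
  exists q' : nat, [/\ X - q%:R < q'%:R, q'%:R <= X & (q %| p * q' + 1)%N].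
Proof.
move=> q0 pq qX; have X0 : 0 <= X by apply: le_trans qX.
have qT : (q <= Num.truncn X)%N by rewrite truncn_ge_nat.
set T := Num.truncn X in qT.
have := count_neg_inverse p (T - q).+1 q0; rewrite coprime_sym pq.
have [/existsP[y hy] _|/existsPn h] := boolP [exists y : 'I_q, (q %| p * ((T - q).+1 + y) + 1)%N].
  exists ((T - q).+1 + y)%N; split=> //.
    by rewrite -truncn_lt_nat ?subr_ge0// truncn_subn// ltn_addr.
  by rewrite -truncn_ge_nat//; have := ltn_ord y; lia.
by rewrite big1 // => y _; have /negbTE-> := h y.
Qed.

(** For such a q', the fraction (p q' + 1) / (q q') reduces to denominator q'
    and is at distance 1 / (q q') after p / q. Conversely, let s = a / b be
    any larger fraction of order X, at distance j / (q b). Then q divides j q'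
    - b. If b were larger than j q', then b >= q + j q' >= q + q' > X; hence b
    <= j q' and s is at distance at least 1 / (q q'). *)
Lemma farey_followedP X t (p q : nat) : 0 < t -> (0 < q)%N -> coprime p q -> q%:R <= X ->
  followed (farey_le X) t (p%:R / q%:R) <->
  exists q', next_den X (t * X ^+ 2)^-1 p q q'.
Proof.
move=> t0 q0 pq qX; have q0' : (0 : R) < q%:R by rewrite ltr0n.
have X0 : 0 < X by apply: lt_le_trans qX.
have kE : (t * X ^+ 2)^-1 * X ^+ 2 = t^-1 by field; rewrite !gt_eqF.
split => [[s [sX rs st]]|[q' /and4P[q'1 q'2 q'3 q'4]]]; last first.
  have q'0 : (0 < q')%N by rewrite -(ltr_nat R); apply: le_lt_trans q'1; rewrite subr_ge0.
  have q'0' : (0 : R) < q'%:R by rewrite ltr0n.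
  have /dvdnP[p' p'E] := q'4.
  have cp : coprime p' q'.
    rewrite /coprime -dvdn1 -(@dvdn_addr (p * q')%N) ?p'E.
      by rewrite dvdn_mulr// dvdn_gcdl.
    by rewrite dvdn_mull// dvdn_gcdr.
  have diff (V : numFieldType) : p'%:R / q'%:R = p%:R / q%:R + (q%:R * q'%:R)^-1 :> V.
    have : (p * q' + 1)%N%:R = (p' * q)%N%:R :> V by rewrite p'E.
    rewrite natrD !natrM => e; have -> : p'%:R = (p%:R * q'%:R + 1) / q%:R :> V.
      by rewrite e mulfK// pnatr_eq0 -lt0n.
    by field; rewrite !pnatr_eq0 -!lt0n q0 q'0.
  exists (p'%:R / q'%:R); split.
  - by rewrite /farey_le qden_frac.
  - by rewrite diff ltrDl invr_gt0 mulr_gt0// ltr0n.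
  - rewrite !ratr_frac diff lerD2l -[t]invrK lef_pV2 ?posrE ?invr_gt0 ?mulr_gt0//.
    by rewrite -kE.
have [q' [q'1 q'2 q'4]] := exists_next_den q0 pq qX.
exists q'; rewrite /next_den q'1 q'2 q'4 andbT /= kE.
have q'0 : (0 < q')%N by rewrite -(ltr_nat R); apply: le_lt_trans q'1; rewrite subr_ge0.
have s0 : 0 <= s by apply: le_trans (ltW rs); rewrite divr_ge0.
have [sE cs] := rat_frac s0.
have d0 := qden_gt0 s; move: sX cs rs st sE d0; rewrite /farey_le.
set b := qden s; set a := `|numq s|%N => sX cs rs st sE d0.
have b0' : (0 : R) < b%:R by rewrite ltr0n.
have ab : (p * b < a * q)%N.
  move: rs; rewrite sE ltr_pdivrMr ?ltr0n// mulrAC ltr_pdivlMr ?ltr0n//.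
  by rewrite -!natrM ltr_nat.
pose j := (a * q - p * b)%N.
have jE : (a * q = p * b + j)%N by rewrite /j subnKC// ltnW.
have j0 : (0 < j)%N by rewrite subn_gt0.
(* multiplied by p, which is prime to q, the difference b - j q' is a q - j (p
   q' + 1) *)
have bj : (b <= j * q')%N.
  rewrite leqNgt; apply/negP => h.
  have : (q %| b - j * q')%N.
    rewrite -(@Gauss_dvdr _ p) 1?coprime_sym//.
    rewrite mulnBr -(@dvdn_addr (j * (p * q' + 1))%N) ?dvdn_mull//.
    have -> : (j * (p * q' + 1) + (p * b - p * (j * q')) = a * q)%N.
      have h3 : (p * (j * q') <= p * b)%N by rewrite leq_mul2l (ltnW h) orbT.
      by rewrite mulnDr muln1 (mulnCA j) addnAC subnKC.
    exact: dvdn_mull.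
  move/dvdn_leq; rewrite subn_gt0 => /(_ h) h2.
  have : (q + q' <= b)%N.
    apply: leq_trans (leq_add (leqnn q) (leq_pmull q' j0)) _.
    by rewrite addnC -[leqRHS](subnKC (ltnW h)) leq_add2l.
  rewrite -(ler_nat R) natrD; lra.
have stR : j%:R / (q%:R * b%:R) <= t.
  move: st; rewrite {1}sE !ratr_frac -lerBlDl; apply: le_trans.
  have : (a * q)%N%:R = (p * b + j)%N%:R :> R by rewrite jE.
  rewrite natrD !natrM => e; have -> : j%:R = a%:R * q%:R - p%:R * b%:R :> R by rewrite e; ring.
  by rewrite le_eqVlt; apply/orP; left; apply/eqP; field; rewrite !gt_eqF.
rewrite -[leRHS]invrK lef_pV2 ?posrE ?invr_gt0 ?mulr_gt0 ?ltr0n//.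
apply: le_trans stR; rewrite -div1r ler_pdivrMr ?mulr_gt0 ?ltr0n//.
rewrite mulrAC ler_pdivlMr ?mulr_gt0// mul1r mulrCA ler_wpM2l ?ler0n//.
by rewrite -natrM ler_nat.
Qed.

Lemma sum_interval (V : nmodType) (G : nat -> V) (c n q : nat) : (c + n <= q)%N ->
  \sum_(x < n) G (c + x)%N = \sum_(a < q | (c <= a < c + n)%N) G a.
Proof.
move=> cq; rewrite -(big_mkord (fun a => (c <= a < c + n)%N) G).
transitivity (\sum_(c <= a < c + n) G a).
  have -> : \sum_(c <= a < c + n) G a = \sum_(0 + c <= a < n + c) G a by rewrite add0n addnC.
  by rewrite big_addn addnK big_mkord; apply: eq_bigr => i _; rewrite addnC.
by rewrite (big_nat_widen _ _ _ _ _ cq) (big_nat_widenl _ _ _ _ _ (leq0n c)); apply: eq_bigl => i; rewrite andbC.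
Qed.

(** The interval of the q' has at most q elements, so at most one of them is
    -1/p modulo q. *)
Lemma sum_next_den X k (p q : nat) : 0 <= k -> (0 < q)%N -> q%:R <= X ->
  \sum_(y < succ_count X k q) (q %| p * (succ_first X k q + y) + 1)%N%:R =
  (`[< exists q', next_den X k p q q' >])%:R :> R.
Proof.
move=> k0 q0 qX; rewrite -natr_sum; congr _%:R.
have sq : (succ_count X k q <= q)%N by exact: geq_minl.
have le1 : (\sum_(y < succ_count X k q) (q %| p * (succ_first X k q + y) + 1) <= 1)%N.
  rewrite (big_ord_widen q (fun y => ((q %| p * (succ_first X k q + y) + 1)%N : nat)) sq).
  apply: (@leq_trans (coprime q p)); last by case: coprime.
  rewrite -(count_neg_inverse _ (succ_first X k q) q0) big_mkcond /=.
  by apply: leq_sum => y _; case: ifP.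
case: asboolP => [[q' /and4P[a b c d]]|h].
  have : (succ_first X k q <= q' < succ_first X k q + succ_count X k q)%N.
    by rewrite succ_intervalP// a b c.
  move=> /andP[h1 h2].
  have yb : (q' - succ_first X k q < succ_count X k q)%N by rewrite ltn_subLR.
  apply/eqP; rewrite eqn_leq le1 /= (bigD1 (Ordinal yb)) //= subnKC// d.
  exact: leq_addr.
rewrite big1// => y _; apply/eqP; rewrite eqb0; apply/negP => d; apply: h.
exists (succ_first X k q + y)%N; rewrite /next_den d andbT.
have : (succ_first X k q <= succ_first X k q + y < succ_first X k q + succ_count X k q)%N.
  by rewrite leq_addr ltn_add2l ltn_ord.
by rewrite succ_intervalP// => /and3P[-> -> ->].
Qed.

Lemma next_den_coprime X k (p q q' : nat) : next_den X k p q q' -> coprime p q.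
Proof.
move=> /and4P[_ _ _ d]; rewrite /coprime -dvdn1 -(@dvdn_addr (p * q')%N).
  exact: dvdn_trans (dvdn_gcdr _ _) d.
by rewrite dvdn_mulr// dvdn_gcdl.
Qed.

Lemma consecutive_countE X k (a b : R) M (P : pred rat) :
  0 <= k -> 0 <= X -> 0 <= a -> a <= b -> b <= 1 -> (Num.truncn X <= M)%N ->
  (forall p q : nat, (0 < q)%N -> coprime p q -> q%:R <= X ->
     P (p%:R / q%:R) = `[< exists q', next_den X k p q q' >]) ->
  (count (fun r => [&& a <= ratr r, ratr r < b, farey_le X r & P r]) (farey_list M))%:R
   = consecutive_count X k a b.
Proof.
move=> k0 X0 a0 ab b1 XM HP.
rewrite -sum1_count big_mkcond natr_sum sum_farey_list /consecutive_count.
rewrite (@big_cat_nat _ _ _ (Num.truncn X).+1)//= [X in _ + X]big_nat_cond [X in _ + X]big1 ?addr0; last first.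
  move=> q /andP[/andP[Xq _] _]; rewrite big1// => c cq.
  have q0 : (0 < q)%N by exact: leq_trans Xq.
  have qX : (q%:R <= X) = false by rewrite -truncn_ge_nat// leqNgt Xq.
  by rewrite /farey_le qden_frac// qX /= !andbF.
apply: eq_big_nat => q /andP[q0]; rewrite ltnS => qX.
have qX' : q%:R <= X by rewrite -truncn_ge_nat.
have q0' : (0 : R) < q%:R by rewrite ltr0n.
rewrite /inverse_count.
under [RHS]eq_bigr => x _ do rewrite sum_next_den//.
have b0 : 0 <= b by exact: le_trans ab.
have bq : (nceil (b * q%:R) <= q)%N by rewrite nceil_le ?mulr_ge0// ler_piMl.
have abq : (nceil (a * q%:R) <= nceil (b * q%:R))%N.
  rewrite nceil_le ?mulr_ge0//; have /andP[h _] := nceil_bounds (mulr_ge0 b0 (ltW q0')).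
  by rewrite (le_trans _ h)// ler_wpM2r// ltW.
have e : (nceil (a * q%:R) + num_count (a * q%:R) (b * q%:R) = nceil (b * q%:R))%N.
  by rewrite /num_count subnKC.
rewrite (@sum_interval R (fun x => (`[< exists q', next_den X k x q q' >])%:R) _ _ q) e//.
rewrite big_mkcond [RHS]big_mkcond /=; apply: eq_bigr => x _.
rewrite nceil_le ?mulr_ge0 ?(ltW q0')// ltnNge nceil_le ?mulr_ge0 ?(ltW q0')// -ltNge.
have [cx|ncx] := boolP (coprime x q); last first.
  case: ifP => // _; case: asboolP => // -[q' /next_den_coprime]; by rewrite (negbTE ncx).
rewrite ratr_frac /farey_le qden_frac// qX' HP//= ler_pdivlMr// ltr_pdivrMr//.
by case: (a * _ <= _); case: (_ < b * _) => //=; case: asboolP.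
Qed.

(** Every point has a right neighbour, which for k = 0 is subject to no
    further condition. *)
Lemma count_farey_le X (a b : R) M : 0 <= X -> 0 <= a -> a <= b -> b <= 1 ->
  (Num.truncn X <= M)%N ->
  (count (fun r => [&& a <= ratr r, ratr r < b & farey_le X r]) (farey_list M))%:R
   = consecutive_count X 0 a b.
Proof.
move=> X0 a0 ab b1 XM; rewrite -(@consecutive_countE X 0 a b M xpredT)//.
  by congr _%:R; apply: eq_count => r; rewrite andbT.
move=> p q q0 pq qX; have [q' [h1 h2 h3]] := exists_next_den q0 pq qX.
by apply/esym/asboolP; exists q'; rewrite /next_den h1 h2 h3 mul0r mulr_ge0.
Qed.

Lemma count_farey_followed X t (a b : R) M : 0 < X -> 0 < t -> 0 <= a -> a <= b -> b <= 1 ->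
  (Num.truncn X <= M)%N ->
  (count (fun r => [&& a <= ratr r, ratr r < b, farey_le X r & `[< followed (farey_le X) t r >]])
      (farey_list M))%:R
   = consecutive_count X (t * X ^+ 2)^-1 a b.
Proof.
move=> X0 t0 a0 ab b1 XM; apply: consecutive_countE => //; rewrite ?(ltW X0)//.
  by rewrite invr_ge0 mulr_ge0 ?exprn_ge0// ltW.
by move=> p q q0 pq qX; apply: asbool_equiv_eq; exact: farey_followedP.
Qed.

End followed_points.

(** * Counting followed points in nested sets *)

Lemma count_le_diff (T : Type) (P Q : pred T) (s : seq T) :
  (count P s <= count Q s + count (fun x => P x && ~~ Q x) s)%N.
Proof.
by elim: s => //= x s IH; case: (P x); case: (Q x) => /=; lia.
Qed.

Lemma count_le1 (T : eqType) (P : pred T) (s : seq T) : uniq s ->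
  (forall x y, x \in s -> y \in s -> P x -> P y -> x = y) -> (count P s <= 1)%N.
Proof.
move=> us h; rewrite -size_filter.
have : {in seq.filter P s &, forall x y, x = y}.
  by move=> x y; rewrite !mem_filter => /andP[? ?] /andP[? ?]; exact: h.
have := filter_uniq P us; case: (seq.filter P s) => [|x [|y l]]//= /andP[]; rewrite inE negb_or.
by move=> /andP[xy _] _ /(_ x y); rewrite !inE !eqxx ?orbT => /(_ isT isT) e; rewrite e eqxx in xy.
Qed.

Section stability.
Context {R : realType}.
Variables (a b t : R) (L : seq rat) (S F : pred rat).
Hypothesis L_uniq : uniq L.

Definition in_piece (r : rat) : bool := (a <= ratr r) && (ratr r < b).

Let lt_trans_piece (r1 r2 s : rat) : in_piece r1 -> in_piece r2 -> r1 < r2 ->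
  r1 < s -> ~~ in_piece s -> ratr s <= ratr r1 + t -> ratr r2 <= ratr r1 + t.
Proof.
move=> /andP[a1 b1] /andP[a2 b2] r12 r1s ns st.
apply: le_trans st; apply: le_trans (ltW b2) _.
rewrite leNgt; apply: contra ns => sb; rewrite /in_piece sb andbT.
by rewrite (le_trans a1)// ler_rat ltW.
Qed.

Let asym (P : rat -> Prop) (r1 r2 : rat) : P r1 -> P r2 ->
  (forall x y, P x -> P y -> x < y -> False) -> r1 = r2.
Proof.
move=> p1 p2 h; apply/eqP; rewrite eq_le !leNgt; apply/andP; split; apply/negP.
  exact: h p2 p1. exact: h p1 p2.
Qed.

(** A followed point of F remains followed in S by the same point s, if s lies
    in the piece. If it does not, then any later point of F in the piece lies
    before s and can replace it: only the last point of F in the piece may be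
    lost. *)
Lemma followed_count_lower :
  (forall r, in_piece r -> F r -> S r) ->
  (count (fun r => [&& in_piece r, F r & `[< followed F t r >]]) L <=
   count (fun r => [&& in_piece r, S r & `[< followed S t r >]]) L + 1)%N.
Proof.
move=> FS; apply: leq_trans (count_le_diff _ (fun r => [&& in_piece r, S r & `[< followed S t r >]]) _) _.
rewrite leq_add2l.
apply: count_le1 => // x y _ _ px py.
apply: (asym (P := fun r => [&& in_piece r, F r & `[< followed F t r >]] &&
   ~~ [&& in_piece r, S r & `[< followed S t r >]])) => // {px py} {}x {}y.
move=> /andP[/and3P[xI Fx /asboolP[s [Fs xs st]]]].
rewrite xI FS//= => nx /andP[/and3P[yI Fy _] _] xy.
case/negP: nx; apply/asboolP.
have [sI|sI] := boolP (in_piece s); first by exists s; split => //; exact: FS.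
by exists y; split; [exact: FS|by []|exact: lt_trans_piece xI yI xy xs sI st].
Qed.

(** A point counted for S and not for F either is not in F, or is in F and is
    followed in S but not in F. In the second case, charge it to a point of S
    in the piece that follows it, necessarily outside F. Of two points with
    the same charge, the smaller would be followed in F by the larger: the
    charge is injective. A point with no such charge in the piece is the last
    point of its kind, as in [followed_count_lower]. *)
Lemma followed_count_upper :
  (forall r, in_piece r -> S r -> r \in L) ->
  (count (fun r => [&& in_piece r, S r & `[< followed S t r >]]) L <=
   count (fun r => [&& in_piece r, F r & `[< followed F t r >]]) L +
   2 * count (fun r => [&& in_piece r, S r & ~~ F r]) L + 1)%N.
Proof.
move=> SL.
pose inner r := `[< exists s, [/\ in_piece s, S s, r < s & ratr s <= ratr r + t] >].
pose bad r := [&& in_piece r, S r, F r, `[< followed S t r >] & ~~ `[< followed F t r >]].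
apply: leq_trans (count_le_diff _ (fun r => [&& in_piece r, F r & `[< followed F t r >]]) _) _.
rewrite -addnA leq_add2l.
apply: (@leq_trans (count (fun r => [&& in_piece r, S r & ~~ F r]) L + count bad L)%N).
  rewrite -count_predUI; apply: leq_trans (leq_addr _ _).
  apply: sub_count => r /=; rewrite /bad.
  by case: (in_piece r); case: (S r); case: (F r) => //=; rewrite ?andbT.
rewrite mul2n -addnn -!addnA leq_add2l.
apply: leq_trans (count_le_diff _ (fun r => bad r && inner r) _) _; apply: leq_add.
  (* the charge of r *)
  pose w r := if pselect (exists s, [/\ in_piece s, S s, r < s & ratr s <= ratr r + t])
     is left h then projT1 (cid h) else r.
  have wP r : inner r -> [/\ in_piece (w r), S (w r), r < w r & ratr (w r) <= ratr r + t].
    by move=> /asboolP h; rewrite /w; case: pselect => // h'; case: (cid h').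
  rewrite -!size_filter -(size_map w); apply: uniq_leq_size.
    rewrite map_inj_in_uniq ?filter_uniq// => x y; rewrite !mem_filter.
    move=> /andP[xP _] /andP[yP _] wxy.
    apply: (asym (P := fun r => bad r && inner r /\ w r = w x)) => //.
    move=> {xP yP wxy} r1 r2 [/andP[b1 i1] w1] [/andP[b2 i2] w2] r12.
    have [_ _ h1 h2] := wP _ i1; have [_ _ h3 h4] := wP _ i2.
    case/and5P: b1 => _ _ _ _ /negP; apply; apply/asboolP; exists r2; split=> //.
      by case/and5P: b2.
    by apply: le_trans h2; rewrite ler_rat w1 -w2 ltW.
  move=> s /mapP[r]; rewrite mem_filter => /andP[/andP[br ir] _] ->.
  have [h1 h2 h3 h4] := wP _ ir; rewrite mem_filter h1 h2 /= SL// andbT.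
  apply/negP => Fw; case/and5P: br => _ _ _ _ /negP; apply.
  by apply/asboolP; exists (w r).
apply: count_le1 => // x y _ _ px py.
apply: (asym (P := fun r => bad r && ~~ (bad r && inner r))) => // {px py} {}x {}y.
move=> /andP[xb]; rewrite xb /= => nx /andP[yb _] xy.
case/and5P: xb => xI _ _ /asboolP[s [Ss xs st]] /negP; apply; apply/asboolP.
case/and5P: yb => yI _ Fy _ _.
have [sI|sI] := boolP (in_piece s); first by case/negP: nx; apply/asboolP; exists s.
by exists y; split; [by []|by []|exact: lt_trans_piece xI yI xy xs sI st].
Qed.

End stability.

Section gap_ratio.
Context {R : realType}.
Variable u : farey_unit R.

Definition in_farey Q (r : rat) : bool := `[< farey_set u Q r >].
(** The endpoint 1 closes the last gap. *)
Definition in_farey1 Q (r : rat) : bool := in_farey Q r || (r == 1).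

Variables (Q M : nat).
Hypothesis QM : forall r, farey_set u Q r -> (qden r <= M)%N.
Local Notation fs := (sort <=%R (fset_set (farey_set u Q))).

Lemma in_farey_list r : in_farey Q r -> r \in farey_list M.
Proof.
move=> /asboolP h; rewrite mem_farey_list QM//.
by case: h => /andP[-> ->].
Qed.

Lemma farey_sort_perm : perm_eq fs (seq.filter (in_farey Q) (farey_list M)).
Proof.
apply: uniq_perm.
- by rewrite sort_uniq fset_uniq.
- by rewrite filter_uniq// farey_list_uniq.
- move=> r; rewrite mem_sort in_fset_set; last exact: finite_farey_set.
  rewrite mem_filter; apply/idP/andP => [|[/asboolP h _]]; last by rewrite inE.
  rewrite inE => h; have h' : in_farey Q r by exact/asboolP.
  by split=> //; exact: in_farey_list.
Qed.

Lemma farey_cardE : farey_card u Q = count (in_farey Q) (farey_list M).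
Proof. by rewrite -size_filter -(perm_size farey_sort_perm) size_sort. Qed.

(** In the increasing list, s_i is followed within t if and only if the next
    element s_(i+1) is within t. *)
Lemma farey_gap_ratioE (z : R) :
  let n := farey_card u Q in
  farey_gap_ratio u z Q =
  (count (fun r => in_farey Q r && `[< followed (in_farey1 Q) (z / n%:R) r >]) (farey_list M))%:R
    / n%:R.
Proof.
move=> n; rewrite /farey_gap_ratio -/n; congr (_%:R / _).
have sfs : size fs = n by rewrite size_sort.
pose xs := rcons fs 1.
have xsE : farey_seq u Q = [seq ratr r | r <- xs] by rewrite /farey_seq /xs map_rcons rmorph1.
have mem_fs r : (r \in fs) = in_farey Q r.
  by rewrite (perm_mem farey_sort_perm) mem_filter andb_idr//; exact: in_farey_list.
have mem_xs r : (r \in xs) = in_farey1 Q r by rewrite mem_rcons inE mem_fs orbC.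
have sorted_xs : sorted <%R xs.
  rewrite lt_sorted_uniq_le rcons_uniq mem_fs sort_uniq fset_uniq andbT; apply/andP; split.
    by apply/negP => /asboolP[/andP[_]]; rewrite ltxx.
  have : sorted <=%R fs by exact: sort_le_sorted.
  have : all (fun r => r <= 1) fs.
    by apply/allP => r; rewrite mem_fs => /asboolP[/andP[_ /ltW]].
  rewrite /xs; case: (fs) => //= y l /andP[y1 al]; rewrite rcons_path => -> /=.
  by have := mem_last y l; rewrite inE => /predU1P[->//|/(allP al)].
transitivity (count (fun r => `[< followed (in_farey1 Q) (z / n%:R) r >]) fs); last first.
  rewrite (permP farey_sort_perm) count_filter; apply: eq_count => r /=.
  by rewrite andbC.
rewrite -sum1_count (big_nth 0) sfs big_mkord -sum1_card; apply: eq_bigl => i.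
rewrite inE /farey_gap xsE.
have [iN ixs i1xs] : [/\ (i < size fs)%N, (i < size xs)%N & (i.+1 < size xs)%N].
  by rewrite size_rcons sfs ltnS ltn_ord ltnS ltnW.
rewrite !(nth_map 0)//.
have n0 : (0 : R) < n%:R by rewrite ltr0n; apply: leq_ltn_trans (ltn_ord i).
have xi : nth 0 xs i = nth 0 fs i by rewrite nth_rcons iN.
rewrite -ler_pdivlMl// lerBlDl mulrC xi.
apply/idP/asboolP => [h|[s [Ss xsi st]]].
  exists (nth 0 xs i.+1); split; rewrite -?mem_xs ?mem_nth// -xi.
  by apply: (sorted_ltn_nth lt_trans) => //; rewrite inE.
apply: le_trans st; rewrite ler_rat.
have sxs : s \in xs by rewrite mem_xs.
have := nth_index 0 sxs; have : (index s xs < size xs)%N by rewrite index_mem.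
set j := index s xs => jx jE; rewrite -jE.
have ij : (i < j)%N.
  rewrite ltnNge; apply/negP => ji; move: xsi; rewrite -xi -jE ltNge => /negP; apply.
  apply: (sorted_leq_nth le_trans lexx) => //; rewrite ?inE//.
  by move: sorted_xs; rewrite lt_sorted_uniq_le => /andP[].
apply: (sorted_leq_nth le_trans lexx) => //; rewrite ?inE//.
by move: sorted_xs; rewrite lt_sorted_uniq_le => /andP[].
Qed.

End gap_ratio.

Section pieces.
Context {R : realType}.

Lemma count_pieces (K M : nat) (P : pred rat) : (0 < K)%N ->
  count P (farey_list M) =
  (\sum_(j < K) count (fun r => in_piece (j%:R / K%:R : R) (j.+1%:R / K%:R) r && P r)
     (farey_list M))%N.
Proof.
move=> K0; have K0' : (0 : R) < K%:R by rewrite ltr0n.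
under eq_bigr do rewrite -sum1_count big_mkcond /=.
rewrite exchange_big /= -sum1_count big_mkcond /=; apply: eq_big_seq => r.
rewrite mem_farey_list => /and3P[r0 r1 _].
have rR : 0 <= ratr r :> R by rewrite ler0q.
pose j := Num.truncn (K%:R * ratr r : R).
have jK : (j < K)%N.
  have Kr : K%:R * ratr r < K%:R :> R.
    by rewrite gtr_pMr// -(rmorph1 (@ratr R)) ltr_rat.
  by rewrite truncn_lt_nat// mulr_ge0.
have pE (i : nat) : in_piece (i%:R / K%:R : R) (i.+1%:R / K%:R) r = (i == j).
  rewrite /in_piece ler_pdivrMr// ltr_pdivlMr// (mulrC (ratr r)) eq_sym /j.
  by rewrite truncn_eq// mulr_ge0.
rewrite (bigD1 (Ordinal jK)) //= pE eqxx /= big1 ?addn0// => i ij.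
by rewrite pE ifF//; apply: contraNF ij => /andP[/eqP e _]; apply/eqP/val_inj.
Qed.

End pieces.

(** * Dilations of the plane and the triangles *)

Section dilation.
Context {R : realType}.
Notation leb := (@lebesgue_measure R).
Notation T := (measurableTypeR R * measurableTypeR R)%type.

Definition dilate (w : R) : measurableTypeR R -> measurableTypeR R := fun x => w * x.

Lemma measurable_dilate w : measurable_fun setT (dilate w).
Proof. exact: measurable_funM. Qed.

HB.instance Definition _ w :=
  isMeasurableFun.Build _ _ _ _ (dilate w) (measurable_dilate w).

Lemma lebesgue_dilate (w : R) (w0 : 0 < w) (A : set (measurableTypeR R)) : measurable A ->
  leb A = (w%:E * leb (dilate w @^-1` A))%E.
Proof.
move=> mA.
pose k : {nonneg R} := NngNum (ltW w0).
apply: (@lebesgue_measure_unique R (mscale k (pushforward leb (dilate w)))) => //.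
move=> X [[a b] _ <-] /=.
rewrite /mscale /= /pushforward.
have -> : dilate w @^-1` `]a, b]%classic = `]a / w, b / w]%classic.
  apply/seteqP; split => x /=; rewrite /dilate !in_itv/= ltr_pdivrMr// ler_pdivlMr// mulrC//.
rewrite !lebesgue_measure_itv/= !lte_fin ltr_pM2r ?invr_gt0//.
case: ifP => ab; last by rewrite mule0.
by rewrite -EFinB -EFinM mulrBr !(mulrC w) !divfK ?gt_eqF// EFinB.
Qed.

Definition dilate2 (w : R) (p : T) : T := (dilate w p.1, dilate w p.2).

Lemma measurable_dilate2 w : measurable_fun setT (dilate2 w).
Proof.
apply: measurable_fun_pair.
  exact: (measurableT_comp (measurable_dilate w) measurable_fst).
exact: (measurableT_comp (measurable_dilate w) measurable_snd).
Qed.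

(** Fubini, with a change of variable in each coordinate. *)
Lemma lebesgue2_dilate (w : R) (w0 : 0 < w) (B : set T) : measurable B ->
  (leb \x leb)%E B = ((w ^+ 2)%:E * (leb \x leb)%E (dilate2 w @^-1` B))%E.
Proof.
move=> mB.
have mB' : measurable (dilate2 w @^-1` B).
  by rewrite -[X in measurable X]setTI; exact: measurable_dilate2.
have mphi := measurable_fun_xsection leb mB.
have mphi' := measurable_fun_xsection leb mB'.
pose k : {nonneg R} := NngNum (ltW w0).
(* Lebesgue measure is w times its image by x -> w x *)
pose nu_ := (mscale k (pushforward leb (dilate w)) :
  {measure set (measurableTypeR R) -> \bar R}).
pose nu := nu_ (measurable_dilate w).
rewrite {1}/product_measure1 /=.
rewrite (@eq_measure_integral _ _ R setT nu leb); last first.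
  by move=> A mA _; exact: (lebesgue_dilate w0 mA).
rewrite ge0_integral_mscale//=.
rewrite ge0_integral_pushforward//.
rewrite preimage_setT.
rewrite (eq_integral (fun x => w%:E * leb (xsection (dilate2 w @^-1` B) x)))%E; last first.
  move=> x _ /=; rewrite (lebesgue_dilate w0); last exact: measurable_xsection.
  congr (_ * leb _)%E; apply/seteqP; split => y; by rewrite /xsection /= !inE.
rewrite ge0_integralZl//; last by rewrite lee_fin ltW.
by rewrite muleA -EFinM -expr2.
Qed.

End dilation.

Section triangle.
Context {R : realType}.
Notation leb := (@lebesgue_measure R).
Notation T := (measurableTypeR R * measurableTypeR R)%type.
Notation leb2 := (leb \x leb)%E.

Lemma zeta2_gt0 : 0 < zeta (2 : R).
Proof. by have /andP[] := @zeta2_bounds R; lra. Qed.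

Lemma Omega_1_section (k x : R) : 0 <= k ->
  leb (xsection (Omega_ 1 `&` [set p : T | k <= p.1 * p.2]) x) = (gap_profile k x)%:E.
Proof.
move=> k0.
have [/andP[x0 x1]|nx] := boolP ((0 < x) && (x <= 1)); last first.
  rewrite /gap_profile (negbTE nx) (_ : xsection _ _ = set0) ?measure0//.
  apply/seteqP; split => y //=; rewrite /xsection /= inE => -[[/= x0 _ x1 _ _] _].
  by rewrite x0 x1 in nx.
rewrite gap_profileE//.
have kx (y : R) : (k <= x * y) = (k / x <= y) by rewrite ler_pdivrMr// mulrC.
have [h|h] := leP (k / x) (1 - x).
  rewrite (_ : xsection _ _ = `]1 - x, 1]%classic).
    rewrite lebesgue_measure_itv/= lte_fin ifT; last by lra.
    rewrite -EFinB; congr _%:E.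
    have -> : Num.min x (1 - k / x) = x by rewrite min_l//; lra.
    by rewrite max_r ?ltW//; ring.
  apply/seteqP; split => y; rewrite /xsection /= inE/= in_itv/=.
    by move=> [[/= _ y0 _ y1 xy] _]; apply/andP; split; lra.
  move=> /andP[xy y1]; split; first by split => /=; lra.
  by rewrite /= kx; lra.
rewrite (_ : xsection _ _ = `[k / x, 1]%classic).
  rewrite lebesgue_measure_itv/= lte_fin.
  have -> : Num.min x (1 - k / x) = 1 - k / x by rewrite min_r//; lra.
  case: ltP => k1; first by rewrite max_r ?EFinB//; lra.
  by rewrite max_l//; lra.
apply/seteqP; split => y; rewrite /xsection /= inE/= in_itv/=.
  by move=> [[/= _ y0 _ y1 xy]]; rewrite kx y1 andbT.
move=> /andP[xy y1]; split; last by rewrite /= kx.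
by split => /=; lra.
Qed.

Lemma leb2_hyperbola (k : R) : 0 <= k ->
  leb2 (Omega_ 1 `&` [set p : T | k <= p.1 * p.2]) = (area (gap_profile k))%:E.
Proof.
move=> k0; rewrite /product_measure1 /area /Rintegral fineK; last first.
  by apply: integrable_fin_num => //; exact: (profile_integrable (gap_profileP k0)).
rewrite integral_mkcond; apply: eq_integral => x _ /=.
rewrite Omega_1_section// patchE; case: ifPn => //; rewrite notin_setE /= in_itv/= => nx.
rewrite /gap_profile ifF//; apply/negP => /andP[x0 x1]; apply: nx.
by rewrite ltW.
Qed.

(** For k = 0 the profile is the identity on (0, 1], and its Riemann sum at N
    + 1 equals (N + 2) / 2. *)
Lemma area_gap_profile0 : area (gap_profile (0 : R)) = 1 / 2.
Proof.
have H (N : nat) : `|(N.+2%:R) / 2 - N.+1%:R * area (gap_profile (0 : R))| <= 1.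
  have N1 : (1 : R) <= N.+1%:R by rewrite ler1n.
  have := riemann_sum (gap_profileP (lexx (0 : R))) N1.
  rewrite natrK; set S := \sum_(_ <= q < _) _.
  rewrite (_ : S = N.+2%:R / 2)// /S {S}.
  have N0 : (0 : R) < N.+1%:R by rewrite ltr0n.
  transitivity ((\sum_(1 <= q < N.+2) q)%N%:R / N.+1%:R : R).
    rewrite natr_sum mulr_suml; apply: eq_big_nat => q /andP[q0 qN].
    have q0' : (0 : R) < q%:R by rewrite ltr0n.
    rewrite gap_profileE ?divr_gt0 ?ler_pdivrMr ?mul1r ?ler_nat//.
    rewrite mul0r subr0 min_l; last by rewrite ler_pdivrMr ?mul1r ?ler_nat.
    by rewrite max_r// divr_ge0// ltW.
  have : (2 * \sum_(1 <= q < N.+2) q = N.+1 * N.+2)%N.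
    elim: (N) => [|n IH]; first by rewrite big_nat1.
    by rewrite big_nat_recr//= mulnDr IH; ring.
  move/(congr1 (fun n : nat => n%:R : R)); rewrite !natrM => e.
  have -> : (\sum_(1 <= q < N.+2) q)%N%:R = N.+1%:R * N.+2%:R / 2 :> R by rewrite -e; field.
  by field; rewrite gt_eqF.
apply/eqP; rewrite -subr_eq0 -normr_eq0; apply/eqP/le_anti; rewrite normr_ge0 andbT.
rewrite leNgt; apply/negP => d0; set d := `|_| in d0.
pose N := Num.bound (3 / d).
have dN : 3 < d * N%:R.
  by rewrite mulrC -ltr_pdivrMr//; apply: archi_boundP; rewrite divr_ge0// ltW.
have := H N; rewrite -(natr1 N.+1) mulrDl -addrA.
have -> : N.+1%:R / 2 + (1 / 2 - N.+1%:R * area (gap_profile (0 : R))) =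
  1 / 2 - N.+1%:R * (area (gap_profile (0 : R)) - 1 / 2) by ring.
move=> h; have : `|N.+1%:R * (area (gap_profile (0 : R)) - 1 / 2)| <= 3 / 2.
  move: h; rewrite !ler_norml => /andP[? ?]; apply/andP; split; lra.
rewrite normrM ger0_norm// -/d -natr1 mulrDl mul1r; lra.
Qed.

Lemma leb2_Omega_1 : leb2 (Omega_ (1 : R)) = (1 / 2)%:E.
Proof.
rewrite -area_gap_profile0 -leb2_hyperbola//; congr (leb2 _).
apply/seteqP; split => [p Op|p []//]; split => //=.
by case: Op => x0 y0 _ _ _; rewrite mulr_ge0// ltW.
Qed.

Lemma dilate2_Omega (w : R) : 0 < w -> dilate2 w @^-1` Omega_ w = Omega_ 1.
Proof.
move=> w0; apply/seteqP; split => -[x y]; rewrite /Omega_ /dilate2 /dilate /=.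
  move=> [x0 y0 xw yw wxy]; split.
  - by rewrite -(pmulr_rgt0 _ w0).
  - by rewrite -(pmulr_rgt0 _ w0).
  - by rewrite -(ler_pM2l w0) mulr1.
  - by rewrite -(ler_pM2l w0) mulr1.
  - by rewrite -(ltr_pM2l w0) mulr1 mulrDr.
move=> [x0 y0 x1 y1 xy]; split.
- by rewrite mulr_gt0.
- by rewrite mulr_gt0.
- by rewrite ger_pMr.
- by rewrite ger_pMr.
- by rewrite -mulrDr ltr_pMr.
Qed.

Lemma leb2_Omega_ (w : R) : 0 < w -> leb2 (Omega_ w) = (w ^+ 2 / 2)%:E.
Proof.
move=> w0; rewrite (lebesgue2_dilate w0 (measurable_Omega_ w)) dilate2_Omega//.
by rewrite leb2_Omega_1 -EFinM; congr _%:E; field.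
Qed.

Lemma P_E (w : R) (A : set T) : 0 < w ->
  P_ w A = (leb2 (A `&` Omega_ w) * ((w ^+ 2 / 2)^-1)%:E)%E.
Proof.
move=> w0; have -> : P_ w A = mnormalize (leb_Omega_ w) (dirac ((0, 0) : T)) A by [].
rewrite /mnormalize.
have -> : leb_Omega_ w setT = (w ^+ 2 / 2)%:E by rewrite -leb2_Omega_// /leb_Omega_ /= /mrestr setTI.
by rewrite eqe gt_eqF//= divr_gt0// exprn_gt0.
Qed.

Lemma measurable_gap_le (c z : R) : measurable ([set p : T | gap_fun c p <= z]).
Proof.
rewrite (_ : mkset _ = gap_fun c @^-1` `]-oo, z]%classic).
  by rewrite -[X in measurable X]setTI; exact: measurable_funP.
by apply/seteqP; split => p /=; rewrite in_itv.
Qed.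

(** The dilation of ratio w maps Omega_1 onto Omega_w and multiplies x y by
    w^2. *)
Lemma P_gap_scaling (c w z : R) : 0 < c -> 0 < w ->
  P_ w [set p : T | gap_fun c p <= z] = P_ 1 [set p : T | gap_fun 1 p <= c^-1 * w ^+ 2 * z].
Proof.
move=> c0 w0; rewrite !P_E// (lebesgue2_dilate w0); last first.
  by apply: measurableI; [exact: measurable_gap_le|exact: measurable_Omega_].
rewrite preimage_setI dilate2_Omega//.
have -> : dilate2 w @^-1` [set p : T | gap_fun c p <= z] =
    [set p : T | gap_fun 1 p <= c^-1 * w ^+ 2 * z].
  apply/seteqP; split => -[x y]; rewrite /gap_fun /dilate2 /dilate /=.
    move=> h; have cw : 0 < c^-1 * w ^+ 2 by rewrite mulr_gt0 ?invr_gt0 ?exprn_gt0.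
    move: h; rewrite -(ler_pM2l cw); apply: le_trans.
    rewrite le_eqVlt; apply/orP; left; apply/eqP.
    rewrite !invfM; move: (x^-1) (y^-1) => x' y'.
  by field; rewrite !gt_eqF ?zeta2_gt0.
  have cw : 0 < c^-1 * w ^+ 2 by rewrite mulr_gt0 ?invr_gt0 ?exprn_gt0.
  move=> h; rewrite -(ler_pM2l cw); apply: le_trans h.
  rewrite le_eqVlt; apply/orP; left; apply/eqP.
  rewrite !invfM; move: (x^-1) (y^-1) => x' y'.
  by field; rewrite !gt_eqF ?zeta2_gt0.
rewrite muleAC expr1n -EFinM muleC; congr (_ * _%:E)%E.
by field; rewrite gt_eqF.
Qed.

(** The factor 2 normalises the area 1/2 of the triangle. *)
Lemma P1_gap_le (z : R) : 0 < z ->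
  P_ 1 [set p : T | gap_fun 1 p <= z] = (2 * area (gap_profile (2 * zeta 2 * z)^-1))%:E.
Proof.
move=> z0; have zz : 0 < 2 * zeta 2 * z by rewrite mulr_gt0// mulr_gt0// zeta2_gt0.
have z2 := zeta2_gt0.
have k0 : 0 <= (2 * zeta 2 * z)^-1 by rewrite invr_ge0 ltW.
rewrite P_E// (_ : _ `&` _ = Omega_ 1 `&` [set p : T | (2 * zeta 2 * z)^-1 <= p.1 * p.2]).
  by rewrite leb2_hyperbola// -EFinM; congr _%:E; field.
rewrite setIC; apply/seteqP; split => -[x y] [Oxy]; split => //; move: b; rewrite /gap_fun /=.
  case: Oxy => /= x0 y0 _ _ _.
  rewrite ler_pdivrMr ?mulr_gt0// => h; rewrite -div1r ler_pdivrMr//.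
  by apply: le_trans h _; rewrite le_eqVlt; apply/orP; left; apply/eqP; ring.
case: Oxy => /= x0 y0 _ _ _.
rewrite -div1r ler_pdivrMr// => h; rewrite ler_pdivrMr ?mulr_gt0//.
by apply: le_trans h _; rewrite le_eqVlt; apply/orP; left; apply/eqP; ring.
Qed.

Lemma P1_gap_le0 (z : R) : z <= 0 -> P_ 1 [set p : T | gap_fun 1 p <= z] = 0%E.
Proof.
move=> z0; rewrite P_E// (_ : _ `&` _ = set0) ?measure0 ?mul0e//.
apply/seteqP; split => // -[x y] [/= h] [/= x0 y0 _ _ _].
have := le_trans h z0; rewrite leNgt => /negP; apply.
by rewrite divr_gt0// mulr_gt0// mulr_gt0// mulr_gt0// zeta2_gt0.
Qed.

End triangle.

Section cdfs.
Context {R : realType}.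
Notation leb := (@lebesgue_measure R).
Variable u : farey_unit R.
Notation T := (measurableTypeR R * measurableTypeR R)%type.

Let setE (c z : R) : gap_fun c @^-1` `]-oo, z]%classic = [set p : T | gap_fun c p <= z].
Proof. by apply/seteqP; split => p /=; rewrite in_itv. Qed.

Lemma cdf_gap_var1E (z : R) : cdf (@gap_var1 R) z = P_ 1 [set p : T | gap_fun 1 p <= z].
Proof. by rewrite -setE. Qed.

Lemma cdf_gap_varE (z : R) : cdf (gap_var u) z =
  (\int[leb]_(s in `[0%R, 1%R])
     (P_ (unit_inv u s) [set p : T | (gap_fun (unit_mass u) p <= z)%R] * (unit_density u s)%:E))%E.
Proof. by rewrite -setE. Qed.

(** By [P_gap_scaling] with c = C and w = v(s), as m(s) = v(s)^2 / C. *)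
Theorem cdf_gap_var_mixture (z : R) :
  cdf (gap_var u) z =
  (\int[leb]_(s in `[0%R, 1%R])
     (cdf (@gap_var1 R) (unit_density u s * z)%R * (unit_density u s)%:E))%E.
Proof.
rewrite cdf_gap_varE; apply: eq_integral => s; rewrite inE => s01.
by rewrite cdf_gap_var1E P_gap_scaling ?unit_mass_gt0 ?unit_inv_gt0.
Qed.

End cdfs.

(** * Riemann sums and the modulus of continuity of the area *)

Section pieces_of_unit_interval.
Context {R : realType}.
Notation leb := (@lebesgue_measure R).

(** Heine: a continuous function on a segment is uniformly continuous. *)
Lemma segment_uniformly_continuous (f : R -> R) (eps : R) :
  {within `[0, 1], continuous f} -> 0 < eps ->
  exists2 d : R, 0 < d & forall x y, x \in `[0, 1] -> y \in `[0, 1] -> `|x - y| < d ->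
    `|f x - f y| <= eps.
Proof.
move=> /subspace_continuousP cf e0.
have cov := proj1 (compact_near_coveringP _) (@segment_compact R 0 1).
pose P (d x : R) := x \in `[0, 1] -> forall y, y \in `[0, 1] -> `|x - y| < d -> `|f x - f y| <= eps.
have [] := cov R 0^'+ P _.
  move=> x x01; have /cvgrPdist_lt/(_ (eps / 2)) := cf x x01.
  case; first by rewrite divr_gt0.
  move=> r /= r0 Hr.
  exists (ball x (r / 2), [set d | 0 < d < r / 2]).
    split; first by apply: nbhsx_ballx; rewrite divr_gt0.
    exists (r / 2) => /=; first by rewrite divr_gt0.
    by move=> d /=; rewrite sub0r normrN => dr d0; rewrite d0 (le_lt_trans (ler_norm _) dr).
  move=> [x' d] /= [bxx' /andP[d0 dr]] x'01 y y01 x'y.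
  have xx' : `|x - x'| < r / 2 by [].
  have h1 : `|f x - f x'| < eps / 2 by apply: Hr => //=; lra.
  have h2 : `|f x - f y| < eps / 2.
    apply: Hr => //=; rewrite (_ : x - y = (x - x') + (x' - y)); last by ring.
    by apply: le_lt_trans (ler_normD _ _) _; lra.
  rewrite (_ : f x' - f y = - (f x - f x') + (f x - f y)); last by ring.
  by apply: le_trans (ler_normD _ _) _; rewrite normrN; lra.
move=> r /= r0 Hr; exists (r / 2); first by rewrite divr_gt0.
move=> x y x01 y01 xy; apply: (Hr (r / 2)) => //=.
- by rewrite sub0r normrN ger0_norm ?divr_ge0 ?(ltW r0)//; lra.
- by rewrite divr_gt0.
Qed.

Lemma step_approximation (f : R -> R) (K : nat) (c : nat -> R) (eta : R) : (0 < K)%N ->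
  leb.-integrable `[0, 1] (EFin \o f) ->
  (forall j s, (j < K)%N -> j%:R / K%:R <= s <= j.+1%:R / K%:R -> `|f s - c j| <= eta) ->
  `|\int[leb]_(s in `[0, 1]) f s - \sum_(j < K) c j / K%:R| <= eta.
Proof.
move=> K0 fi H; have K0' : (0 : R) < K%:R by rewrite ltr0n.
pose J x := \int[leb]_(t in `[0, x]) f t.
have J0 : J 0 = 0 by rewrite /J set_itv1 Rintegral_set1.
have -> : \int[leb]_(s in `[0, 1]) f s = \sum_(j < K) (J (j.+1%:R / K%:R) - J (j%:R / K%:R)).
  rewrite -(big_mkord predT (fun j => J (j.+1%:R / K%:R) - J (j%:R / K%:R))).
  by rewrite (telescope_sumr (fun q => J (q%:R / K%:R)))// mul0r J0 subr0 divff// gt_eqF.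
rewrite -sumrB; apply: le_trans (ler_norm_sum _ _ _) _.
have -> : eta = \sum_(j < K) eta / K%:R.
  by rewrite sumr_const card_ord -mulr_natl; field; rewrite gt_eqF.
apply: ler_sum => j _.
have jK : j.+1%:R / K%:R - j%:R / K%:R = K%:R^-1 :> R.
  by rewrite -mulrBl -natr1 addrAC subrr add0r mul1r.
have := @Rintegral_increment R f (j%:R / K%:R) (j.+1%:R / K%:R) (c j - eta) (c j + eta) fi.
rewrite jK -/(J _) -/(J _) => inc.
have /andP[h1 h2] : (c j - eta) / K%:R <= J (j.+1%:R / K%:R) - J (j%:R / K%:R) <= (c j + eta) / K%:R.
  apply: inc.
  - by rewrite divr_ge0// ltW.
  - by rewrite ler_pM2r ?invr_gt0// ler_nat.
  - by rewrite ler_pdivrMr// mul1r ler_nat.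
  - move=> x /andP[jx xj]; have := H j x (ltn_ord j); rewrite (ltW jx) xj => /(_ isT).
    by rewrite ler_norml => /andP[? ?]; apply/andP; split; lra.
by rewrite ler_norml; apply/andP; split; lra.
Qed.

End pieces_of_unit_interval.

Section area_lipschitz.
Context {R : realType}.
Notation leb := (@lebesgue_measure R).

(** The profiles vanish for x <= k0, and beyond k0 the map k -> k / x is
    Lipschitz of constant 1 / k0. *)
Lemma gap_profile_lipschitz (k0 k k' x : R) : 0 < k0 -> k0 <= k -> k0 <= k' ->
  `|gap_profile k x - gap_profile k' x| <= `|k - k'| / k0.
Proof.
move=> k00 kk kk'; have rhs0 : 0 <= `|k - k'| / k0 by rewrite divr_ge0// ltW.
rewrite /gap_profile; case: ifP => [/andP[x0 x1]|_]; last by rewrite subrr normr0.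
have [xk|kx] := leP x k0.
  have small (h : R) : k0 <= h -> Num.max 0 (Num.min x (1 - h / x)) = 0.
    move=> kh; rewrite max_l// ge_min; apply/orP; right.
    by rewrite subr_le0 ler_pdivlMr// mul1r (le_trans xk).
  by rewrite !small// subrr normr0.
have d : `|k / x - k' / x| <= `|k - k'| / k0.
  rewrite -mulrBl normrM normfV (gtr0_norm x0) ler_wpM2l// lef_pV2 ?posrE//; exact: ltW.
move: d; set A := k / x; set B := k' / x; rewrite ler_norml => /andP[d1 d2].
have [m1 m2] : Num.min x (1 - A) - Num.min x (1 - B) <= `|k - k'| / k0 /\
   Num.min x (1 - B) - Num.min x (1 - A) <= `|k - k'| / k0.
  by case: (leP x (1 - A)) => h1; case: (leP x (1 - B)) => h2; split; lra.
rewrite ler_norml; apply/andP; move: m1 m2.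
move: (Num.min x (1 - A)) (Num.min x (1 - B)) => a b m1 m2.
by case: (leP 0 a) => h3; case: (leP 0 b) => h4; split; lra.
Qed.

Lemma area_lipschitz (k0 k k' : R) : 0 < k0 -> k0 <= k -> k0 <= k' ->
  `|area (gap_profile k) - area (gap_profile k')| <= `|k - k'| / k0.
Proof.
move=> k00 kk kk'.
have ki (h : R) : k0 <= h -> leb.-integrable `[0, 1] (EFin \o gap_profile h).
  by move=> kh; apply/profile_integrable/gap_profileP; apply: le_trans kh; exact: ltW.
have di : leb.-integrable `[0, 1] (EFin \o (fun x => gap_profile k x - gap_profile k' x)).
  have m01 : measurable (`[0, 1]%classic : set (measurableTypeR R)) by exact: measurable_itv.
  exact: (integrableB m01 (ki k kk) (ki k' kk')).
rewrite /area -RintegralB//; try exact: ki.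
have := @step_approximation R _ 1 (fun=> 0) (`|k - k'| / k0) isT di.
rewrite big_ord1 mul0r subr0; apply => j s _ _.
by rewrite subr0; exact: gap_profile_lipschitz.
Qed.

Lemma area_bounds (k : R) : 0 <= k -> 0 <= area (gap_profile k) <= 1.
Proof. by move=> k0; exact: area01 (gap_profileP k0). Qed.

(** At w = v(s)^2 this is the variation of the density of gaps, both in s over
    a piece and in k, which approaches its limit as Q grows. *)
Lemma scaled_area_lipschitz (w0 W k0 k k' w w' : R) :
  0 < w0 -> 0 < k0 -> w0 <= w -> w <= W -> w0 <= w' -> w' <= W ->
  k0 <= k -> k0 <= k' -> k <= 4 * k0 ->
  `|w * area (gap_profile (k / w)) - w' * area (gap_profile (k' / w'))| <=
  `|w - w'| * (1 + 4 * W / w0) + `|k - k'| * (W / k0).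
Proof.
move=> w00 k00 ww wW ww' w'W kk kk' k4.
have wp : 0 < w by lra. have w'p : 0 < w' by lra. have Wp : 0 < W by lra.
have kp : 0 < k by lra. have k'p : 0 < k' by lra.
have b0 : 0 < k0 / W by rewrite divr_gt0.
have b1 : k0 / W <= k / w.
  by rewrite ler_pdivrMr// mulrAC ler_pdivlMr//; apply: ler_pM => //; exact: ltW.
have b2 : k0 / W <= k' / w'.
  by rewrite ler_pdivrMr// mulrAC ler_pdivlMr//; apply: ler_pM => //; exact: ltW.
have /andP[a0 a1] := area_bounds (divr_ge0 (ltW kp) (ltW wp)).
have lip := area_lipschitz b0 b1 b2.
have -> : w * area (gap_profile (k / w)) - w' * area (gap_profile (k' / w')) =
  (w - w') * area (gap_profile (k / w)) +
  w' * (area (gap_profile (k / w)) - area (gap_profile (k' / w'))) by ring.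
apply: le_trans (ler_normD _ _) _; rewrite !normrM (ger0_norm a0) (gtr0_norm w'p).
have h1 : `|w - w'| * area (gap_profile (k / w)) <= `|w - w'| by rewrite ler_piMr.
have h2 : w' * `|area (gap_profile (k / w)) - area (gap_profile (k' / w'))| <=
    (`|k - k'| + `|w - w'| * (k / w)) * (W / k0).
  apply: le_trans (ler_wpM2l (ltW w'p) lip) _.
  have -> : w' * (`|k / w - k' / w'| / (k0 / W)) = `|w' * (k / w - k' / w')| * (W / k0).
    by rewrite normrM (gtr0_norm w'p); field; rewrite !gt_eqF.
  rewrite ler_wpM2r ?divr_ge0 ?(ltW Wp) ?(ltW k00)//.
  have -> : w' * (k / w - k' / w') = (k - k') - (w - w') * (k / w) by field; rewrite !gt_eqF.
  by apply: le_trans (ler_normB _ _) _; rewrite lerD2l normrM (ger0_norm (divr_ge0 (ltW kp) (ltW wp))).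
have h3 : k / w * (W / k0) <= 4 * W / w0.
  have -> : k / w * (W / k0) = k / k0 * W / w by field; rewrite !gt_eqF.
  apply: ler_pM.
  - by rewrite mulr_ge0 ?(ltW Wp)// divr_ge0// ltW.
  - by rewrite invr_ge0 ltW.
  - by rewrite ler_wpM2r ?(ltW Wp)// ler_pdivrMr.
  - by rewrite lef_pV2 ?posrE.
rewrite mulrDr mulr1 -addrA; apply: lerD => //; apply: le_trans h2 _.
by rewrite mulrDl [leRHS]addrC lerD2l -mulrA ler_wpM2l.
Qed.

End area_lipschitz.

(** * Comparison with classical Farey sets on short pieces *)

Section unit_asymptotics.
Context {R : realType}.
Notation leb := (@lebesgue_measure R).
Variable u : farey_unit R.
Local Notation v := (unit_inv u).
Local Notation C := (unit_mass u).
Local Notation z2 := (zeta (2 : R)).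

Lemma unit_inv_bounds : exists m M : R, 0 < m /\ forall s, s \in `[0, 1] -> m <= v s <= M.
Proof.
have [c c01 cP] := @EVT_min R v 0 1 ler01 (@unit_inv_continuous R u).
have [d d01 dP] := @EVT_max R v 0 1 ler01 (@unit_inv_continuous R u).
exists (v c), (v d); split; first exact: unit_inv_gt0.
by move=> s s01; rewrite cP// dP.
Qed.

Variables (m M : R).
Hypotheses (m0 : 0 < m) (mvM : forall s, s \in `[0, 1] -> m <= v s <= M).

Let mM : m <= M.
Proof.
have /andP[a b] : m <= v 0 <= M by apply: mvM; rewrite in_itv/= lexx ler01.
exact: le_trans b.
Qed.

Let M0 : 0 < M. Proof. exact: lt_le_trans mM. Qed.

(** The bounds are the value of v at the left end of the piece, plus or minus
    the oscillation allowed by uniform continuity, truncated to [m, M]. *)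
Lemma unit_inv_pieces (eta : R) : 0 < eta -> exists K (l L : nat -> R), (0 < K)%N /\
  forall j, (j < K)%N -> [/\ m <= l j, l j <= L j, L j <= M, L j ^+ 2 - l j ^+ 2 <= eta &
    forall s, j%:R / K%:R <= s <= j.+1%:R / K%:R -> l j <= v s <= L j].
Proof.
move=> eta0; pose d := eta / (4 * M).
have d0 : 0 < d by rewrite divr_gt0// mulr_gt0.
have [r r0 Hr] := segment_uniformly_continuous (@unit_inv_continuous R u) d0.
pose K := (Num.bound (1 / r)).+1.
have K0 : (0 : R) < K%:R by rewrite ltr0n.
have Kr : K%:R^-1 < r.
  have : 1 / r < (Num.bound (1 / r))%:R by apply: archi_boundP; rewrite divr_ge0// ltW.
  move=> h; rewrite -[ltRHS]invrK ltf_pV2 ?posrE ?invr_gt0// -div1r.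
  by apply: lt_trans h _; rewrite ltr_nat.
pose c j := v (j%:R / K%:R).
exists K, (fun j => Num.max m (c j - d)), (fun j => Num.min M (c j + d)); split => // j jK.
have p01 : (j%:R / K%:R : R) \in `[0, 1].
  by rewrite in_itv/= divr_ge0 ?(ltW K0)//= ler_pdivrMr// mul1r ler_nat ltnW.
have /andP[mc cM] := mvM p01; rewrite -/(c j) in mc cM.
split.
- by rewrite le_max lexx.
- rewrite ge_max !le_min mM; apply/andP; split; lra.
- by rewrite ge_min lexx.
- set L := Num.min _ _; set l := Num.max _ _.
  have Ll : L - l <= 2 * d.
    have : L <= c j + d by rewrite ge_min lexx orbT.
    have : c j - d <= l by rewrite le_max lexx orbT.
    lra.
  have LM : L <= M by rewrite ge_min lexx.
  have lM : l <= M by rewrite ge_max mM /=; lra.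
  have L0 : 0 < L by rewrite lt_min M0 addr_gt0// (lt_le_trans m0).
  have l0 : 0 < l by rewrite lt_max m0.
  rewrite subr_sqr; apply: (@le_trans _ _ (2 * d * (2 * M))).
    have s0 : 0 <= L + l by lra.
    apply: (@le_trans _ _ (2 * d * (L + l))); first by rewrite ler_wpM2r.
    by rewrite ler_wpM2l//; lra.
  by rewrite /d le_eqVlt; apply/orP; left; apply/eqP; field; rewrite gt_eqF.
- move=> s /andP[js sj].
  have s01 : s \in `[0, 1].
    rewrite in_itv/=; apply/andP; split; first by apply: le_trans js; rewrite divr_ge0// ltW.
    by apply: le_trans sj _; rewrite ler_pdivrMr// mul1r ler_nat.
  have /andP[ms sM] := mvM s01.
  have : `|v (j%:R / K%:R) - v s| <= d.
    apply: Hr => //; rewrite distrC ger0_norm ?subr_ge0//.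
    apply: le_lt_trans Kr; rewrite lerBlDr; apply: le_trans sj _.
    by rewrite -natr1 mulrDl mul1r addrC.
  rewrite -/(c j) ler_norml => /andP[h1 h2].
  by rewrite ge_max le_min ms sM /=; apply/andP; split; lra.
Qed.

Lemma in_fareyE (Q : nat) (r : rat) : 0 <= r < 1 ->
  in_farey u Q r = ((qden r)%:R <= Q%:R * v (ratr r)).
Proof.
move=> /andP[r0 r1].
have r01 : (ratr r : R) \in `[0, 1].
  by rewrite in_itv/= ler0q r0/= -(rmorph1 (@ratr R)) ler_rat ltW.
have u0 : 0 < u (ratr r) by exact: unit_gt0.
rewrite /unit_inv ler_pdivlMr// mulrC -qdenE.
by apply/asboolP/idP => [[]//|h]; split => //; rewrite r0.
Qed.

Lemma in_piece_unit (a b : R) r : 0 <= a -> b <= 1 -> in_piece a b r -> 0 <= r < 1.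
Proof.
move=> a0 b1 /andP[ar rb]; apply/andP; split; first by rewrite -(ler0q R) (le_trans a0).
by rewrite -(ltr_rat R) rmorph1 (lt_le_trans rb).
Qed.

(** Denominators in F_u(Q) are at most Q v, hence at most this number. *)
Definition den_bound (Q : nat) : nat := Num.truncn (Q%:R * M).

Lemma farey_set_den_bound Q r : farey_set u Q r -> (qden r <= den_bound Q)%N.
Proof.
move=> h; have r01 : 0 <= r < 1 by case: h => /andP[-> ->].
have : in_farey u Q r by exact/asboolP.
rewrite in_fareyE// => hq; rewrite truncn_ge_nat ?mulr_ge0 ?(ltW M0)//.
apply: le_trans hq _; rewrite ler_wpM2l//.
have /andP[r0 r1] := r01.
have : (ratr r : R) \in `[0, 1].
  by rewrite in_itv/= ler0q r0/= -(rmorph1 (@ratr R)) ler_rat ltW.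
by move=> /mvM /andP[].
Qed.

Lemma den_bound_le Q x : x <= M -> (Num.truncn (Q%:R * x) <= den_bound Q)%N.
Proof. by move=> xM; apply: le_truncn; rewrite ler_wpM2l. Qed.

Section one_piece.
Variables (Q K j : nat) (l L : R).
Hypotheses (jK : (j < K)%N) (ml : m <= l) (lL : l <= L) (LM : L <= M).
Hypothesis Q0 : (0 < Q)%N.
Hypothesis vlL : forall s, j%:R / K%:R <= s <= j.+1%:R / K%:R -> l <= v s <= L.
Local Notation a := (j%:R / K%:R : R).
Local Notation b := (j.+1%:R / K%:R : R).
Local Notation FL := (farey_list (den_bound Q)).

Let K0 : (0 : R) < K%:R.
Proof. by rewrite ltr0n; exact: leq_ltn_trans jK. Qed.
Let a0 : 0 <= a. Proof. by rewrite divr_ge0// ltW. Qed.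
Let ab : a <= b. Proof. by rewrite ler_pM2r ?invr_gt0// ler_nat. Qed.
Let b1 : b <= 1. Proof. by rewrite ler_pdivrMr// mul1r ler_nat. Qed.
Let l0 : 0 < l. Proof. exact: lt_le_trans ml. Qed.
Let L0 : 0 < L. Proof. exact: lt_le_trans lL. Qed.
Let QR : (0 : R) < Q%:R. Proof. by rewrite ltr0n. Qed.

Lemma piece_lower r : in_piece a b r -> farey_le (Q%:R * l) r -> in_farey u Q r.
Proof.
move=> ri; rewrite in_fareyE; last exact: in_piece_unit ri.
move=> h; apply: le_trans h _; rewrite ler_wpM2l//.
by case/andP: ri => h1 h2; have /andP[] := vlL (introT andP (conj h1 (ltW h2))).
Qed.

Lemma piece_upper r : in_piece a b r -> in_farey u Q r -> farey_le (Q%:R * L) r.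
Proof.
move=> ri; rewrite in_fareyE; last exact: in_piece_unit ri.
move=> h; apply: le_trans h _; rewrite ler_wpM2l//.
by case/andP: ri => h1 h2; have /andP[] := vlL (introT andP (conj h1 (ltW h2))).
Qed.

Lemma in_farey1E r : in_piece a b r -> in_farey1 u Q r = in_farey u Q r.
Proof.
move=> ri; rewrite /in_farey1; have /andP[_ r1] := in_piece_unit a0 b1 ri.
by rewrite lt_eqF// orbF.
Qed.

Local Notation cc X k := (consecutive_count X k a b).

(** On the piece, F_u(Q) lies between the classical Farey sets of orders Q l
    and Q L. *)
Lemma piece_count_bounds :
  cc (Q%:R * l) 0 <= (count (fun r => in_piece a b r && in_farey u Q r) FL)%:R <= cc (Q%:R * L) 0.
Proof.
have cE x : 0 < x -> x <= M -> cc (Q%:R * x) 0 =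
    (count (fun r => [&& a <= ratr r, ratr r < b & farey_le (Q%:R * x) r]) FL)%:R.
  move=> x0 xM; rewrite (@count_farey_le R)// ?den_bound_le//.
  by rewrite mulr_ge0// ltW.
rewrite !cE// ?(le_trans lL)// !ler_nat; apply/andP; split; apply: sub_count => r /=.
  move=> /and3P[h1 h2 h3]; have ri : in_piece a b r by rewrite /in_piece h1.
  by rewrite ri piece_lower.
move=> /andP[ri h]; have := piece_upper ri h.
by case/andP: (ri) => -> -> ->.
Qed.

(** Stability of the number of followed points, from the classical Farey set
    of order Q l to F_u(Q): the points added are among those of the order Q L
    which are not of order Q l. *)
Lemma piece_followed_bounds (t G E : R) : 0 < t ->
  G = (count (fun r => in_piece a b r && (in_farey u Q r &&
    `[< followed (in_farey1 u Q) t r >])) FL)%:R ->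
  E = cc (Q%:R * l) (t * (Q%:R * l) ^+ 2)^-1 ->
  E - 1 <= G <= E + 2 * (cc (Q%:R * L) 0 - cc (Q%:R * l) 0) + 1.
Proof.
move=> t0 G_def E_def.
pose F := farey_le (Q%:R * l).
have EE : E = (count (fun r => [&& in_piece a b r, F r & `[< followed F t r >]]) FL)%:R.
  rewrite E_def -(@count_farey_followed R _ t a b (den_bound Q))// ?den_bound_le ?mulr_gt0 ?(le_trans lL)//.
  by congr _%:R; apply: eq_count => r; rewrite /in_piece -andbA.
have GE : G = (count (fun r => [&& in_piece a b r, in_farey1 u Q r & `[< followed (in_farey1 u Q) t r >]]) FL)%:R.
  rewrite G_def; congr _%:R; apply: eq_count => r /=.
  by case: (boolP (in_piece a b r)) => //= ri; rewrite in_farey1E.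
have cE x : 0 < x -> x <= M -> cc (Q%:R * x) 0 =
    (count (fun r => in_piece a b r && farey_le (Q%:R * x) r) FL)%:R.
  move=> x0 xM; rewrite -(@count_farey_le R _ _ _ (den_bound Q))// ?den_bound_le//.
    by congr _%:R; apply: eq_count => r; rewrite /in_piece -andbA.
  by rewrite mulr_ge0// ltW.
apply/andP; split.
  rewrite lerBlDr EE GE natr1 ler_nat -[leqRHS]addn1; apply: followed_count_lower.
    exact: farey_list_uniq.
  by move=> r ri h; rewrite in_farey1E//; exact: piece_lower.
have up := @followed_count_upper R a b t FL (in_farey1 u Q) F (farey_list_uniq _).
have Sin r : in_piece a b r -> in_farey1 u Q r -> r \in FL.
  by move=> ri; rewrite in_farey1E// => h; apply: in_farey_list h => r'; exact: farey_set_den_bound.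
have cast (x y z : nat) : (x <= y + 2 * z + 1)%N -> x%:R <= y%:R + 2 * z%:R + 1 :> R.
  by rewrite -(ler_nat R) natrD natrD natrM.
have := cast _ _ _ (up Sin); rewrite -EE -GE => h; apply: le_trans h _.
have key : (count (fun r => [&& in_piece a b r, in_farey1 u Q r & ~~ F r]) FL +
    count (fun r => in_piece a b r && F r) FL <=
    count (fun r => in_piece a b r && farey_le (Q%:R * L) r) FL)%N.
  rewrite -count_predUI (@eq_count _ (predI _ _) pred0); last first.
    by move=> r /=; case: (F r); rewrite /= ?andbF.
  rewrite count_pred0 addn0; apply: sub_count => r /orP[/and3P[ri h _]|/andP[ri h]].
    by rewrite ri /=; rewrite in_farey1E// in h; exact: piece_upper.
  by rewrite ri /=; apply: le_trans h _; rewrite ler_wpM2l.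
move: key; rewrite -(ler_nat R) natrD -(cE l)// ?(le_trans lL)// -(cE L)//.
set D := (count _ _)%:R; set x := consecutive_count _ _ _ _; set y := consecutive_count _ _ _ _.
by move=> key; rewrite lerD2r lerD2l; lra.
Qed.

End one_piece.

End unit_asymptotics.

(** * Asymptotics of the cardinal and of the number of short gaps *)

Section unit_limits.
Context {R : realType}.
Notation leb := (@lebesgue_measure R).
Variable u : farey_unit R.
Local Notation v := (unit_inv u).
Local Notation C := (unit_mass u).
Local Notation z2 := (zeta (2 : R)).

Lemma unit_inv_sqr_continuous : {within `[0, 1], continuous (fun s => v s ^+ 2)}.
Proof.
move=> s; have uc := @unit_inv_continuous R u s.
exact: (cvg_comp v (fun x : R => x ^+ 2) uc (@exprn_continuous R 2 _)).
Qed.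

(** Divided by zeta(2), the density near s, relative to Q^2, of the points of
    F_u(Q) followed within 1 / (k Q^2): locally F_u(Q) is a classical Farey
    set of order X = Q v(s), and k Q^2 = (k / v(s)^2) X^2. *)
Definition gap_density (k : R) (s : R) : R := v s ^+ 2 * area (gap_profile (k / v s ^+ 2)).

Variables (m M : R).
Hypotheses (m0 : 0 < m) (mvM : forall s, s \in `[0, 1] -> m <= v s <= M).

Let mM : m <= M.
Proof.
have /andP[a b] : m <= v 0 <= M by apply: mvM; rewrite in_itv/= lexx ler01.
exact: le_trans b.
Qed.
Let M0 : 0 < M. Proof. exact: lt_le_trans mM. Qed.
Let mm0 : 0 < m ^+ 2. Proof. exact: exprn_gt0. Qed.

Let sqr_le (x y : R) : 0 < x -> x <= y -> x ^+ 2 <= y ^+ 2.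
Proof.
by move=> x0 xy; have y0 := lt_le_trans x0 xy; rewrite lerXn2r// nnegrE ltW.
Qed.

Let sqr_bounds (x : R) : m <= x -> x <= M -> m ^+ 2 <= x ^+ 2 <= M ^+ 2.
Proof.
move=> mx xM; have x0 : 0 < x by exact: lt_le_trans mx.
by rewrite !sqr_le.
Qed.

Lemma gap_density_continuous (k : R) : 0 < k -> {within `[0, 1], continuous (gap_density k)}.
Proof.
move=> k0; apply/subspace_continuousP => x x01.
have cx := (proj1 (subspace_continuousP _ _) unit_inv_sqr_continuous) x x01.
apply/cvgrPdist_le => e e0.
pose B := 1 + 4 * M ^+ 2 / m ^+ 2.
have B0 : 0 < B by rewrite /B addr_gt0// divr_gt0// mulr_gt0// exprn_gt0.
have /cvgrPdist_le/(_ (e / B)) := cx.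
rewrite divr_gt0// => /(_ isT) [r r0 Hr]; exists r => // y xy y01.
have := Hr y xy y01; rewrite /= => hy; rewrite /gap_density.
have /andP[mx Mx] := mvM x01; have /andP[my My] := mvM y01.
have /andP[w1 w2] := sqr_bounds mx Mx; have /andP[w3 w4] := sqr_bounds my My.
have k4 : k <= 4 * k by lra.
have := scaled_area_lipschitz mm0 k0 w1 w2 w3 w4 (lexx k) (lexx k) k4.
rewrite subrr normr0 mul0r addr0 -/B => h; apply: le_trans h _.
by rewrite -ler_pdivlMr.
Qed.

Let itg (f : R -> R) : {within `[0, 1], continuous f} -> leb.-integrable `[0, 1] (EFin \o f).
Proof. by move=> cf; apply: continuous_compact_integrable => //; exact: segment_compact. Qed.

Let sum_norm (K : nat) (F G : 'I_K -> R) (c : R) : (0 < K)%N ->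
  (forall j, `|F j - G j| <= c) -> `|\sum_j F j - \sum_j G j| <= K%:R * c.
Proof.
move=> K0 H; rewrite -sumrB; apply: le_trans (ler_norm_sum _ _ _) _.
apply: le_trans (ler_sum _ (fun j _ => H j)) _.
by rewrite sumr_const card_ord mulr_natl.
Qed.

Let zb : 1 <= z2. Proof. by have /andP[] := @zeta2_bounds R. Qed.

Let div_z2 (x y : R) : 0 <= x -> x <= y -> x / z2 <= y.
Proof.
move=> x0 xy; have y0 := le_trans x0 xy.
by rewrite ler_pdivrMr ?zeta2_gt0//; apply: le_trans xy _; rewrite ler_peMr ?zb.
Qed.

Let piece_estimate (K Q j : nat) (x dl X0 k : R) : (j < K)%N -> 0 < dl ->
  (forall X k a b, X0 <= X -> 0 <= k -> 0 <= a -> a <= b -> b <= 1 ->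
  `|consecutive_count X k a b - (b - a) * area (gap_profile k) / z2 * X ^+ 2| <=
    dl * X ^+ 2) -> 0 < x -> x <= M -> X0 <= Q%:R * x -> 0 <= k ->
  `|consecutive_count (Q%:R * x) k (j%:R / K%:R) (j.+1%:R / K%:R) -
    Q%:R ^+ 2 * (x ^+ 2 * area (gap_profile k) / z2 / K%:R)| <= Q%:R ^+ 2 * (dl * M ^+ 2).
Proof.
move=> jK dl0 H x0 xM Qx k0; have K0 : (0 : R) < K%:R by rewrite ltr0n; exact: leq_ltn_trans jK.
have := H (Q%:R * x) k (j%:R / K%:R) (j.+1%:R / K%:R) Qx k0.
rewrite divr_ge0 ?(ltW K0)// ler_pM2r ?invr_gt0// ler_nat leqnSn.
rewrite ler_pdivrMr// mul1r ler_nat jK => /(_ isT isT isT).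
have -> : (j.+1%:R / K%:R - j%:R / K%:R) * area (gap_profile k) / z2 * (Q%:R * x) ^+ 2 =
   Q%:R ^+ 2 * (x ^+ 2 * area (gap_profile k) / z2 / K%:R).
  by rewrite -natr1; field; rewrite !gt_eqF// zeta2_gt0.
move=> h; apply: le_trans h _; rewrite exprMn mulrCA ler_wpM2l ?exprn_ge0// ler_wpM2l ?(ltW dl0)//.
exact: sqr_le.
Qed.

(** Half of eps pays for the asymptotics of the K classical counts, and half
    for the variation of v^2 on the pieces; the area at k = 0 is 1/2. *)
Lemma card_estimate (eps : R) : 0 < eps -> exists Q0 : nat, forall Q, (Q0 <= Q)%N ->
  `|(farey_card u Q)%:R - Q%:R ^+ 2 * (C / (2 * z2))| <= Q%:R ^+ 2 * eps.
Proof.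
move=> eps0; pose eta := eps / 2; have eta0 : 0 < eta by rewrite divr_gt0.
have [K [l [L [K0 HK]]]] := unit_inv_pieces m0 mvM eta0.
have K0' : (0 : R) < K%:R by rewrite ltr0n.
pose dl := eps / (2 * K%:R * M ^+ 2).
have dl0 : 0 < dl by rewrite divr_gt0// !mulr_gt0// exprn_gt0.
have [X0 X01 H] := @consecutive_count_asymptotic R _ dl0.
pose Q0 := (Num.truncn (X0 / m)).+1.
exists Q0 => Q QQ.
have QX x : m <= x -> X0 <= Q%:R * x.
  move=> mx; apply: (@le_trans _ _ (Q%:R * m)); last by rewrite ler_wpM2l.
  rewrite -ler_pdivrMr// ltW//; apply: lt_le_trans (truncnS_gt _) _.
  by rewrite ler_nat.
have Qp : (0 < Q)%N by exact: leq_trans QQ.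
rewrite (@farey_cardE R u Q (den_bound M Q)); last first.
  by move=> r; exact: (farey_set_den_bound m0 mvM).
rewrite (@count_pieces R K)// natr_sum.
have pe (j : 'I_K) : `|(count (fun r => in_piece (j%:R / K%:R : R) (j.+1%:R / K%:R) r && in_farey u Q r)
     (farey_list (den_bound M Q)))%:R - Q%:R ^+ 2 * (l j ^+ 2 / 2 / z2 / K%:R)| <=
   Q%:R ^+ 2 * (dl * M ^+ 2 + eta / 2 / z2 / K%:R).
  have [ml lL LM dL vl] := HK j (ltn_ord j).
  have /andP[b1 b2] := piece_count_bounds m0 Q (ltn_ord j) ml lL LM vl.
  have l0 : 0 < l j by exact: lt_le_trans ml.
  have lM := le_trans lL LM.
  have mL := le_trans ml lL.
  have L0 := lt_le_trans l0 lL.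
  have e1 := piece_estimate (ltn_ord j) dl0 H l0 lM (QX _ ml) (lexx 0).
  have e2 := piece_estimate (ltn_ord j) dl0 H L0 LM (QX _ mL) (lexx 0).
  move: e1 e2; rewrite area_gap_profile0 !mul1r.
  have hL : Q%:R ^+ 2 * (L j ^+ 2 / 2 / z2 / K%:R) <=
     Q%:R ^+ 2 * (l j ^+ 2 / 2 / z2 / K%:R) + Q%:R ^+ 2 * (eta / 2 / z2 / K%:R).
    rewrite -mulrDr ler_wpM2l ?exprn_ge0// -!mulrDl !ler_pM2r ?invr_gt0 ?zeta2_gt0//; lra.
  rewrite [X in _ -> _ -> _ <= X]mulrDr.
  have eK : 0 <= Q%:R ^+ 2 * (eta / 2 / z2 / K%:R).
    by rewrite mulr_ge0 ?exprn_ge0// !divr_ge0 ?(ltW eta0)// ltW ?zeta2_gt0.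
  by rewrite !ler_norml => /andP[? ?] /andP[? ?]; apply/andP; split; lra.
have sn := sum_norm K0 pe.
have sa := @step_approximation R _ K (fun j => l j ^+ 2) eta K0 (itg unit_inv_sqr_continuous).
have {}sa : `|C - \sum_(j < K) l j ^+ 2 / K%:R| <= eta.
  apply: sa => j s jK js; have [ml lL LM dL vl] := HK j jK.
  have /andP[h1 h2] := vl s js.
  have l0 : 0 < l j by exact: lt_le_trans ml.
  have v0 := lt_le_trans l0 h1; have L0 := lt_le_trans l0 lL.
  have q1 : l j ^+ 2 <= v s ^+ 2 by exact: sqr_le.
  have q2 : v s ^+ 2 <= L j ^+ 2 by exact: sqr_le.
  by rewrite ler_norml; apply/andP; split; lra.
set S := \sum_(j < K) _ in sn *.
set B := \sum_(j < K) _ in sn *.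
set D := \sum_(j < K) _ in sa *.
have BE : B = Q%:R ^+ 2 * (D / (2 * z2)).
  rewrite /B /D mulr_suml mulr_sumr; apply: eq_bigr => j _.
  by field; rewrite !gt_eqF// zeta2_gt0.
rewrite (_ : S - _ = (S - B) + Q%:R ^+ 2 * ((D - C) / (2 * z2))); last by rewrite BE; ring.
apply: le_trans (ler_normD _ _) _.
have t1 : `|Q%:R ^+ 2 * ((D - C) / (2 * z2))| <= Q%:R ^+ 2 * (eta / (2 * z2)).
  have z20 : 0 < 2 * z2 by rewrite mulr_gt0// zeta2_gt0.
  rewrite normrM (ger0_norm (exprn_ge0 2 (ler0n R Q))) normrM normfV (gtr0_norm z20).
  by rewrite ler_wpM2l ?exprn_ge0// ler_pM2r ?invr_gt0// distrC.
apply: le_trans (lerD sn t1) _.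
rewrite mulrCA -mulrDr ler_wpM2l ?exprn_ge0//.
have -> : K%:R * (dl * M ^+ 2 + eta / 2 / z2 / K%:R) + eta / (2 * z2) = eps / 2 + eta / z2.
  by rewrite /dl; field; rewrite !gt_eqF// zeta2_gt0.
by have := div_z2 (ltW eta0) (lexx eta); rewrite /eta; lra.
Qed.

Definition followed_total (z : R) Q : R :=
  (count (fun r => in_farey u Q r &&
     `[< followed (in_farey1 u Q) (z / (farey_card u Q)%:R) r >]) (farey_list (den_bound M Q)))%:R.

(** A quarter of eps pays for each of the following: the asymptotics of the
    classical counts, the K boundary terms of the pieces, the variation of v^2
    on the pieces, and the replacement of k2 = n / (Q^2 z) by its limit k1,
    known by [card_estimate]. *)
Lemma followed_total_estimate (z eps : R) : 0 < z -> 0 < eps -> exists Q0 : nat, forall Q, (Q0 <= Q)%N ->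
  `|followed_total z Q - Q%:R ^+ 2 *
     ((\int[leb]_(s in `[0, 1]) gap_density (C / (2 * z2) / z) s) / z2)| <= Q%:R ^+ 2 * eps.
Proof.
move=> z0 eps0; have z20 := @zeta2_gt0 R.
pose nu := C / (2 * z2); have nu0 : 0 < nu by rewrite divr_gt0 ?unit_mass_gt0// mulr_gt0.
pose k1 := nu / z; have k10 : 0 < k1 by rewrite divr_gt0.
pose A := 1 + 4 * M ^+ 2 / m ^+ 2.
have A0 : 0 < A by rewrite /A addr_gt0// divr_gt0// mulr_gt0// exprn_gt0.
pose B := M ^+ 2 / (k1 / 2); have B0 : 0 < B by rewrite divr_gt0 ?exprn_gt0// divr_gt0.
pose eta := eps / (4 * (1 + A)); have eta0 : 0 < eta by rewrite divr_gt0// mulr_gt0// addr_gt0.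
have [K [l [L [K0 HK]]]] := unit_inv_pieces m0 mvM eta0.
have K0' : (0 : R) < K%:R by rewrite ltr0n.
pose dl := eps / (20 * K%:R * M ^+ 2).
have dl0 : 0 < dl by rewrite divr_gt0// !mulr_gt0// exprn_gt0.
have [X0 X01 H] := @consecutive_count_asymptotic R _ dl0.
(* k2 stays in the range where the area is Lipschitz, and its error,
   multiplied by the constant B, is small *)
pose ka := Num.min (k1 / 2) (eps / (4 * B)).
have ka0 : 0 < ka by rewrite lt_min divr_gt0//= divr_gt0// mulr_gt0.
have [Q1 HQ1] := card_estimate (mulr_gt0 ka0 z0).
pose Q0 := maxn (maxn Q1 (Num.truncn (X0 / m)).+1) (Num.bound (4 * K%:R / eps)).
exists Q0 => Q; rewrite !geq_max => /andP[/andP[QQ1 QQ] QK].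
have QX x : m <= x -> X0 <= Q%:R * x.
  move=> mx; apply: (@le_trans _ _ (Q%:R * m)); last by rewrite ler_wpM2l.
  rewrite -ler_pdivrMr// ltW//; apply: lt_le_trans (truncnS_gt _) _.
  by rewrite ler_nat.
have Qp : (0 < Q)%N by exact: leq_trans QQ.
have Qp' : (0 : R) < Q%:R by rewrite ltr0n.
have Qp2 : (0 : R) < Q%:R ^+ 2 by rewrite exprn_gt0.
set n := farey_card u Q.
pose k2 := n%:R / Q%:R ^+ 2 / z.
have kk : `|k2 - k1| <= ka.
  have := HQ1 Q QQ1; rewrite -/n -/nu => h.
  have -> : k2 - k1 = (n%:R - Q%:R ^+ 2 * nu) / (Q%:R ^+ 2 * z).
    by rewrite /k2 /k1; field; rewrite !gt_eqF.
  rewrite normrM normfV (gtr0_norm (mulr_gt0 Qp2 z0)) ler_pdivrMr ?mulr_gt0//.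
  by apply: le_trans h _; rewrite mulrCA mulrA.
have kb : `|k2 - k1| <= k1 / 2 by apply: le_trans kk _; rewrite ge_min lexx.
have kc : `|k2 - k1| * B <= eps / 4.
  apply: (@le_trans _ _ (eps / (4 * B) * B)).
    by rewrite ler_wpM2r ?(ltW B0)//; apply: le_trans kk _; rewrite ge_min lexx orbT.
  by rewrite le_eqVlt; apply/orP; left; apply/eqP; field; rewrite gt_eqF.
move: (kb); rewrite ler_norml => /andP[kb1 kb2].
have k20 : 0 < k2 by lra.
have n0 : (0 : R) < n%:R.
  by move: k20; rewrite /k2 pmulr_lgt0 ?invr_gt0// pmulr_lgt0 ?invr_gt0.
have t0 : 0 < z / n%:R by rewrite divr_gt0.
rewrite /followed_total -/n (@count_pieces R K)// natr_sum.
have pe (j : 'I_K) : `|(count (fun r => in_piece (j%:R / K%:R : R) (j.+1%:R / K%:R) r &&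
     (in_farey u Q r && `[< followed (in_farey1 u Q) (z / n%:R) r >]))
     (farey_list (den_bound M Q)))%:R -
     Q%:R ^+ 2 * (l j ^+ 2 * area (gap_profile (k2 / l j ^+ 2)) / z2 / K%:R)| <=
   Q%:R ^+ 2 * (5 * (dl * M ^+ 2) + eta / z2 / K%:R) + 1.
  have [ml lL LM dL vl] := HK j (ltn_ord j).
  have /andP[b1 b2] := piece_followed_bounds m0 mvM (ltn_ord j) ml lL LM Qp vl t0 erefl erefl.
  have l0 : 0 < l j by exact: lt_le_trans ml.
  have lM := le_trans lL LM.
  have mL := le_trans ml lL.
  have L0 := lt_le_trans l0 lL.
  have kE : (z / n%:R * (Q%:R * l j) ^+ 2)^-1 = k2 / l j ^+ 2.
    by rewrite /k2; field; rewrite !gt_eqF.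
  rewrite kE in b1 b2.
  have kl0 : 0 <= k2 / l j ^+ 2 by rewrite divr_ge0 ?exprn_ge0 ?ltW.
  have e1 := piece_estimate (ltn_ord j) dl0 H l0 lM (QX _ ml) (lexx 0).
  have e2 := piece_estimate (ltn_ord j) dl0 H L0 LM (QX _ mL) (lexx 0).
  have e3 := piece_estimate (ltn_ord j) dl0 H l0 lM (QX _ ml) kl0.
  move: e1 e2; rewrite area_gap_profile0 !mul1r.
  (* the points between the orders Q l and Q L enter twice *)
  have hL : 2 * (Q%:R ^+ 2 * (L j ^+ 2 / 2 / z2 / K%:R)) <=
     2 * (Q%:R ^+ 2 * (l j ^+ 2 / 2 / z2 / K%:R)) + Q%:R ^+ 2 * (eta / z2 / K%:R).
    have -> : 2 * (Q%:R ^+ 2 * (L j ^+ 2 / 2 / z2 / K%:R)) = Q%:R ^+ 2 * (L j ^+ 2 / z2 / K%:R).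
      by field; rewrite !gt_eqF.
    have -> : 2 * (Q%:R ^+ 2 * (l j ^+ 2 / 2 / z2 / K%:R)) = Q%:R ^+ 2 * (l j ^+ 2 / z2 / K%:R).
      by field; rewrite !gt_eqF.
    rewrite -mulrDr ler_wpM2l ?exprn_ge0// -!mulrDl !ler_pM2r ?invr_gt0//; lra.
  rewrite [X in _ -> _ -> _ <= X + 1]mulrDr.
  have eK : 0 <= Q%:R ^+ 2 * (eta / z2 / K%:R).
    apply: mulr_ge0; first exact: exprn_ge0.
    by apply/ltW/divr_gt0 => //; exact: divr_gt0.
  have eM : 0 <= Q%:R ^+ 2 * (dl * M ^+ 2).
    by apply: mulr_ge0; [exact: exprn_ge0|apply: mulr_ge0; [exact: ltW|apply: exprn_ge0; exact: ltW]].
  rewrite (_ : Q%:R ^+ 2 * (5 * (dl * M ^+ 2)) = 5 * (Q%:R ^+ 2 * (dl * M ^+ 2))); last by ring.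
  move: e3 b1 b2; set G := (count _ _)%:R; set E := consecutive_count _ (k2 / _) _ _.
  set e := Q%:R ^+ 2 * (dl * M ^+ 2) in eM *.
  rewrite !ler_norml => /andP[? ?] ? ? /andP[? ?] /andP[? ?]; apply/andP; split; lra.
have sn := sum_norm K0 pe.
have sa := @step_approximation R (gap_density k1) K
  (fun j => l j ^+ 2 * area (gap_profile (k2 / l j ^+ 2)))
  (eta * A + `|k2 - k1| * B) K0 (itg (gap_density_continuous k10)).
have {}sa : `|\int[leb]_(s in `[0, 1]) gap_density k1 s -
    \sum_(j < K) l j ^+ 2 * area (gap_profile (k2 / l j ^+ 2)) / K%:R| <= eta * A + `|k2 - k1| * B.
  apply: sa => j s jK js; have [ml lL LM dL vl] := HK j jK.
  have /andP[h1 h2] := vl s js.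
  have l0 : 0 < l j by exact: lt_le_trans ml.
  have v0 := lt_le_trans l0 h1; have L0 := lt_le_trans l0 lL.
  have q1 : l j ^+ 2 <= v s ^+ 2 by exact: sqr_le.
  have q2 : v s ^+ 2 <= L j ^+ 2 by exact: sqr_le.
  have /andP[w1 w2] := sqr_bounds ml (le_trans lL LM).
  have /andP[w3 w4] := sqr_bounds (le_trans ml h1) (le_trans h2 LM).
  have k120 : 0 < k1 / 2 by rewrite divr_gt0.
  have kk1 : k1 / 2 <= k1 by lra. have kk2 : k1 / 2 <= k2 by lra.
  have kk4 : k1 <= 4 * (k1 / 2) by lra.
  have := scaled_area_lipschitz mm0 k120 w3 w4 w1 w2 kk1 kk2 kk4.
  rewrite -/A -/B -/(gap_density k1 s) => h; apply: le_trans h _.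
  rewrite (distrC k1) lerD2r ler_wpM2r ?(ltW A0)// ger0_norm; lra.
set S := \sum_(j < K) _ in sn *.
set B' := \sum_(j < K) _ in sn *.
set D := \sum_(j < K) _ in sa *.
set J := \int[leb]_(s in _) _ in sa *.
have BE : B' = Q%:R ^+ 2 * (D / z2).
  rewrite /B' /D mulr_suml mulr_sumr; apply: eq_bigr => j _.
  by congr (_ * _); rewrite mulrAC.
rewrite -/nu -/k1 -/J (_ : S - _ = (S - B') + Q%:R ^+ 2 * ((D - J) / z2)); last by rewrite BE; ring.
apply: le_trans (ler_normD _ _) _.
have t1 : `|Q%:R ^+ 2 * ((D - J) / z2)| <= Q%:R ^+ 2 * ((eta * A + `|k2 - k1| * B) / z2).
  rewrite normrM (gtr0_norm Qp2) normrM normfV (gtr0_norm z20).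
  by rewrite ler_wpM2l ?exprn_ge0// ler_pM2r ?invr_gt0// distrC.
apply: le_trans (lerD sn t1) _.
have Kb : K%:R <= Q%:R ^+ 2 * (eps / 4).
  have : 4 * K%:R / eps < (Num.bound (4 * K%:R / eps))%:R.
    by apply: archi_boundP; rewrite divr_ge0 ?(ltW eps0)// mulr_ge0.
  rewrite ltr_pdivrMr// => h.
  have h2 : ((Num.bound (4 * K%:R / eps))%:R : R) <= Q%:R by rewrite ler_nat.
  have h3 : 4 * K%:R <= Q%:R * eps.
    by apply: le_trans (ltW h) _; rewrite ler_wpM2r// ltW.
  have h4 : (Q%:R : R) <= Q%:R ^+ 2 by rewrite expr2 ler_peMr// ler1n.
  have : Q%:R * eps <= Q%:R ^+ 2 * eps by rewrite ler_wpM2r// ltW.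
  lra.
have -> : K%:R * (Q%:R ^+ 2 * (5 * (dl * M ^+ 2) + eta / z2 / K%:R) + 1) =
   Q%:R ^+ 2 * (eps / 4 + eta / z2) + K%:R.
  by rewrite /dl; field; rewrite !gt_eqF.
have d1 := div_z2 (ltW eta0) (lexx eta).
have d2 : (eta * A + `|k2 - k1| * B) / z2 <= eta * A + eps / 4.
  apply: div_z2; last by rewrite lerD2l.
  by rewrite addr_ge0// mulr_ge0// ltW.
have d3 : eta + eta * A = eps / 4.
  by rewrite /eta; field; rewrite gt_eqF// addr_gt0.
have : Q%:R ^+ 2 * (eps / 4 + eta / z2) + Q%:R ^+ 2 * ((eta * A + `|k2 - k1| * B) / z2)
   <= Q%:R ^+ 2 * (3 / 4 * eps).
  by rewrite -mulrDr ler_wpM2l ?exprn_ge0//; lra.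
have -> : Q%:R ^+ 2 * (3 / 4 * eps) = Q%:R ^+ 2 * eps - Q%:R ^+ 2 * (eps / 4) by field.
lra.
Qed.

End unit_limits.

(** * The gap distribution *)

Section gap_limit.
Context {R : realType}.
Notation leb := (@lebesgue_measure R).
Variable u : farey_unit R.
Local Notation C := (unit_mass u).
Local Notation z2 := (zeta (2 : R)).

Lemma farey_gap_ratio0 Q : farey_gap_ratio u 0 Q = 0.
Proof.
have [m [M [m0 mvM]]] := unit_inv_bounds u.
rewrite (@farey_gap_ratioE R u Q (den_bound M Q)); last first.
  by move=> r; exact: (farey_set_den_bound m0 mvM).
rewrite (@eq_count _ _ pred0) ?count_pred0 ?mul0r// => r /=.
case: asboolP => [[s [_ rs]]|_]; rewrite ?andbF//.
by rewrite addr0 ler_rat leNgt rs.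
Qed.

(** With k = C / (2 zeta(2) z), the function of s in the mixture formula is 2
    / C times the density: 1 / (2 zeta(2) m(s) z) = k / v(s)^2, and the
    triangle has area 1/2. *)
Lemma gap_density_integral_cdf (z : R) : 0 < z ->
  cdf (gap_var u) z =
  (2 / C * \int[leb]_(s in `[0, 1]) gap_density u (C / (2 * z2) / z) s)%:E.
Proof.
move=> z0; have [m [M [m0 mvM]]] := unit_inv_bounds u.
have C0 := unit_mass_gt0 u; have z20 := @zeta2_gt0 R.
have k0 : 0 < C / (2 * z2) / z by rewrite divr_gt0// divr_gt0// mulr_gt0.
have gi : leb.-integrable `[0, 1] (EFin \o gap_density u (C / (2 * z2) / z)).
  apply: continuous_compact_integrable; first exact: segment_compact.
  exact: (gap_density_continuous m0 mvM k0).
rewrite cdf_gap_var_mixture EFinM /Rintegral fineK; last exact: integrable_fin_num.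
rewrite -integralZl//; apply: eq_integral => s; rewrite inE => s01.
have v0 := unit_inv_gt0 u s01.
rewrite cdf_gap_var1E P1_gap_le; last first.
  by rewrite mulr_gt0// mulr_gt0 ?invr_gt0 ?exprn_gt0.
rewrite -!EFinM /gap_density; congr _%:E.
have -> : (2 * z2 * (unit_density u s * z))^-1 = C / (2 * z2) / z / unit_inv u s ^+ 2.
  by rewrite /unit_density; field; rewrite !gt_eqF.
by rewrite /unit_density; field; rewrite gt_eqF.
Qed.

Lemma cdf_gap_var0 : cdf (gap_var u) 0 = 0%E.
Proof.
rewrite cdf_gap_var_mixture; apply: integral0_eq => s _.
by rewrite mulr0 cdf_gap_var1E P1_gap_le0// mul0e.
Qed.

Lemma cvg_sqr_rate (a : nat -> R) (l : R) :
  (forall eps, 0 < eps -> exists Q0 : nat, forall Q, (Q0 <= Q)%N ->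
     `|a Q - Q%:R ^+ 2 * l| <= Q%:R ^+ 2 * eps) ->
  (fun Q => a Q / Q%:R ^+ 2) @ \oo --> l.
Proof.
move=> H; apply/cvgrPdist_le => eps e0; have [Q0 HQ] := H _ e0.
exists (maxn Q0 1) => // Q /=; rewrite geq_max => /andP[QQ Q1].
have Q2 : (0 : R) < Q%:R ^+ 2 by rewrite exprn_gt0// ltr0n.
have -> : l - a Q / Q%:R ^+ 2 = - ((a Q - Q%:R ^+ 2 * l) / Q%:R ^+ 2).
  by field; rewrite pnatr_eq0 -lt0n.
by rewrite normrN normrM normfV (gtr0_norm Q2) ler_pdivrMr// (mulrC eps) HQ.
Qed.

(** Both counts are asymptotic to constants times Q^2; their quotient tends to
    the quotient of the constants. *)
Lemma farey_gap_ratio_cvg (z : R) : 0 < z ->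
  farey_gap_ratio u z @ \oo -->
  2 / C * \int[leb]_(s in `[0, 1]) gap_density u (C / (2 * z2) / z) s.
Proof.
move=> z0; have [m [M [m0 mvM]]] := unit_inv_bounds u.
have C0 := unit_mass_gt0 u; have z20 := @zeta2_gt0 R.
have cn := cvg_sqr_rate (fun eps e0 => card_estimate m0 mvM e0).
have cG := cvg_sqr_rate (fun eps e0 => followed_total_estimate m0 mvM z0 e0).
have nu0 : C / (2 * z2) != 0 by rewrite gt_eqF// divr_gt0// mulr_gt0.
have := cvgM cG (cvgV nu0 cn).
set I := Rintegral _ _ _.
rewrite (_ : I / z2 * (C / (2 * z2))^-1 = 2 / C * I); last by field; rewrite !gt_eqF.
move=> /(_ _ _) h; refine (cvg_trans (near_eq_cvg _) h); exists 1%N => // Q /= Q1.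
have Q2 : (Q%:R : R) ^+ 2 != 0 by rewrite expf_neq0// pnatr_eq0 -lt0n.
rewrite (@farey_gap_ratioE R u Q (den_bound M Q)); last first.
  by move=> r; exact: (farey_set_den_bound m0 mvM).
by rewrite /followed_total /= invf_div mulrA mulfVK.
Qed.

End gap_limit.

Unset Implicit Arguments.

Theorem theorem3p6 (R : realType) (u : farey_unit R) :
  [/\ forall z : R, 0 <= z -> cvgn (farey_gap_ratio u z),
      forall z : R, 0 <= z -> (cumulative_gap u z)%:E = cdf (gap_var u) z,
      forall z : R,
        cdf (gap_var u) z =
        (\int[@lebesgue_measure R]_(s in `[0%R, 1%R])
          (cdf (@gap_var1 R) (unit_density u s * z)%R *
           (unit_density u s)%:E))%E
    & forall z : R, 0 <= z ->
        (cumulative_gap u z)%:E =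
        (\int[@lebesgue_measure R]_(s in `[0%R, 1%R])
          (cdf (@gap_var1 R) (unit_density u s * z)%R *
           (unit_density u s)%:E))%E].
Proof.
have ratio0 : farey_gap_ratio u 0 = cst 0 by apply/funext => Q; exact: farey_gap_ratio0.
have lim (z : R) : 0 <= z -> (cumulative_gap u z)%:E = cdf (gap_var u) z.
  rewrite le_eqVlt => /predU1P[<-|z0].
    by rewrite cdf_gap_var0 /cumulative_gap ratio0 lim_cst.
  by rewrite gap_density_integral_cdf// /cumulative_gap (cvg_lim _ (@farey_gap_ratio_cvg R u z z0)).
split => // [z|z|z z0].
- rewrite le_eqVlt => /predU1P[<-|z0]; first by rewrite ratio0; exact: is_cvg_cst.
  by apply/cvg_ex; eexists; exact: farey_gap_ratio_cvg.
- exact: cdf_gap_var_mixture.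
- by rewrite lim// cdf_gap_var_mixture.
Qed.
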